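(* Let $d\ge 1$. Then $\frac{1}{\mathcal{H}_{\frac{d+1}{2}}(d)-\mathcal{H}_{\frac{d-1}{2}}(d)}$ is the optimal rational number such that every isolated complete intersection singularity $(X,0)\subset(\mathbb{C}^d,0)$ of codimension $1$ (i.e. every isolated hypersurface singularity) satisfies $$\frac{\mu}{\tau}\le\frac{1}{\mathcal{H}_{\frac{d+1}{2}}(d)-\mathcal{H}_{\frac{d-1}{2}}(d)},$$ where $\mu,\tau$ are the Milnor and Tjurina numbers of $(X,0)$, and where optimal means that there exists a family of such singularities for which $\frac{\mu}{\tau}$ tends to $\frac{1}{\mathcal{H}_{\frac{d+1}{2}}(d)-\mathcal{H}_{\frac{d-1}{2}}(d)}$ when the multiplicity at the origin tends to infinity.
   Context: If $(X,0)$ is defined by $f\in\mathfrak m^2$, with $\mathfrak m=(x_1,\dots,x_d)$ the maximal ideal of $R=\mathbb{C}[[x_1,\dots,x_d]]$, then $\mu=\dim_{\mathbb C}R/\left(\frac{\partial f}{\partial x_1},\dots,\frac{\partial f}{\partial x_d}\right)$ and $\tau=\dim_{\mathbb C}R/\left(f,\frac{\partial f}{\partial x_1},\dots,\frac{\partial f}{\partial x_d}\right)$; the singularity is isolated if $\tau<\infty$ (equivalently $\mu<\infty$). The multiplicity at the origin is the order of $f$, i.e. the largest $m$ with $f\in\mathfrak m^m$. For real $0\le s\le d$, $\mathcal{H}_s(d)=\sum_{i=0}^{\lfloor s\rfloor}\frac{(-1)^i}{d!}\binom{d}{i}(s-i)^d$, the Lebesgue measure of $\{(x_1,\dots,x_d)\in[0,1]^d\mid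 x_1+\dots+x_d\le s\}$. *)

(* Defs.v *)
From HB Require Import structures.
From mathcomp Require Import all_boot all_order all_algebra.
From mathcomp Require Import all_classical all_reals all_analysis.
From mathcomp Require Import complex.
(* The notations of mpoly clash with those of mathcomp-analysis. *)
From mathcomp Require Import -(notations) mpoly.

Set Implicit Arguments.
Unset Strict Implicit.
Unset Printing Implicit Defensive.

Import Order.TTheory GRing.Theory Num.Theory.

Local Open Scope classical_set_scope.
Local Open Scope ring_scope.

(* Formal power series A[[x_1, ..., x_d]], as coefficient families indexed by
   the exponents [multinom d]. The record keeps the pointwise operations of
   mathcomp-analysis on functions from being inferred on series. *)
Record fps (d : nat) (A : Type) := Fps { fcoef : multinom d -> A }.

Section FpsRing.
Variables (d : nat) (A : comNzRingType).
Local Notation S := (fps d A).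
Local Notation M := (multinom d).
Implicit Types f g h : S.

HB.instance Definition _ := [isNew for @fcoef d A].
HB.instance Definition _ := [Choice of fps d A by <:].

Lemma fpsP f g : (forall m, fcoef f m = fcoef g m) <-> f = g.
Proof.
split=> [|-> //]; case: f g => [f] [g] /= fg.
by congr Fps; apply/funext.
Qed.

Definition fps_zero : S := Fps (fun=> 0).
Definition fps_opp f : S := Fps (fun m => - fcoef f m).
Definition fps_add f g : S := Fps (fun m => fcoef f m + fcoef g m).

Fact fps_addA : associative fps_add.
Proof. by move=> f g h; apply/fpsP => m /=; rewrite addrA. Qed.
Fact fps_addC : commutative fps_add.
Proof. by move=> f g; apply/fpsP => m /=; rewrite addrC. Qed.
Fact fps_add0 : left_id fps_zero fps_add.
Proof. by move=> f; apply/fpsP => m /=; rewrite add0r. Qed.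
Fact fps_addN : left_inverse fps_zero fps_opp fps_add.
Proof. by move=> f; apply/fpsP => m /=; rewrite addNr. Qed.

HB.instance Definition _ :=
  GRing.isZmodule.Build S fps_addA fps_addC fps_add0 fps_addN.

Definition fps_one : S := Fps (fun m => (m == @mnm0 d)%:R).

(* [bmultinom d b] is the finite type of the exponents of degree < b, and
   [lem k m] means that k <= m coordinatewise. *)
Definition fps_mul f g : S :=
  Fps (fun m => \sum_(k : bmultinom d (mdeg m).+1 | lem k m)
                  fcoef f k * fcoef g (mnm_sub m k)).

Definition fps_trunc b f : mpoly d A :=
  \sum_(k : bmultinom d b) fcoef f k *: mpolyX A k.

Lemma fps_truncE b f m : (mdeg m < b)%N -> mcoeff m (fps_trunc b f) = fcoef f m.
Proof. exact: mcoeff_mpoly. Qed.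

Lemma fps_mulE b f g m : (mdeg m < b)%N ->
  fcoef (fps_mul f g) m = mcoeff m (fps_trunc b f * fps_trunc b g).
Proof.
move=> mb; rewrite [RHS](mcoeff_poly_mul_lin _ _ (ltnSn (mdeg m))) //=.
apply: eq_bigr => -[k km] /= _; rewrite !fps_truncE //.
  by apply: leq_ltn_trans mb; apply: mdegB.
exact: leq_trans km mb.
Qed.

Lemma mcoeffM_eq (p p' q q' : mpoly d A) b (m : M) : (mdeg m < b)%N ->
  (forall k : M, (mdeg k < b)%N -> mcoeff k p = mcoeff k p') ->
  (forall k : M, (mdeg k < b)%N -> mcoeff k q = mcoeff k q') ->
  mcoeff m (p * q) = mcoeff m (p' * q').
Proof.
move=> mb pp' qq'.
rewrite [LHS](mcoeff_poly_mul_lin _ _ mb) //.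
rewrite [RHS](mcoeff_poly_mul_lin _ _ mb) //.
apply: eq_bigr => -[k kb] /= _; rewrite pp' // qq' //.
by apply: leq_ltn_trans mb; apply: mdegB.
Qed.

Lemma fps_trunc_mul b f g m : (mdeg m < b)%N ->
  mcoeff m (fps_trunc b (fps_mul f g)) =
  mcoeff m (fps_trunc b f * fps_trunc b g).
Proof. by move=> mb; rewrite fps_truncE // (fps_mulE _ _ mb). Qed.

Fact fps_mulA : associative fps_mul.
Proof.
move=> f g h; apply/fpsP => m; rewrite !(fps_mulE _ _ (ltnSn (mdeg m))).
transitivity (mcoeff m (fps_trunc (mdeg m).+1 f *
  (fps_trunc (mdeg m).+1 g * fps_trunc (mdeg m).+1 h))).
  by apply: (mcoeffM_eq (ltnSn _)) => // k kb; apply: fps_trunc_mul.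
rewrite mulrA; apply: (mcoeffM_eq (ltnSn _)) => // k kb.
by rewrite fps_trunc_mul.
Qed.

Fact fps_mulC : commutative fps_mul.
Proof.
by move=> f g; apply/fpsP => m; rewrite !(fps_mulE _ _ (ltnSn (mdeg m))) mulrC.
Qed.

Fact fps_mul1 : left_id fps_one fps_mul.
Proof.
move=> f; apply/fpsP => m; rewrite (fps_mulE _ _ (ltnSn (mdeg m))).
rewrite -(fps_truncE f (ltnSn (mdeg m))) -[in RHS](mul1r (fps_trunc _ f)).
by apply: (mcoeffM_eq (ltnSn _)) => // k kb; rewrite fps_truncE // mcoeff1.
Qed.

Fact fps_mulDl : left_distributive fps_mul fps_add.
Proof.
move=> f g h; apply/fpsP => m; rewrite /= -big_split /=.
by apply: eq_bigr => k _; rewrite mulrDl.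
Qed.

Fact fps_oner_neq0 : fps_one != 0.
Proof.
apply/eqP => /fpsP/(_ (@mnm0 d)) /eqP; rewrite /= eqxx.
by rewrite oner_eq0.
Qed.

HB.instance Definition _ := GRing.Zmodule_isComNzRing.Build S
  fps_mulA fps_mulC fps_mul1 fps_mulDl fps_oner_neq0.

Definition fps_scale (a : A) f : S := Fps (fun m => a * fcoef f m).

Fact fps_scaleA a b f : fps_scale a (fps_scale b f) = fps_scale (a * b) f.
Proof. by apply/fpsP => m /=; rewrite mulrA. Qed.
Fact fps_scale1 : left_id 1 fps_scale.
Proof. by move=> f; apply/fpsP => m /=; rewrite mul1r. Qed.
Fact fps_scaleDr : right_distributive fps_scale +%R.
Proof. by move=> a f g; apply/fpsP => m /=; rewrite mulrDr. Qed.
Fact fps_scaleDl f : {morph fps_scale^~ f : a b / a + b}.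
Proof. by move=> a b; apply/fpsP => m /=; rewrite mulrDl. Qed.

HB.instance Definition _ := GRing.Zmodule_isLmodule.Build A S
  fps_scaleA fps_scale1 fps_scaleDr fps_scaleDl.

Fact fps_scaleAl (a : A) f g : a *: (f * g) = (a *: f) * g.
Proof.
apply/fpsP => m /=; rewrite mulr_sumr.
by apply: eq_bigr => k _; rewrite mulrA.
Qed.

HB.instance Definition _ := GRing.Lmodule_isLalgebra.Build A S fps_scaleAl.

Definition fps_X (i : 'I_d) : S := Fps (fun m => (m == mnm1 i)%:R).

Definition fps_deriv (i : 'I_d) f : S :=
  Fps (fun m => fcoef f (mnm_add m (mnm1 i)) *+ (m i).+1).

End FpsRing.

Section Ideals.
Variable S : comNzRingType.

Definition ideal_gen (G : set S) : set S :=
  [set h | exists (k : nat) (a g : 'I_k -> S),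
     (forall i, G (g i)) /\ h = \sum_i a i * g i].

(* For k = 0 the only generator is the empty product 1. *)
Definition ideal_pow (I : set S) (k : nat) : set S :=
  ideal_gen [set h | exists u : 'I_k -> S,
     (forall i, I (u i)) /\ h = \prod_i u i].

End Ideals.

Section QuotientDimension.
Variables (K : fieldType) (V : lmodType K).
Implicit Type I : set V.

Definition basis_mod I (k : nat) (v : 'I_k -> V) : Prop :=
  (forall c : 'I_k -> K, I (\sum_i c i *: v i) -> forall i, c i = 0) /\
  (forall g : V, exists c : 'I_k -> K, I (g - \sum_i c i *: v i)).

Definition has_quot_dim I (k : nat) : Prop :=
  exists v : 'I_k -> V, basis_mod I v.

(* dim_K (V / I), with value +oo when V / I has no finite basis *)
Definition quot_dim (R : realType) I : \bar R :=
  if `[< exists k, has_quot_dim I k >]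
  then ((xget 0%N [set k | has_quot_dim I k])%:R)%:E else +oo%E.

End QuotientDimension.

Section Singularities.
Variables (R : realType) (d : nat).
Local Notation S := (fps d R[i]).

Definition max_ideal : set S := ideal_gen (range (@fps_X d R[i])).

Definition jacobian_ideal (f : S) : set S :=
  ideal_gen (range (fun i => fps_deriv i f)).

Definition tjurina_ideal (f : S) : set S :=
  ideal_gen (f |` range (fun i => fps_deriv i f)).

Definition milnor (f : S) : \bar R := quot_dim R (jacobian_ideal f).

Definition tjurina (f : S) : \bar R := quot_dim R (tjurina_ideal f).

Definition isolated_hypersurface_sing (f : S) : Prop :=
  ideal_pow max_ideal 2 f /\ (tjurina f < +oo)%E.

(* The value is 0 when there is no largest m, that is, when f = 0. *)
Definition multiplicity (f : S) : nat :=
  xget 0%N [set m | ideal_pow max_ideal m f /\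
                    forall k, ideal_pow max_ideal k f -> (k <= m)%N].

End Singularities.

(* The Lebesgue measure of the points of [0, 1]^d with sum of coordinates <= s,
   for 0 <= s <= d. For s >= 0, [Num.truncn s] is the floor of s as a natural number. *)
Definition hypercube_vol (R : realType) (s : R) (d : nat) : R :=
  \sum_(i < (Num.truncn s).+1)
    (-1) ^+ i / (d`!)%:R * ('C(d, i))%:R * (s - i%:R) ^+ d.

Definition mu_tau_bound (R : realType) (d : nat) : R :=
  (hypercube_vol ((d%:R + 1) / 2) d - hypercube_vol ((d%:R - 1) / 2) d)^-1.

(* Main.v *)
(* Let J be the Jacobian ideal of f and I = (f) + J, and assume tau finite. On a
   component of a one-parameter deformation of the critical scheme where f is
   invertible, the trace of the chain rule contradicts f = t; hence f is nilpotent
   modulo J and mu is finite. The series ring is free of rank mu over the power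
   series in the partial derivatives, and the same argument along each line shows
   that f^p acts in a basis by matrices of order >= p - mu + 1. For a prime p,
   counting coordinates with exponents in the box [0, p)^d gives
     mu (N(u) - N(t)) <= dim R / (f^p, f_1^p, ..., f_d^p),   u = t + p + 1 - mu,
   where N(u) counts the points of the box of degree < u. If p is large, it is not
   invertible in some ring containing the finitely many relevant coefficients, and
   the Frobenius modulo p bounds the right-hand side by p^d tau. With t near
   (d-1)p/2, letting p tend to infinity gives mu w <= tau, where 1/w is the bound.

   Equality is approached by f = sum x_i^(a+1) + (sum x_i)^(a+2): here mu >= a^d,
   and (sum x_i)^(a+2) lies in I, so that by the strong Lefschetz property of
   k[x]/(x_i^a) tau is at most a difference of two box counts. *)
Require Import Defs.
From HB Require Import structures.
From mathcomp Require Import all_boot all_order all_algebra.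
From mathcomp Require Import all_classical all_reals all_analysis.
From mathcomp Require Import complex.
From mathcomp Require Import -(notations) mpoly.
From mathcomp Require Import ring lra zify.

Set Implicit Arguments.
Unset Strict Implicit.
Unset Printing Implicit Defensive.

Import Order.TTheory GRing.Theory Num.Theory.

Local Open Scope classical_set_scope.
Local Open Scope ring_scope.

Local Arguments fcoef : simpl never.


(** * Coefficients and order of power series *)

(** The constant: multiplication by [f^p] shifts degrees by about [p], and among slabs of width [p]
    in the box the central one holds the most points. This places t near (d-1)p/2, and [w] is the
    volume of the slab of width 1 centred in the unit cube. The gain of order is a quantitative form
    of the integrality of [f] over its Jacobian ideal: [f^(mu+l)] lies in the power [l+1] of that
    ideal. Orders in several variables are hard to reach by arcs, so they are tested on lines in the
    target of the gradient map, where series in one variable and determinants are available. The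
    Frobenius step: in characteristic p, flatness of the Frobenius would give exactly [p^d tau]. In
    characteristic zero an upper bound suffices, and it comes from a spanning family: relations
    known modulo [p] form a square matrix congruent to the identity, whose determinant is nonzero
    because [p] is not a unit. For finitely many coefficients to be involved, [f] is cut to a
    polynomial with the same Jacobian and Tjurina ideals. In the family, the two box counts bound a
    slab of width [a+2] that is central up to a bounded shift, whence the same constant. *)

Section Multinomials.
Variable d : nat.
Implicit Types m k : multinom d.

Lemma lem_mdeg k m : lem k m -> (mdeg k <= mdeg m)%N.
Proof. by move=> km; rewrite -(submK km) mdegD leq_addl. Qed.

Lemma mdeg_sub k m : lem k m -> (mdeg (mnm_sub m k) + mdeg k = mdeg m)%N.
Proof. by move=> km; rewrite -mdegD submK. Qed.

Lemma mnm1_le_deg (i : 'I_d) m : (m i <= mdeg m)%N.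
Proof. by rewrite mdegE (bigD1 i) //= leq_addr. Qed.

End Multinomials.

HB.instance Definition _ (d : nat) (A : comNzRingType) :=
  GRing.Lalgebra_isComAlgebra.Build A (fps d A).

Section FpsBasics.
Variables (d : nat) (A : comNzRingType).
Local Notation S := (fps d A).
Local Notation M := (multinom d).
Implicit Types (f g h : S) (m k : M).

Lemma fcoefE (F : M -> A) m : fcoef (Fps F) m = F m. Proof. by []. Qed.
Lemma fcoef_deriv i f m :
  fcoef (fps_deriv i f) m = fcoef f (mnm_add m (mnm1 i)) *+ (m i).+1.
Proof. by []. Qed.
Lemma fcoef_X (i : 'I_d) m : fcoef (fps_X A i) m = (m == mnm1 i)%:R. Proof. by []. Qed.
Lemma fcoef0 m : fcoef (0 : S) m = 0. Proof. by []. Qed.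
Lemma fcoef1 m : fcoef (1 : S) m = (m == @mnm0 d)%:R. Proof. by []. Qed.
Lemma fcoefD f g m : fcoef (f + g) m = fcoef f m + fcoef g m. Proof. by []. Qed.
Lemma fcoefN f m : fcoef (- f) m = - fcoef f m. Proof. by []. Qed.
Lemma fcoefB f g m : fcoef (f - g) m = fcoef f m - fcoef g m. Proof. by []. Qed.
Lemma fcoefZ a f m : fcoef (a *: f) m = a * fcoef f m. Proof. by []. Qed.

Lemma fcoefM f g m : fcoef (f * g) m =
  \sum_(k : bmultinom d (mdeg m).+1 | lem k m) fcoef f k * fcoef g (mnm_sub m k).
Proof. by []. Qed.

Lemma fcoef_sum I (r : seq I) (P : pred I) (F : I -> S) m :
  fcoef (\sum_(i <- r | P i) F i) m = \sum_(i <- r | P i) fcoef (F i) m.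
Proof. by apply: (big_morph (fun f => fcoef f m)). Qed.

Definition fmon (m0 : M) : S := Fps (fun m => (m == m0)%:R).

Lemma fcoef_mon m0 m : fcoef (fmon m0) m = (m == m0)%:R. Proof. by []. Qed.

Lemma fcoef_monM m0 f m :
  fcoef (fmon m0 * f) m = if lem m0 m then fcoef f (mnm_sub m m0) else 0.
Proof.
rewrite fcoefM; case: ifP => [le|nle].
  have lt : (mdeg m0 < (mdeg m).+1)%N by rewrite ltnS lem_mdeg.
  rewrite (bigD1 (BMultinom lt)) //= fcoef_mon eqxx mul1r big1 ?addr0 // => k /andP[_ ne].
  rewrite fcoef_mon; case: eqP => [e|_]; last by rewrite mul0r.
  by case/eqP: ne; apply/val_inj.
rewrite big1 // => k lek; rewrite fcoef_mon; case: eqP => [e|_]; rewrite ?mul0r //.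
by rewrite -e lek in nle.
Qed.

Lemma fmonD m m' : fmon (mnm_add m m') = fmon m * fmon m'.
Proof.
apply/fpsP => k; rewrite fcoef_monM !fcoef_mon; case: ifP => [le|nle].
  congr ((nat_of_bool _)%:R); apply/eqP/eqP => [->|e]; first by rewrite addmC addmK.
  by rewrite -e addmC submK.
case: eqP => // e; move: nle; rewrite e; move/negP; case.
by apply/mnm_lepP => i; rewrite mnmDE leq_addr.
Qed.

Lemma fmon0 : fmon (@mnm0 d) = 1. Proof. by apply/fpsP. Qed.

Lemma fps_XE (i : 'I_d) : fps_X A i = fmon (mnm1 i). Proof. by []. Qed.

Lemma fcoef_XM (i : 'I_d) f m : fcoef (fps_X A i * f) m =
  if (0 < m i)%N then fcoef f (mnm_sub m (mnm1 i)) else 0.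
Proof. by rewrite fps_XE fcoef_monM lep1mP lt0n. Qed.

Lemma fmonXn (i : 'I_d) n : fps_X A i ^+ n = fmon (mnm_muln (mnm1 i) n).
Proof.
elim: n => [|n IH]; first by rewrite expr0 mulm0n fmon0.
by rewrite exprS IH mulmS fmonD.
Qed.

Lemma fmonX m n : fmon m ^+ n = fmon (mnm_muln m n).
Proof.
elim: n => [|n IH]; first by rewrite expr0 mulm0n fmon0.
by rewrite exprS IH mulmS fmonD.
Qed.

(** A lower bound on the order rather than the order itself, so that the zero series needs no
    convention. It amounts to membership in the [n]-th power of the maximal ideal. *)
Definition ordge n f := forall m, (mdeg m < n)%N -> fcoef f m = 0.

Lemma ordge0 f : ordge 0 f. Proof. by []. Qed.
Lemma ordge_0 n : ordge n 0. Proof. by []. Qed.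

Lemma ordgeW n n' f : (n' <= n)%N -> ordge n f -> ordge n' f.
Proof. by move=> le H m lt; apply: H; apply: leq_trans le. Qed.

Lemma ordgeD n f g : ordge n f -> ordge n g -> ordge n (f + g).
Proof. by move=> Hf Hg m lt; rewrite fcoefD Hf // Hg // addr0. Qed.

Lemma ordgeN n f : ordge n f -> ordge n (- f).
Proof. by move=> Hf m lt; rewrite fcoefN Hf // oppr0. Qed.

Lemma ordgeB n f g : ordge n f -> ordge n g -> ordge n (f - g).
Proof. by move=> Hf Hg; apply: ordgeD => //; apply: ordgeN. Qed.

Lemma ordgeZ n a f : ordge n f -> ordge n (a *: f).
Proof. by move=> Hf m lt; rewrite fcoefZ Hf // mulr0. Qed.

Lemma ordge_sum n I (r : seq I) (P : pred I) (F : I -> S) :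
  (forall i, P i -> ordge n (F i)) -> ordge n (\sum_(i <- r | P i) F i).
Proof. by move=> H; apply: big_ind => //; exact: ordgeD. Qed.

Lemma ordgeM a b f g : ordge a f -> ordge b g -> ordge (a + b) (f * g).
Proof.
move=> Hf Hg m lt; rewrite fcoefM big1 // => k lek.
have [ltk|gek] := ltnP (mdeg k) a; first by rewrite Hf // mul0r.
rewrite Hg ?mulr0 //; have := mdeg_sub lek; lia.
Qed.

Lemma ordgeMl n f g : ordge n g -> ordge n (f * g).
Proof. by move=> H; apply: (@ordgeM 0 n). Qed.

Lemma ordgeMr n f g : ordge n f -> ordge n (f * g).
Proof. by rewrite mulrC; exact: ordgeMl. Qed.

Lemma ordgeX a f n : ordge a f -> ordge (n * a) (f ^+ n).
Proof.
move=> H; elim: n => [|n IH]; first by rewrite mul0n.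
by rewrite exprS mulSn; apply: ordgeM.
Qed.

Lemma ordge_mon m : ordge (mdeg m) (fmon m).
Proof. by move=> k lt; rewrite fcoef_mon; case: eqP lt => // ->; rewrite ltnn. Qed.

Lemma ordge_X i : ordge 1 (fps_X A i).
Proof. by rewrite fps_XE -(mdeg1 i); exact: ordge_mon. Qed.

Lemma ordge_eq0 f : (forall n, ordge n f) -> f = 0.
Proof. by move=> H; apply/fpsP => m; rewrite (H (mdeg m).+1). Qed.

Lemma ordge1P f : ordge 1 f <-> fcoef f (@mnm0 d) = 0.
Proof.
split=> [H|H m]; first by apply: H; rewrite mdeg0.
by rewrite ltnS leqn0 mdeg_eq0 => /eqP->.
Qed.

Lemma ordgeXn n f : ordge 1 f -> ordge n (f ^+ n).
Proof. by move/(@ordgeX 1 f n); rewrite muln1. Qed.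

(** Every monomial of [h] has an exponent at least [N] at some index of [P] and is charged to the
    least such index, so that none is counted twice. The last clauses serve later estimates: the
    quotients lose at most [N] in order and use no new coefficients, which keeps them inside a given
    subring. *)
Lemma mono_decomp (P : pred 'I_d) N h :
    (forall m, (forall i, P i -> (m i < N)%N) -> fcoef h m = 0) ->
  exists u : 'I_d -> S, h = \sum_(i | P i) fps_X A i ^+ N * u i /\
    (forall i n, ordge n h -> ordge (n - N) (u i)) /\
    forall C : set A, C 0 -> (forall m, C (fcoef h m)) -> forall i m, C (fcoef (u i) m).
Proof.
move=> H.
pose u (i : 'I_d) : S := Fps (fun m =>
  if [forall j : 'I_d, (j < i)%N ==> P j ==> (m j < N)%N]
  then fcoef h (mnm_add m (mnm_muln (mnm1 i) N)) else 0).
exists u; split; last split; first last.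
- by move=> C C0 Ch i m; rewrite /u fcoefE; case: ifP.
- move=> i n Hn m lt; rewrite /u fcoefE; case: ifP => // _; apply: Hn.
  by rewrite mdegD mdegMn mdeg1 mul1n; lia.
have cX i (w : S) m : fcoef (fps_X A i ^+ N * w) m =
    if (N <= m i)%N then fcoef w (mnm_sub m (mnm_muln (mnm1 i) N)) else 0.
  rewrite fmonXn fcoef_monM; congr (if _ then _ else _).
  apply/mnm_lepP/idP => [/(_ i)|le j]; rewrite mulmnE mnm1E; first by rewrite eqxx mul1n.
  by case: eqP => [<-|_]; rewrite ?mul1n ?mul0n.
apply/fpsP => m; rewrite fcoef_sum.
case: (pickP [pred i | P i && (N <= m i)%N]) => [i0 Hi0|none]; last first.
  rewrite H => [|i Pi]; last by have := none i; rewrite /= Pi /= ltnNge => ->.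
  by rewrite big1 // => i Pi; rewrite cX; have := none i; rewrite /= Pi /= => ->.
case: (@arg_minnP _ i0 _ (@nat_of_ord d) Hi0) => i /= /andP[Pi mi] min.
rewrite (bigD1 i) //= big1 ?addr0 => [|j /andP[Pj nj]].
  rewrite cX ifT // /u fcoefE submK; last first.
    apply/mnm_lepP => j; rewrite mulmnE mnm1E.
    by case: eqP => [<-|_]; rewrite ?mul1n ?mul0n.
  rewrite ifT //; apply/forallP => j; apply/implyP => ji; apply/implyP => Pj.
  rewrite mnmBE; case: (ltnP (m j) N) => [lt|ge]; first by apply: leq_ltn_trans lt; exact: leq_subr.
  by have := min j; rewrite Pj ge => /(_ isT); rewrite leqNgt ji.
rewrite cX; case: ifP => // mj; rewrite /u fcoefE ifF //.
apply/negP => /forallP/(_ i)/implyP; rewrite mnmBE mulmnE mnm1E (negbTE nj) mul0n subn0 Pi /=.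
move=> absurd; suff : (m i < N)%N by rewrite ltnNge; move: mi => /= ->.
apply: absurd; rewrite ltn_neqAle min ?Pj ?mj // andbT.
by apply: contra nj => /eqP e; apply/eqP/val_inj.
Qed.

Lemma ordgeS_decomp n h : ordge n.+1 h ->
  exists u : 'I_d -> S, (forall i, ordge n (u i)) /\ h = \sum_i fps_X A i * u i.
Proof.
move=> H; have [m Hm|u [hu [Hu _]]] := @mono_decomp xpredT 1 h.
  have -> : m = @mnm0 d.
    by apply/mnmP => i; rewrite mnm0E; apply/eqP; rewrite -leqn0 -ltnS Hm.
  by apply: H; rewrite mdeg0.
exists u; split=> [i|]; first by have := Hu i _ H; rewrite subn1.
by rewrite {1}hu; apply: eq_bigr => i _; rewrite expr1.
Qed.

Lemma fps_decomp b h :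
  exists2 r, ordge b r & h = \sum_(k : bmultinom d b) fcoef h k *: fmon k + r.
Proof.
exists (h - \sum_(k : bmultinom d b) fcoef h k *: fmon k); last by rewrite addrC subrK.
move=> m lt; rewrite fcoefB fcoef_sum (bigD1 (BMultinom lt)) //= fcoefZ fcoef_mon eqxx mulr1.
rewrite big1 ?addr0 ?subrr // => k nk; rewrite fcoefZ fcoef_mon; case: eqP => [e|_]; last by rewrite mulr0.
by case/eqP: nk; apply: val_inj.
Qed.

Lemma fcoef0M f g : fcoef (f * g) (@mnm0 d) = fcoef f (@mnm0 d) * fcoef g (@mnm0 d).
Proof.
have d0 : (mdeg (@mnm0 d) < (mdeg (@mnm0 d)).+1)%N by [].
rewrite fcoefM (bigD1 (BMultinom d0)) /=; last exact: lepm_refl.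
rewrite subm0 big1 ?addr0 // => k /andP[/mnm_lepP k0 nk]; case/eqP: nk.
by apply/val_inj/mnmP => i /=; rewrite mnm0E; have := k0 i; rewrite mnm0E leqn0 => /eqP.
Qed.

(** The geometric series. The coefficients of degree [n] of the inverse are read off the partial sum
    up to [g^n], since later powers have larger order. *)
Lemma geom_inverse g : ordge 1 g -> exists h, (1 - g) * h = 1.
Proof.
move=> Hg.
pose hN N : S := \sum_(n < N.+1) g ^+ n.
pose h : S := Fps (fun m => fcoef (hN (mdeg m)) m).
have hNh N : ordge N.+1 (h - hN N).
  move=> m lt; rewrite fcoefB /h fcoefE.
  suff -> : fcoef (hN N) m = fcoef (hN (mdeg m)) m by rewrite subrr.
  rewrite /hN -!(big_mkord xpredT (fun n => g ^+ n)).
  rewrite (@big_cat_nat _ _ _ (mdeg m).+1 0 N.+1) //= fcoefD [X in _ + X](_ : _ = 0) ?addr0 //.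
  rewrite fcoef_sum big_nat big1 // => n /andP[le _].
  by rewrite (ordgeXn (n := n) Hg).
exists h; apply/eqP; rewrite -subr_eq0; apply/eqP/ordge_eq0 => N.
have -> : (1 - g) * h - 1 = (1 - g) * (h - hN N) - g ^+ N.+1.
  rewrite mulrBr -addrA; congr (_ + _).
  have -> : (1 - g) * hN N = 1 - g ^+ N.+1 by rewrite -[X in X - g ^+ _](expr1n _ N.+1) subrXX; congr (_ * _); apply: eq_bigr => i _; rewrite expr1n mul1r.
  by rewrite opprB addrAC subrr add0r.
apply: ordgeB; first by apply: ordgeMl; apply: ordgeW (hNh N).
by apply: (ordgeW (n := N.+1)) => //; apply: ordgeXn.
Qed.

Lemma unit_inverse f : fcoef f (@mnm0 d) = 1 -> exists h, f * h = 1.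
Proof.
move=> f0; have [|h Hh] := @geom_inverse (1 - f).
  by apply/ordge1P; rewrite fcoefB fcoef1 eqxx f0 subrr.
by exists h; rewrite -[RHS]Hh opprB addrCA subrr addr0.
Qed.

Lemma fps_derivD i f g : fps_deriv i (f + g) = fps_deriv i f + fps_deriv i g.
Proof. by apply/fpsP => m; rewrite fcoefD !fcoef_deriv mulrnDl. Qed.

Lemma fps_derivZ i a f : fps_deriv i (a *: f) = a *: fps_deriv i f.
Proof. by apply/fpsP => m; rewrite fcoefZ !fcoef_deriv fcoefZ mulrnAr. Qed.

(** A derivative loses one degree, hence the truncation at [b.+1]. This transports the Leibniz rule
    from polynomials. *)
Lemma fps_deriv_trunc i f b m : (mdeg m < b)%N ->
  fcoef (fps_deriv i f) m = mcoeff m (mderiv i (fps_trunc b.+1 f)).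
Proof.
by move=> lt; rewrite mcoeff_mderiv fps_truncE // mdegD mdeg1 addn1 ltnS.
Qed.

Lemma fps_derivM i f g :
  fps_deriv i (f * g) = fps_deriv i f * g + f * fps_deriv i g.
Proof.
apply/fpsP => m; set b := (mdeg m).+1.
have lt : (mdeg m < b)%N by [].
rewrite (fps_deriv_trunc _ _ lt) mcoeff_mderiv fps_truncE ?mdegD ?mdeg1 ?addn1 ?ltnS //.
rewrite (fps_mulE (b := b.+1)) ?mdegD ?mdeg1 ?addn1 ?ltnS //.
rewrite -mcoeff_mderiv mderivM fcoefD mcoeffD.
congr (_ + _).
  transitivity (mcoeff m (fps_trunc b (fps_deriv i f) * fps_trunc b g)); last first.
    by rewrite -(fps_mulE _ _ lt).
  apply: (mcoeffM_eq lt) => k kb; rewrite !fps_truncE // ?(leq_trans kb) //.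
  by rewrite -fps_deriv_trunc.
transitivity (mcoeff m (fps_trunc b f * fps_trunc b (fps_deriv i g))); last first.
  by rewrite -(fps_mulE _ _ lt).
apply: (mcoeffM_eq lt) => k kb; rewrite !fps_truncE // ?(leq_trans kb) //.
by rewrite -fps_deriv_trunc.
Qed.

Lemma fps_derivX (i j : 'I_d) : fps_deriv i (fps_X A j) = (i == j)%:R.
Proof.
apply/fpsP => m; have -> : ((i == j)%:R : S) = (i == j)%:R *: 1 by case: eqP; rewrite ?scale1r ?scale0r.
rewrite fcoefZ fcoef1 fcoef_deriv fcoef_X.
have [->|nij] := eqVneq i j.
  rewrite mul1r -[X in _ == X]add0m (inj_eq (@addIm _ _)).
  by case: eqP => [->|]; rewrite ?mul0rn // mnm0E.
rewrite mul0r; case: eqP; rewrite ?mul0rn // => /mnmP/(_ i).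
by rewrite mnmDE !mnm1E eqxx eq_sym (negbTE nij) addn1.
Qed.

Lemma fps_deriv1 (i : 'I_d) : fps_deriv i (1 : S) = 0.
Proof.
by apply/fpsP => m; rewrite fcoef_deriv fcoef1 mnmD_eq0 mnm1_eq0 andbF mul0rn.
Qed.

Lemma ordge_deriv i n f : ordge n.+1 f -> ordge n (fps_deriv i f).
Proof. by move=> H m lt; rewrite fcoef_deriv H ?mul0rn // mdegD mdeg1 addn1 ltnS. Qed.

End FpsBasics.

Section FpsMap.
Variables (d : nat) (A B : comNzRingType) (phi : {rmorphism A -> B}).

Definition fps_map (f : fps d A) : fps d B := Fps (fun m => phi (fcoef f m)).

Fact fps_map_is_zmod_morphism : zmod_morphism fps_map.
Proof. by move=> f g; apply/fpsP => m; rewrite fcoefB !fcoefE rmorphB. Qed.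

Fact fps_map_is_monoid_morphism : monoid_morphism fps_map.
Proof.
split=> [|f g]; apply/fpsP => m; first by rewrite fcoefE !fcoef1 rmorph_nat.
by rewrite fcoefE !fcoefM rmorph_sum; apply: eq_bigr => k _; rewrite rmorphM.
Qed.

HB.instance Definition _ :=
  GRing.isZmodMorphism.Build (fps d A) (fps d B) fps_map fps_map_is_zmod_morphism.
HB.instance Definition _ :=
  GRing.isMonoidMorphism.Build (fps d A) (fps d B) fps_map fps_map_is_monoid_morphism.

End FpsMap.

Section ConstantTerm.
Variables (d : nat) (A : comNzRingType).

Definition fconst (f : fps d A) : A := fcoef f (@mnm0 d).

Fact fconst_is_zmod_morphism : zmod_morphism fconst.
Proof. by []. Qed.

Fact fconst_is_monoid_morphism : monoid_morphism fconst.
Proof. by split=> [|f g]; [rewrite /fconst fcoef1 eqxx | exact: fcoef0M]. Qed.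

HB.instance Definition _ :=
  GRing.isZmodMorphism.Build (fps d A) A fconst fconst_is_zmod_morphism.
HB.instance Definition _ :=
  GRing.isMonoidMorphism.Build (fps d A) A fconst fconst_is_monoid_morphism.

End ConstantTerm.

(** * Ideals of finite codimension *)

Section Ideals.
Variable S : comNzRingType.

Record ideal (I : set S) : Prop := Ideal {
  ideal0 : I 0;
  idealD : forall x y, I x -> I y -> I (x + y);
  idealM : forall a x, I x -> I (a * x) }.

Section IdealTheory.
Variables (I : set S) (idI : ideal I).

Lemma idealMr x a : I x -> I (x * a).
Proof. by move=> Ix; rewrite mulrC; apply: idealM. Qed.

Lemma idealN x : I x -> I (- x).
Proof. by move=> Ix; rewrite -mulN1r; apply: idealM. Qed.

Lemma idealB x y : I x -> I y -> I (x - y).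
Proof. by move=> Ix Iy; apply: idealD => //; apply: idealN. Qed.

Lemma ideal_sum T (r : seq T) (P : pred T) (F : T -> S) :
  (forall t, P t -> I (F t)) -> I (\sum_(t <- r | P t) F t).
Proof. by move=> H; apply: big_ind => //; [exact: ideal0 | exact: idealD]. Qed.

Lemma ideal_eqM x x' y y' : I (x - x') -> I (y - y') -> I (x * y - x' * y').
Proof.
move=> Ix Iy; have -> : x * y - x' * y' = y * (x - x') + x' * (y - y') by ring.
by apply: idealD => //; apply: idealM.
Qed.

Lemma ideal_eqX x x' n : I (x - x') -> I (x ^+ n - x' ^+ n).
Proof.
move=> Ix; elim: n => [|n IH]; first by rewrite subrr; apply: ideal0.
by rewrite !exprS; apply: ideal_eqM.
Qed.

Lemma ideal_trans x y z : I (x - y) -> I (y - z) -> I (x - z).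
Proof. by move=> h1 h2; rewrite -[x](subrK y) -addrA; apply: idealD. Qed.

Lemma ideal_sym x y : I (x - y) -> I (y - x).
Proof. by move=> h; rewrite -opprB; apply: idealN. Qed.

Lemma ideal_eq x y : I (x - y) -> I y -> I x.
Proof. by move=> h Iy; rewrite -[x](subrK y); apply: idealD. Qed.

End IdealTheory.

Definition idl n (g : 'I_n -> S) : set S :=
  [set h | exists a : 'I_n -> S, h = \sum_i a i * g i].

Lemma idl_ideal n (g : 'I_n -> S) : ideal (idl g).
Proof.
split=> [|x y [a ->] [b ->]|c x [a ->]].
- by exists (fun=> 0); rewrite big1 // => i _; rewrite mul0r.
- by exists (fun i => a i + b i); rewrite -big_split; apply: eq_bigr => i _; rewrite mulrDl.
- by exists (fun i => c * a i); rewrite mulr_sumr; apply: eq_bigr => i _; rewrite mulrA.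
Qed.

Lemma idl_mem n (g : 'I_n -> S) i : idl g (g i).
Proof.
exists (fun j => (j == i)%:R); rewrite (bigD1 i) //= eqxx mul1r big1 ?addr0 // => j /negbTE->.
by rewrite mul0r.
Qed.

Lemma idl_min n (g : 'I_n -> S) (I : set S) :
  ideal I -> (forall i, I (g i)) -> idl g `<=` I.
Proof. by move=> idI gI _ [a ->]; apply: ideal_sum => // i _; apply: idealM. Qed.

Definition fcons n (f : S) (g : 'I_n -> S) (i : 'I_n.+1) : S :=
  if unlift ord0 i is Some j then g j else f.

Lemma fcons0 n f (g : 'I_n -> S) : fcons f g ord0 = f.
Proof. by rewrite /fcons unlift_none. Qed.

Lemma fconsS n f (g : 'I_n -> S) i : fcons f g (lift ord0 i) = g i.
Proof. by rewrite /fcons liftK. Qed.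

Lemma fcons_ind n f (g : 'I_n -> S) (P : S -> Prop) :
  P f -> (forall i, P (g i)) -> forall i, P (fcons f g i).
Proof. by move=> Pf Pg i; rewrite /fcons; case: unliftP. Qed.

Lemma ideal_gen_ideal (G : set S) : ideal (ideal_gen G).
Proof.
split=> [|x y [k [a [g [Gg ->]]]] [l [b [h [Gh ->]]]]|c x [k [a [g [Gg ->]]]]].
- by exists 0%N, (fun=> 0), (fun=> 0); split=> [[]//|]; rewrite big_ord0.
- exists (k + l)%N, (fun i => match fintype.split i with inl j => a j | inr j => b j end),
    (fun i => match fintype.split i with inl j => g j | inr j => h j end); split=> [i|].
    by case: fintype.split.
  rewrite big_split_ord /=; congr (_ + _); apply: eq_bigr => i _.
    by rewrite (unsplitK (inl _ i)).
  by rewrite (unsplitK (inr _ i)).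
- by exists k, (fun i => c * a i), g; split=> //; rewrite mulr_sumr; apply: eq_bigr => i _; rewrite mulrA.
Qed.

Lemma ideal_gen_mem (G : set S) x : G x -> ideal_gen G x.
Proof.
by move=> Gx; exists 1%N, (fun=> 1), (fun=> x); split=> //; rewrite big_ord1 mul1r.
Qed.

Lemma ideal_gen_min (G I : set S) : ideal I -> G `<=` I -> ideal_gen G `<=` I.
Proof.
move=> idI GI x [k [a [g [Gg ->]]]].
by apply: ideal_sum => // i _; apply: idealM => //; apply: GI.
Qed.

Lemma ideal_gen_range n (g : 'I_n -> S) : ideal_gen (range g) = idl g.
Proof.
apply/seteqP; split.
  by apply: ideal_gen_min; [exact: idl_ideal | move=> _ [i _ <-]; exact: idl_mem].
apply: idl_min; first exact: ideal_gen_ideal.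
by move=> i; apply: ideal_gen_mem; exists i.
Qed.

Lemma ideal_gen_cons n f (g : 'I_n -> S) :
  ideal_gen (f |` range g) = idl (fcons f g).
Proof.
apply/seteqP; split.
  apply: ideal_gen_min; first exact: idl_ideal.
  move=> x [->|[i _ <-]]; first by rewrite -[X in idl _ X](fcons0 f g); exact: idl_mem.
  by rewrite -[X in idl _ X](fconsS f g); exact: idl_mem.
apply: idl_min; first exact: ideal_gen_ideal.
by apply: fcons_ind => [|i]; apply: ideal_gen_mem; [left | right; exists i].
Qed.

Lemma ideal_powS (I : set S) n x y :
  I x -> ideal_pow I n y -> ideal_pow I n.+1 (x * y).
Proof.
move=> Ix [k [a [g [Gg ->]]]].
exists k, a, (fun i => x * g i); split=> [i|].
  have [u [Iu ->]] := Gg i.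
  exists (fcons x u); split; first by apply: (fcons_ind (P := I)).
  by rewrite big_ord_recl fcons0; congr (_ * _); apply: eq_bigr => j _; rewrite fconsS.
by rewrite mulr_sumr; apply: eq_bigr => i _; rewrite mulrCA.
Qed.

End Ideals.

(** * Linear algebra modulo a subspace *)

Section QuotientLinearAlgebra.
Variables (K : fieldType) (V : lmodType K).

Record subsp (I : set V) : Prop := Subsp {
  subsp0 : I 0;
  subspD : forall x y, I x -> I y -> I (x + y);
  subspZ : forall (a : K) x, I x -> I (a *: x) }.

Definition spans (I : set V) (T : finType) (v : T -> V) :=
  forall g : V, exists c : T -> K, I (g - \sum_t c t *: v t).

Definition indep (I : set V) (T : finType) (v : T -> V) :=
  forall c : T -> K, I (\sum_t c t *: v t) -> forall t, c t = 0.

Variables (I : set V) (sI : subsp I).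

Lemma subsp_sum T (r : seq T) (P : pred T) (F : T -> V) :
  (forall t, P t -> I (F t)) -> I (\sum_(t <- r | P t) F t).
Proof. by move=> H; apply: big_ind => //; [exact: subsp0 | exact: subspD]. Qed.

(** The Steinitz bound modulo [I]: with too many independent vectors, the matrix of their
    coordinates has a nonzero left kernel, which is a relation. *)
Lemma indep_le_spans (T U : finType) (v : T -> V) (w : U -> V) :
  indep I v -> spans I w -> (#|T| <= #|U|)%N.
Proof.
move=> iv sw; rewrite leqNgt; apply/negP => lt.
have [C HC] : exists C : T -> U -> K, forall t, I (v t - \sum_s C t s *: w s).
  by exists (fun t => projT1 (cid (sw (v t)))) => t; exact: projT2 (cid (sw (v t))).
pose M := \matrix_(i < #|T|, j < #|U|) C (enum_val i) (enum_val j).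
have : kermx M != 0.
  by rewrite kermx_eq0 /row_free; apply: contraTneq lt => <-; rewrite -leqNgt rank_leq_col.
case/rowV0Pn => u /sub_kermxP uM nz.
pose c t := u ord0 (enum_rank t).
suff c0 : forall t, c t = 0.
  case/eqP: nz; apply/rowP => i; rewrite mxE -(enum_valK i).
  exact: c0.
apply: iv.
have -> : \sum_t c t *: v t = \sum_t c t *: (v t - \sum_s C t s *: w s).
  apply/esym/eqP; rewrite -subr_eq0 -sumrB; apply/eqP.
  under eq_bigr do rewrite -scalerBr addrAC subrr add0r scalerN scaler_sumr.
  rewrite sumrN exchange_big /= big1 ?oppr0 // => s _.
  under eq_bigr do rewrite scalerA.
  rewrite -scaler_suml [X in X *: _](_ : _ = 0) ?scale0r //.
  have := congr1 (fun A : 'rV_#|U| => A ord0 (enum_rank s)) uM.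
  rewrite !mxE (reindex (@enum_rank T)) /=; last exact: onW_bij (enum_rank_bij T).
  by move=> E; rewrite -[RHS]E; apply: eq_bigr => t _; rewrite mxE !enum_rankK.
by apply: subsp_sum => t _; apply: subspZ.
Qed.

Lemma spans_basis n (w : 'I_n -> V) :
  spans I w -> exists k, (k <= n)%N /\ has_quot_dim I k.
Proof.
elim: n w => [|n IH] w sw.
  exists 0%N; split=> //; exists w; split=> // c _ [] //.
have [iw|] := pselect (indep I w); first by exists n.+1; split=> //; exists w.
move/existsNP => [c] /not_implyP[Ic] /existsNP[j] /eqP cj.
have [|k [le Hk]] := IH (fun i => w (lift j i)); last by exists k; split=> //; apply: leqW.
move=> g; have [b Hb] := sw g.
exists (fun i => b (lift j i) - b j / c j * c (lift j i)).
have -> : g - \sum_i (b (lift j i) - b j / c j * c (lift j i)) *: w (lift j i)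
  = (g - \sum_i b i *: w i) + (b j / c j) *: \sum_i c i *: w i.
  rewrite (bigD1_ord j (F := fun i => b i *: w i)) //=.
  rewrite (bigD1_ord j (F := fun i => c i *: w i)) //=.
  under eq_bigr do rewrite scalerBl -scalerA.
  rewrite sumrB -scaler_sumr scalerDr scalerA divfK //.
  rewrite opprB opprD -[RHS]addrA addrACA addNr add0r; congr (_ + _).
  by rewrite addrC.
by apply: subspD => //; apply: subspZ.
Qed.

End QuotientLinearAlgebra.

Section SpanSubspace.
Variables (K : fieldType) (V : lmodType K) (I : set V) (T : finType) (e : T -> V).
Hypothesis sI : subsp I.

Definition span_mod : set V := [set h | exists c : T -> K, I (h - \sum_t c t *: e t)].

Lemma span_mod_subsp : subsp span_mod.
Proof.
split=> [|x y [c hc] [c' hc']|b x [c hc]].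
- exists (fun=> 0); rewrite big1 ?subrr; first exact: subsp0.
  by move=> q _; rewrite scale0r.
- exists (fun q => c q + c' q); under eq_bigr do rewrite scalerDl.
  by rewrite big_split opprD addrACA; exact: subspD.
exists (fun q => b * c q); under eq_bigr do rewrite -scalerA.
by rewrite -scaler_sumr -scalerBr; exact: subspZ.
Qed.

Lemma span_mod_sub x : I x -> span_mod x.
Proof. by move=> Ix; exists (fun=> 0); rewrite big1 ?subr0 // => q _; exact: scale0r. Qed.

Lemma span_mod_gen t : span_mod (e t).
Proof.
exists (fun q => (q == t)%:R); rewrite (bigD1 t) //= eqxx scale1r big1 ?addr0 ?subrr.
  exact: subsp0.
by move=> q /negbTE ->; rewrite scale0r.
Qed.

End SpanSubspace.

Section FpsIdeals.
Variables (d : nat) (K : fieldType).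
Local Notation S := (fps d K).
Implicit Types (I : set S).

Lemma ideal_subsp I : ideal I -> subsp I.
Proof.
move=> idI; split=> [|x y|a x Ix]; [exact: ideal0 | exact: idealD | ].
by rewrite -mulr_algl; apply: idealM.
Qed.

Lemma ordge_ideal n : ideal [set h : S | ordge n h].
Proof. by split=> [|x y|a x]; [exact: ordge_0 | exact: ordgeD | exact: ordgeMl]. Qed.

Lemma max_idealE : ideal_gen (range (@fps_X d K)) = [set h | ordge 1 h].
Proof.
rewrite ideal_gen_range; apply/seteqP; split.
  by apply: idl_min => [|i]; [exact: ordge_ideal | exact: ordge_X].
move=> h /ordgeS_decomp[u [_ ->]]; exists u.
by apply: eq_bigr => i _; rewrite mulrC.
Qed.

Lemma max_ideal_powE n :
  ideal_pow (ideal_gen (range (@fps_X d K))) n = [set h : S | ordge n h].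
Proof.
rewrite max_idealE; apply/seteqP; split.
  apply: ideal_gen_min; first exact: ordge_ideal.
  move=> _ [u [Hu ->]] /=; elim: n u Hu => [|n IH] u Hu; first exact: ordge0.
  rewrite big_ord_recl; apply: (@ordgeM _ _ 1 n); first exact: Hu.
  by apply: IH => i; apply: Hu.
elim: n => [|n IH] h.
  move=> _; exists 1%N, (fun=> h), (fun=> 1); split; last by rewrite big_ord1 mulr1.
  by move=> _; exists (fun=> 0); split=> [[]//|]; rewrite big_ord0.
move=> /= /ordgeS_decomp[u [Hu ->]].
apply: ideal_sum => [|i _]; first exact: ideal_gen_ideal.
by apply: ideal_powS; [exact: ordge_X | apply: IH; apply: Hu].
Qed.

(* A power of each variable lies in [I], by linear dependence of its powers. *)
Lemma fin_codim_primary I (T : finType) (e : T -> S) : ideal I -> spans I e ->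
  forall i, I (fps_X K i ^+ #|T|).
Proof.
move=> idI se i; set X := fps_X K i.
have [ix|] := pselect (indep I (fun j : 'I_#|T|.+1 => X ^+ j)).
  have := indep_le_spans (ideal_subsp idI) ix se.
  by rewrite card_ord ltnn.
move/existsNP => [c] /not_implyP[Ic] /existsNP[j0] /eqP cj0.
(* With [j] the lowest exponent in the relation, its left-hand side is [X^j] times a unit. *)
case: (@arg_minnP _ j0 (fun j => c j != 0) (@nat_of_ord _) cj0) => j cj minj.
suff Ij : I (X ^+ j).
  rewrite -(subnK (ltn_ord j : (j <= #|T|)%N)) exprD; exact: idealM.
pose v : S := \sum_(t < #|T|.+1 | (j <= t)%N) (c t / c j) *: X ^+ (t - j).
have v0 : fcoef v (@mnm0 d) = 1.
  rewrite /v (bigD1 j) //= fcoefD subnn expr0 fcoefZ fcoef1 eqxx divff // mulr1.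
  rewrite fcoef_sum big1 ?addr0 // => t /andP[le ne]; rewrite fcoefZ.
  rewrite (@ordgeXn _ _ (t - j)) ?mulr0 //; first exact: ordge_X.
  by rewrite mdeg0 subn_gt0 ltn_neqAle eq_sym le ne.
have [w Hw] := unit_inverse v0.
rewrite -[X ^+ j]mulr1 -Hw mulrA; apply: idealMr => //.
have -> : X ^+ j * v = (c j)^-1 *: \sum_t c t *: X ^+ t.
  rewrite /v mulr_sumr scaler_sumr [RHS](bigID (fun t : 'I__ => (j <= t)%N)) /=.
  rewrite [X in _ + X]big1 ?addr0 => [|t nle].
    apply: eq_bigr => t le; rewrite -scalerAr -exprD subnKC // scalerA.
    by rewrite mulrC.
  have [->|ct] := eqVneq (c t) 0; first by rewrite scale0r scaler0.
  by have := minj t ct; rewrite (negbTE nle).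
by apply: (subspZ (ideal_subsp idI)).
Qed.

(** Pigeonhole: a monomial of degree above [d * N] has an exponent at least [N]. *)
Lemma ordge_mono_ideal I N : ideal I -> (forall i, I (fps_X K i ^+ N)) ->
  forall h, ordge (d * N).+1 h -> I h.
Proof.
move=> idI HI h Hh.
have [m Hm|u [-> _]] := @mono_decomp d K xpredT N h.
  apply: Hh; rewrite ltnS mdegE -[X in (_ <= X * _)%N]card_ord -sum_nat_const.
  by apply: leq_sum => i _; apply/ltnW/Hm.
by apply: ideal_sum => // i _; apply: idealMr => //; apply: HI.
Qed.

Lemma fin_codim_ordge I (T : finType) (e : T -> S) : ideal I -> spans I e ->
  exists L, forall h, ordge L h -> I h.
Proof.
move=> idI se; exists (d * #|T|).+1 => h.
by apply: ordge_mono_ideal => // i; apply: fin_codim_primary se _.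
Qed.

(** The determinant trick: the matrix [1 - s] is the identity modulo the maximal ideal, so its
    determinant is a unit and its adjugate recovers [y] from elements of [I]. *)
Lemma nakayama I n (y : 'I_n -> S) : ideal I ->
    (forall l, exists s : 'I_n -> S, (forall k, ordge 1 (s k)) /\
       I (y l - \sum_k s k * y k)) ->
  forall l, I (y l).
Proof.
move=> idI Hy.
pose s l := projT1 (cid (Hy l)).
have sP l : (forall k, ordge 1 (s l k)) /\ I (y l - \sum_k s l k * y k) := projT2 (cid (Hy l)).
pose B : 'M[S]_n := 1%:M - \matrix_(l, k) s l k.
pose Y : 'cV[S]_n := \col_l y l.
have BY l : I ((B *m Y) l ord0).
  rewrite mulmxBl mul1mx !mxE.
  under eq_bigr do rewrite !mxE.
  exact: (sP l).2.
have detB : fcoef (\det B) (@mnm0 d) = 1.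
  rewrite -[LHS]/(fconst (\det B)) -det_map_mx.
  suff -> : map_mx (@fconst d K) B = 1%:M by rewrite det1.
  apply/matrixP => i j; rewrite !mxE rmorphB rmorph_nat [X in _ - X](_ : _ = 0) ?subr0 //.
  by apply/ordge1P; exact: (sP i).1.
have [w Hw] := unit_inverse detB.
move=> l; have -> : y l = w * (\adj B *m (B *m Y)) l ord0.
  by rewrite mulmxA mul_adj_mx mul_scalar_mx !mxE mulrA [w * _]mulrC Hw mul1r.
apply: idealM => //; rewrite mxE; apply: ideal_sum => // k _.
exact: idealM.
Qed.

End FpsIdeals.

(** * Koszul complexes *)

Section Koszul.
Variable S : comNzRingType.
Implicit Types (fs hs : seq S) (c u : seq bool -> S) (s : seq bool).

(* A chain over [f :: fs] is a pair (a, b) of chains over [fs], standing for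
   a + e_f /\ b; the two components sit at the words starting with [false]
   and [true]. *)
Fixpoint kosz fs c s : S :=
  match fs, s with
  | f :: fs', false :: s' =>
      kosz fs' (fun t => c (false :: t)) s' + f * c (true :: s')
  | f :: fs', true :: s' => - kosz fs' (fun t => c (true :: t)) s'
  | _, _ => 0
  end.

(** Words of length [n] encode subsets of the generators, so these are the chains in the exterior
    power of degree [i]. *)
Definition kdeg n i c :=
  forall s, ~~ ((size s == n) && (count id s == i)) -> c s = 0.

Lemma eq_kosz fs c c' : c =1 c' -> kosz fs c =1 kosz fs c'.
Proof.
elim: fs c c' => [|f fs IH] c c' e [|[] s] //=.
  by congr (- _); apply: IH => t; apply: e.
by rewrite e; congr (_ + _); apply: IH => t; apply: e.
Qed.

Lemma koszD fs c c' s :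
  kosz fs (fun t => c t + c' t) s = kosz fs c s + kosz fs c' s.
Proof.
elim: fs c c' s => [|f fs IH] c c' [|[] s] //=; rewrite ?addr0 //.
  by rewrite IH opprD.
by rewrite IH mulrDr addrACA.
Qed.

Lemma koszZ fs a c s : kosz fs (fun t => a * c t) s = a * kosz fs c s.
Proof.
elim: fs c s => [|f fs IH] c [|[] s] //=; rewrite ?mulr0 //.
  by rewrite IH mulrN.
by rewrite IH mulrDr mulrCA.
Qed.

Lemma koszN fs c s : kosz fs (fun t => - c t) s = - kosz fs c s.
Proof.
rewrite -mulN1r -koszZ; apply: eq_kosz => t; by rewrite mulN1r.
Qed.

Lemma koszB fs c c' s :
  kosz fs (fun t => c t - c' t) s = kosz fs c s - kosz fs c' s.
Proof. by rewrite koszD koszN. Qed.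

Lemma kosz_ideal (I : set S) fs c : ideal I ->
  (forall s, I (c s)) -> forall s, I (kosz fs c s).
Proof.
move=> idI; elim: fs c => [|f fs IH] c Hc [|[] s] /=; try exact: ideal0.
  by apply: idealN => //; apply: IH.
by apply: idealD => //; [apply: IH | apply: idealM].
Qed.

Lemma kosz_kosz fs c s : kosz fs (kosz fs c) s = 0.
Proof.
elim: fs c s => [|f fs IH] c [|[] s] //=.
  by rewrite koszN IH !oppr0.
by rewrite koszD IH add0r koszZ mulrN subrr.
Qed.

Lemma kosz_eq0 fs c : (forall s, c s = 0) -> forall s, kosz fs c s = 0.
Proof.
move=> c0 s; rewrite (@eq_kosz _ _ (fun t => 0 * c t)) ?koszZ ?mul0r // => t.
by rewrite mul0r c0.
Qed.

Lemma kdeg_false n i c : kdeg n.+1 i c -> kdeg n i (fun t => c (false :: t)).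
Proof. by move=> H s Hs; apply: H; rewrite /= eqSS add0n. Qed.

Lemma kdeg_true n i c : kdeg n.+1 i.+1 c -> kdeg n i (fun t => c (true :: t)).
Proof. by move=> H s Hs; apply: H; rewrite /= !eqSS. Qed.

Lemma kdeg0_true n c : kdeg n.+1 0 c -> forall t, c (true :: t) = 0.
Proof. by move=> H s; apply: H; rewrite /= andbF. Qed.

Lemma kosz_deg0 fs c : kdeg (size fs) 0 c -> forall s, kosz fs c s = 0.
Proof.
elim: fs c => [|f fs IH] c Hc [|[] s] //=.
  by rewrite kosz_eq0 ?oppr0 //; apply: kdeg0_true Hc.
rewrite (kdeg0_true Hc) mulr0 addr0 IH //; exact: kdeg_false Hc.
Qed.

Lemma kosz_deg fs c i : kdeg (size fs) i.+1 c -> kdeg (size fs) i (kosz fs c).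
Proof.
elim: fs c i => [|f fs IH] c i Hc [|[] s] //= Hs.
  have Hc' := kdeg_true Hc; case: i Hc Hs Hc' => [|i] Hc Hs Hc'.
    by rewrite kosz_deg0 ?oppr0.
  by rewrite (IH _ i) ?oppr0 //; move: Hs; rewrite !eqSS.
rewrite (IH _ i) //; last exact: kdeg_false Hc.
rewrite Hc ?mulr0 ?addr0 //; by move: Hs; rewrite /= !eqSS add0n.
Qed.

Fixpoint dotp (hs fs : seq S) : S :=
  match hs, fs with h :: hs', f :: fs' => h * f + dotp hs' fs' | _, _ => 0 end.

(** Exterior multiplication on the left by the vector with coordinates [hs]; the sign comes from
    moving it past the first generator. *)
Fixpoint khom hs c s : S :=
  match hs, s with
  | h :: hs', true :: s' =>
      h * c (false :: s') - khom hs' (fun t => c (true :: t)) s'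
  | h :: hs', false :: s' => khom hs' (fun t => c (false :: t)) s'
  | _, _ => 0
  end.

Lemma eq_khom hs c c' : c =1 c' -> khom hs c =1 khom hs c'.
Proof.
elim: hs c c' => [|h hs IH] c c' e [|[] s] //=.
  by rewrite e; congr (_ - _); apply: IH => t; apply: e.
by apply: IH => t; apply: e.
Qed.

Lemma khomD hs c c' s :
  khom hs (fun t => c t + c' t) s = khom hs c s + khom hs c' s.
Proof.
elim: hs c c' s => [|h hs IH] c c' [|[] s] //=; rewrite ?addr0 //.
by rewrite IH mulrDr opprD addrACA.
Qed.

Lemma khomZ hs a c s : khom hs (fun t => a * c t) s = a * khom hs c s.
Proof.
elim: hs c s => [|h hs IH] c [|[] s] //=; rewrite ?mulr0 //.
by rewrite IH mulrBr mulrCA.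
Qed.

Lemma khomN hs c s : khom hs (fun t => - c t) s = - khom hs c s.
Proof. by rewrite -mulN1r -khomZ; apply: eq_khom => t; rewrite mulN1r. Qed.

Lemma khom_ideal (I : set S) hs c : ideal I ->
  (forall s, I (c s)) -> forall s, I (khom hs c s).
Proof.
move=> idI; elim: hs c => [|f fs IH] c Hc [|[] s] /=; try exact: ideal0.
  by apply: idealB => //; [apply: idealM | apply: IH].
by apply: IH.
Qed.

(** Contraction against [fs] and exterior multiplication by [hs] anticommute up to their pairing.
    Hence every element of the ideal generated by [fs] kills the Koszul homology. *)
Lemma kosz_homotopy hs fs c s : size hs = size fs -> size s = size fs ->
  kosz fs (khom hs c) s + khom hs (kosz fs c) s = dotp hs fs * c s.
Proof.
elim: fs hs c s => [|f fs IH] [|h hs] c [|[] s] //=; rewrite ?mul0r ?addr0 //.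
  move=> [sh] [ss]; rewrite koszB koszZ /=.
  have := IH hs (fun t => c (true :: t)) s sh ss.
  by rewrite khomN => E; rewrite mulrDl -E; ring.
move=> [sh] [ss]; have := IH hs (fun t => c (false :: t)) s sh ss.
by rewrite khomD khomZ => E; rewrite mulrDl -E; ring.
Qed.

Lemma khom_deg hs c i : kdeg (size hs) i c -> kdeg (size hs) i.+1 (khom hs c).
Proof.
elim: hs c i => [|h hs IH] c i Hc [|[] s] //= Hs.
  rewrite Hc; last by move: Hs; rewrite /= !eqSS add0n.
  rewrite mulr0 sub0r; case: i Hc Hs => [|i] Hc Hs.
    rewrite (@eq_khom _ _ (fun t => 0 * c (true :: t))) ?khomZ ?mul0r ?oppr0 // => t.
    by rewrite (kdeg0_true Hc) mul0r.
  rewrite (IH _ i) ?oppr0 //; first exact: kdeg_true Hc.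
apply: (IH _ i); first exact: kdeg_false Hc.
by move: Hs; rewrite eqSS add0n.
Qed.

Section Acyclic.
(** The hypotheses say that [Y j.+1] is the sum of [Y j] and the ideal of [y j], that [y j] is
    regular modulo [Y j], and that [y j] lies in the ideal of [fs]: a regular sequence of length [n]
    inside an ideal with [n] generators. *)
Variables (fs : seq S) (Y : nat -> set S) (y : nat -> S).
Let n := size fs.
Hypothesis idY : forall j, ideal (Y j).
Hypothesis Yy : forall j, (j < n)%N -> Y j `<=` Y j.+1 /\ Y j.+1 (y j).
Hypothesis Ydec : forall j x, (j < n)%N -> Y j.+1 x -> exists a, Y j (x - y j * a).
Hypothesis Yreg : forall j a, (j < n)%N -> Y j (y j * a) -> Y j a.
Hypothesis yfs : forall j, (j < n)%N -> exists2 hs, size hs = n & y j = dotp hs fs.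

(* Depth sensitivity: each regular element killing the homology lowers by one
   the range of degrees where homology may live. *)
Lemma kosz_acyclic_mod k j c : (j + k = n)%N -> kdeg n j.+1 c ->
    (forall s, Y j (kosz fs c s)) ->
  exists u, kdeg n j.+2 u /\ forall s, Y j (c s - kosz fs u s).
Proof.
elim: k j c => [|k IH] j c jk dc Hc.
  (* Here [j = n], so the chain has degree [n + 1] and vanishes. *)
  have c0 s : c s = 0.
    apply: dc; apply/negP => /andP[/eqP ss /eqP cs].
    by have := count_size id s; rewrite ss cs -jk addn0 ltnn.
  exists (fun=> 0); split=> // s; rewrite c0 sub0r.
  by apply: (idealN (idY j)); apply: kosz_ideal => // t; exact: ideal0.
have jn : (j < n)%N by rewrite -jk addnS ltnS leq_addr.
have [hs sh yE] := yfs jn.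
have [sub yj] := Yy jn.
(* The homotopy formula gives [kosz fs w = y j * c] modulo [Y j]; hence [w], one degree higher, is a
   cycle modulo [Y j.+1] and the induction applies to it. *)
pose w := khom hs c.
have dw : kdeg n j.+2 w by rewrite -sh; apply: khom_deg; rewrite sh.
have wE s : Y j (kosz fs w s - y j * c s).
  have [ss|ss] := eqVneq (size s) n; last first.
    rewrite dc ?negb_and ?ss // mulr0 subr0.
    rewrite (kosz_deg (i := j.+1)) ?negb_and ?ss //; exact: ideal0.
  rewrite yE -(kosz_homotopy c sh ss) opprD addrA subrr sub0r.
  by apply: (idealN (idY j)); apply: khom_ideal.
have [||s|v [dv Hv]] := IH j.+1 w; [by rewrite addSnnS | exact: dw | |].
  apply: (ideal_eq (idY _)); first exact/sub/wE.
  by apply: (idealMr (idY _)).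
(* Dividing [r] by [y j] modulo [Y j] gives [u]. Since [r] and [w] have the same boundary, [y j * c]
   and [y j * kosz fs u] agree modulo [Y j], and [y j] cancels. *)
pose r s := w s - kosz fs v s.
have dr : kdeg n j.+2 r.
  by move=> s Hs; rewrite /r dw // (kosz_deg dv) // subr0.
have Hu0 s : exists a, Y j (r s - y j * a) /\
    (~~ ((size s == n) && (count id s == j.+2)) -> a = 0).
  have [Hs|/dr->] := boolP ((size s == n) && (count id s == j.+2)).
    by have [a Ha] := Ydec jn (Hv s); exists a.
  by exists 0; rewrite mulr0 subrr; split=> //; exact: ideal0.
have [u Hu] := choice Hu0.
exists u; split=> [s Hs|s]; first by have [_] := Hu s; apply.
apply: Yreg => //.
have -> : y j * (c s - kosz fs u s) =
   (y j * c s - kosz fs w s) + kosz fs (fun t => r t - y j * u t) s.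
  rewrite koszB koszZ /r koszB kosz_kosz; ring.
apply: (idealD (idY j)); first exact/(ideal_sym (idY j)).
by apply: kosz_ideal => // t; have [] := Hu t.
Qed.

End Acyclic.

Definition unitw n i : seq bool := rcons (nseq i false) true ++ nseq (n - i.+1) false.

Lemma unitw0 n : unitw n.+1 0 = true :: nseq n false.
Proof. by rewrite /unitw /= subn1. Qed.

Lemma unitwS n i : unitw n.+1 i.+1 = false :: unitw n i.
Proof. by rewrite /unitw /= subSS. Qed.

Lemma unitw_deg n i : (i < n)%N -> (size (unitw n i) == n) && (count id (unitw n i) == 1)%N.
Proof.
move=> lt; rewrite /unitw size_cat size_rcons !size_nseq count_cat -cats1 count_cat !count_nseq /=.
by rewrite !mul0n subnKC // !eqxx.
Qed.

Lemma unitw_inj n i j : (i < n)%N -> (j < n)%N -> unitw n i = unitw n j -> i = j.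
Proof.
elim: n i j => [|n IH] [|i] [|j] //; rewrite ?unitw0 ?unitwS //.
by rewrite !ltnS => hi hj [/(IH _ _ hi hj)->].
Qed.

Lemma kosz_nseq fs c :
  kosz fs c (nseq (size fs) false) = \sum_(i < size fs) c (unitw (size fs) i) * fs`_i.
Proof.
elim: fs c => [|f fs IH] c; first by rewrite big_ord0.
by rewrite /= IH big_ord_recl /= unitw0 addrC mulrC; congr (_ + _).
Qed.

(** The degree 2 part of [c] read as an alternating matrix, built along the recursion of [kosz]. *)
Lemma kosz_unitw fs c : exists U : nat -> nat -> S,
  [/\ forall i j, U i j = - U j i, forall i, U i i = 0 &
      forall i, (i < size fs)%N ->
        kosz fs c (unitw (size fs) i) = \sum_(j < size fs) U i j * fs`_j].
Proof.
elim: fs c => [|f fs IH] c; first by exists (fun _ _ => 0); split=> // _ _; rewrite oppr0.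
have [U [anti diag HU]] := IH (fun t => c (false :: t)).
pose b j := c (true :: unitw (size fs) j).
exists (fun i j => match i, j with
  | 0, 0 => 0 | 0, j'.+1 => - b j' | i'.+1, 0 => b i' | i'.+1, j'.+1 => U i' j' end).
split=> [[|i] [|j]|[|i]|[|i] lt]; rewrite ?oppr0 ?opprK //.
  rewrite unitw0 /= kosz_nseq big_ord_recl /= mul0r add0r -sumrN.
  by apply: eq_bigr => i _; rewrite mulNr.
rewrite [size (f :: fs)]/= unitwS /= HU // big_ord_recl /= addrC mulrC.
by congr (_ + _).
Qed.

(** Vanishing of the first Koszul homology. The diagonal condition is separate because it does not
    follow from antisymmetry when 2 is a zero divisor. *)
Definition syz_trivial n (f : 'I_n -> S) := forall h : 'I_n -> S,
  \sum_i h i * f i = 0 ->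
  exists U : 'I_n -> 'I_n -> S,
    [/\ forall i j, U i j = - U j i, forall i, U i i = 0 &
        forall i, h i = \sum_j U i j * f j].

Lemma regular_syz_trivial n (f : 'I_n -> S) (Y : nat -> set S) (y : nat -> S) :
    (forall j, ideal (Y j)) -> (forall x, Y 0%N x -> x = 0) ->
    (forall j, (j < n)%N -> Y j `<=` Y j.+1 /\ Y j.+1 (y j)) ->
    (forall j x, (j < n)%N -> Y j.+1 x -> exists a, Y j (x - y j * a)) ->
    (forall j a, (j < n)%N -> Y j (y j * a) -> Y j a) ->
    (forall j, (j < n)%N -> idl f (y j)) ->
  syz_trivial f.
Proof.
move=> idY Y0 Yy Ydec Yreg yf h hf.
pose fs := [seq f i | i <- enum 'I_n].
have sfs : size fs = n by rewrite size_map size_enum_ord.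
have nfs (i : 'I_n) : fs`_i = f i by rewrite (nth_map i) ?size_enum_ord // nth_ord_enum.
pose c s : S := \sum_(i < n) h i *+ (s == unitw n i).
have dc : kdeg n 1 c.
  move=> s Hs; rewrite /c big1 // => i _; case: eqP => // e.
  by move: Hs; rewrite e unitw_deg.
have cE (i : 'I_n) : c (unitw n i) = h i.
  rewrite /c (bigD1 i) //= eqxx mulr1n big1 ?addr0 // => j /negP nj.
  case: eqP => // e; case: nj; apply/eqP/val_inj/esym.
  exact: unitw_inj e.
have kc s : kosz fs c s = 0.
  have [/andP[/eqP ss /eqP cs]|ns] := boolP ((size s == n) && (count id s == 0)%N); last first.
    by have := @kosz_deg fs c 0; rewrite sfs; apply.
  have -> : s = nseq (size fs) false.
    by rewrite sfs -ss; elim: s {ss} cs => [|[] s IH] //= /IH <-.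
  rewrite kosz_nseq -[RHS]hf sfs; apply: eq_bigr => i _; by rewrite cE nfs.
have [|||||||u [du Hu]] := @kosz_acyclic_mod fs Y y idY _ _ _ _ n 0 c.
- by rewrite sfs.
- by rewrite sfs.
- by rewrite sfs.
- move=> j; rewrite sfs => /yf[a ->].
  exists [seq a i | i <- enum 'I_n]; first by rewrite size_map size_enum_ord.
  rewrite -big_enum /= /fs; elim: (enum _) => [|i e IH] /=; first by rewrite big_nil.
  by rewrite big_cons IH.
- by rewrite sfs.
- by rewrite sfs.
- by move=> s; rewrite kc; exact: ideal0.
have [U [anti diag HU]] := kosz_unitw fs u.
exists (fun i j : 'I_n => U i j); split=> // i.
rewrite -cE; have /Y0/eqP := Hu (unitw n i); rewrite subr_eq0 => /eqP->.
have := HU i; rewrite sfs => -> //.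
by apply: eq_bigr => j _; rewrite nfs.
Qed.

Lemma antisym_sum n (U : 'I_n -> 'I_n -> S) (g : 'I_n -> S) :
    (forall i j, U i j = - U j i) -> (forall i, U i i = 0) ->
  \sum_i (\sum_j U i j * g j) * g i = 0.
Proof.
move=> anti diag.
under eq_bigr do rewrite mulr_suml.
rewrite pair_big /= (bigID (fun p : 'I_n * 'I_n => (p.1 < p.2)%N)) /=.
rewrite [X in _ + X](bigID (fun p : 'I_n * 'I_n => (p.2 < p.1)%N)) /=.
rewrite [X in _ + (_ + X)]big1 ?addr0; last first.
  move=> [i j] /= /andP[n1 n2]; have -> : i = j by apply/val_inj/eqP; rewrite eqn_leq leqNgt n2 leqNgt n1.
  by rewrite diag !mul0r.
rewrite [X in _ + X](reindex (fun p : 'I_n * 'I_n => (p.2, p.1))) /=; last first.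
  by exists (fun p : 'I_n * 'I_n => (p.2, p.1)) => [[]|[]].
rewrite [X in _ + X](eq_bigl (fun p : 'I_n * 'I_n => (p.1 < p.2)%N)); last first.
  by move=> [i j] /=; case: ltngtP.
rewrite -big_split big1 // => -[i j] _ /=.
by rewrite (anti j i); ring.
Qed.

End Koszul.

(** * Perturbing a sequence with trivial syzygies *)

Section Strip.
Variables (R : comNzRingType) (e n : nat) (f : 'I_n -> R).
Hypothesis syzf : syz_trivial f.
Local Notation S := (fps e R).
Variable p : 'I_n -> S.
Hypothesis p1 : forall j, ordge 1 (p j).
Let g j : S := (f j)%:A - p j.

Lemma fcoef_algM (h : S) a m : fcoef (h * a%:A) m = fcoef h m * a.
Proof. by rewrite mulrC mulr_algl fcoefZ mulrC. Qed.

Lemma fcoef_perturb m (h : 'I_n -> S) k : ordge k (\sum_j h j * g j) ->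
  (forall j, ordge k (h j)) -> mdeg m = k ->
  fcoef (\sum_j h j * g j) m = \sum_j fcoef (h j) m * f j.
Proof.
move=> _ Hh mk; rewrite fcoef_sum; apply: eq_bigr => j _.
rewrite /g mulrBr fcoefB fcoef_algM (_ : fcoef (h j * p j) m = 0) ?subr0 //.
by apply: (ordgeM (Hh j) (p1 j)); rewrite mk addn1.
Qed.

(** If the sum has larger order than the [h j], their lowest coefficients are syzygies of [f]. These
    are trivial, so they lift to trivial syzygies of [g], whose subtraction raises the order of the
    [h j] and leaves the sum unchanged. *)
Lemma strip k (h : 'I_n -> S) : ordge k (\sum_j h j * g j) ->
  exists h' : 'I_n -> S, (forall j, ordge k (h' j)) /\
    \sum_j h j * g j = \sum_j h' j * g j.
Proof.
elim: k => [|k IH] HG; first by exists h.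
have [|h' [Hh' E]] := IH; first exact: ordgeW HG.
have Hk : ordge k (\sum_j h' j * g j) by rewrite -E; exact: ordgeW HG.
have HU0 m : exists U : 'I_n -> 'I_n -> R,
    [/\ forall i j, U i j = - U j i, forall i, U i i = 0 &
        mdeg m = k -> forall i, fcoef (h' i) m = \sum_j U i j * f j].
  have [mk|mk] := eqVneq (mdeg m) k; last first.
    by exists (fun _ _ => 0); split=> // [_ _|/eqP]; rewrite ?oppr0 // (negbTE mk).
  have [|U [anti diag HU]] := syzf (h := fun i => fcoef (h' i) m).
    by rewrite -(fcoef_perturb Hk) // -E HG // mk.
  by exists U; split.
have [U HU] := choice HU0.
pose V i j : S := Fps (fun m => if mdeg m == k then U m i j else 0).
have Vk i j : ordge k (V i j) by move=> m lt; rewrite /V fcoefE ltn_eqF.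
exists (fun i => h' i - \sum_j V i j * g j); split=> [i m|].
  rewrite ltnS leq_eqVlt => /orP[/eqP mk|lt]; last first.
    by apply: ordgeB lt => //; apply: ordge_sum => j _; apply: ordgeMr.
  rewrite fcoefB (fcoef_perturb (h := V i) (k := k)) //; last first.
    by apply: ordge_sum => j _; apply: ordgeMr.
  have [_ _ ->] // := HU m.
  by apply/eqP; rewrite subr_eq0; apply/eqP; apply: eq_bigr => j _; rewrite /V fcoefE mk eqxx.
under [RHS]eq_bigr do rewrite mulrBl.
rewrite sumrB E [X in _ - X]antisym_sum ?subr0 // => [i j|i]; apply/fpsP => m;
  rewrite ?fcoefN /V !fcoefE; case: eqP => // _; rewrite ?oppr0 //; by have [] := HU m.
Qed.

(** Flatness of the deformation from [f] to [g]: lowest coefficients of elements of the perturbed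
    ideal already lie in the original one. *)
Lemma perturb_lowest k (G : S) : idl g G -> ordge k G ->
  forall m, mdeg m = k -> idl f (fcoef G m).
Proof.
move=> [h ->] HG m mk; have [h' [Hh' E]] := strip HG.
exists (fun j => fcoef (h' j) m).
by rewrite E (fcoef_perturb (k := k)) // -E.
Qed.

End Strip.

Section SyzygiesOfParameters.
Variables (d : nat) (A : comNzRingType) (f : 'I_d -> fps d A) (N : nat).

(** The powers [x_i^N] form a regular sequence in the ideal of [f]. The ideal of the first [j] of
    them is described by vanishing coefficients, so that regularity is read off the exponents. *)
Lemma parameters_syz_trivial : (forall i, idl f (fps_X A i ^+ N)) -> syz_trivial f.
Proof.
move=> HX.
pose Y j : set (fps d A) := [set h | forall m : multinom d,
  (forall i : 'I_d, (i < j)%N -> (m i < N)%N) -> fcoef h m = 0].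
pose y j : fps d A := if insub j is Some i then fps_X A i ^+ N else 0.
have yE (i : 'I_d) : y i = fps_X A i ^+ N by rewrite /y valK.
have cX (i : 'I_d) (w : fps d A) m : fcoef (fps_X A i ^+ N * w) m =
    if (N <= m i)%N then fcoef w (mnm_sub m (mnm_muln (mnm1 i) N)) else 0.
  rewrite fmonXn fcoef_monM; congr (if _ then _ else _).
  apply/mnm_lepP/idP => [/(_ i)|le j]; rewrite mulmnE mnm1E; first by rewrite eqxx mul1n.
  by case: eqP => [<-|_]; rewrite ?mul1n ?mul0n.
have idY j : ideal (Y j).
  split=> [//|u v Hu Hv m Hm|a u Hu m Hm]; first by rewrite fcoefD Hu // Hv // addr0.
  rewrite fcoefM big1 // => k /mnm_lepP km; rewrite Hu ?mulr0 // => i lt.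
  by rewrite mnmBE; apply: leq_ltn_trans (leq_subr _ _) (Hm i lt).
apply: (@regular_syz_trivial _ d f Y y) => //.
- by move=> u Hu; apply/fpsP => m; apply: Hu.
- move=> j lt; split.
    by move=> u Hu m Hm; apply: Hu => i ij; apply: Hm; apply: ltnW.
  rewrite -[j]/(nat_of_ord (Ordinal lt)) yE => m Hm.
  by rewrite -[X in fcoef X _]mulr1 cX leqNgt Hm.
- move=> j u lt Hu; pose i := Ordinal lt.
  exists (Fps (fun m => fcoef u (mnm_add m (mnm_muln (mnm1 i) N)))) => m Hm.
  rewrite fcoefB -[j]/(nat_of_ord i) yE cX; case: ifP => [le|lt'].
    rewrite fcoefE submK ?subrr //; apply/mnm_lepP => l; rewrite mulmnE mnm1E.
    by case: eqP => [<-|_]; rewrite ?mul1n ?mul0n.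
  rewrite subr0; apply: Hu => l; rewrite ltnS leq_eqVlt => /orP[/eqP e|]; last exact: Hm.
  by have -> : l = i by [apply/val_inj]; rewrite ltnNge lt'.
- move=> j a lt; rewrite -[j]/(nat_of_ord (Ordinal lt)) yE => Ha m Hm.
  have := Ha (mnm_add m (mnm_muln (mnm1 (Ordinal lt)) N)).
  rewrite cX mnmDE mulmnE mnm1E eqxx mul1n leq_addl addmK; apply=> i ij.
  rewrite mnmDE mulmnE mnm1E; case: eqP => [e|_]; last by rewrite mul0n addn0 Hm.
  by move: ij; rewrite -e /= ltnn.
- by move=> j lt; rewrite -[j]/(nat_of_ord (Ordinal lt)) yE.
Qed.

End SyzygiesOfParameters.

(** * Expansions in powers of generators *)

Section FieldSeries.
Variables (d : nat) (K : fieldType).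

Lemma unit_inverseK (f : fps d K) : fconst f != 0 -> exists h, f * h = 1.
Proof.
move=> f0; have [|h Hh] := @unit_inverse d K ((fconst f)^-1 *: f).
  by rewrite fcoefZ mulVf.
by exists ((fconst f)^-1 *: h); rewrite -scalerAr scalerAl.
Qed.

End FieldSeries.

(** * Series in one variable *)

Section OneVariable.
Variable A : comNzRingType.
Local Notation S := (fps 1 A).

Definition mon1 n : multinom 1 := mnm_muln (mnm1 ord0) n.
Definition co (f : S) n : A := fcoef f (mon1 n).
Definition tX : S := fps_X A ord0.

Lemma mon1E (m : multinom 1) : m = mon1 (mdeg m).
Proof.
apply/mnmP => i; rewrite mulmnE mdegE big_ord1 (ord1 i) mnm1E eqxx mul1n //.
Qed.

Lemma mdeg_mon1 n : mdeg (mon1 n) = n.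
Proof. by rewrite mdegMn mdeg1 mul1n. Qed.

Lemma mon1S n : mon1 n.+1 = mnm_add (mon1 n) (mnm1 ord0).
Proof. by rewrite /mon1 mulmSr. Qed.

Lemma mon1_0 : mon1 0 = @mnm0 1. Proof. by []. Qed.

Lemma coP (f g : S) : (forall n, co f n = co g n) -> f = g.
Proof. by move=> H; apply/fpsP => m; rewrite (mon1E m); exact: H. Qed.

Lemma co0 (f : S) : co f 0 = fconst f. Proof. by []. Qed.
Lemma coD (f g : S) n : co (f + g) n = co f n + co g n. Proof. by []. Qed.
Lemma coN (f : S) n : co (- f) n = - co f n. Proof. by []. Qed.
Lemma co_sum I (r : seq I) (P : pred I) (F : I -> S) n :
  co (\sum_(i <- r | P i) F i) n = \sum_(i <- r | P i) co (F i) n.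
Proof. exact: fcoef_sum. Qed.

Lemma co_tXM (f : S) n : co (tX * f) n = if n is n'.+1 then co f n' else 0.
Proof.
rewrite /co fcoef_XM; case: n => [|n]; first by rewrite mon1_0 mnm0E.
by rewrite mon1S mnmDE mnm1E eqxx addn1 /= addmK.
Qed.

Lemma co_tXn n k : co (tX ^+ k) n = (n == k)%:R.
Proof.
elim: k n => [|k IH] n; last by rewrite exprS co_tXM; case: n => // n; rewrite IH.
rewrite expr0 /co fcoef1; congr ((nat_of_bool _)%:R); apply/eqP/eqP => [|->//].
by move/(congr1 (@mdeg 1)); rewrite mdeg_mon1 mdeg0.
Qed.

Lemma co_ordge (f : S) n : (forall k, (k < n)%N -> co f k = 0) <-> ordge n f.
Proof.
split=> [H m lt|H k lt]; last by apply: H; rewrite mdeg_mon1.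
by rewrite (mon1E m); apply: H.
Qed.

Lemma ordge_tXn k (f : S) : ordge k f -> exists u, f = tX ^+ k * u /\ forall n, co u n = co f (n + k).
Proof.
elim: k f => [|k IH] f Hf.
  by exists f; split=> [|n]; rewrite ?mul1r ?addn0.
pose v : S := Fps (fun m => co f (mdeg m).+1).
have vE n : co v n = co f n.+1 by rewrite /co /v fcoefE mdeg_mon1.
have fE : f = tX * v.
  apply: coP => -[|n]; rewrite co_tXM ?vE //.
  by apply: (iffRL (co_ordge f k.+1) Hf).
have [|u [vu Hu]] := IH v.
  by apply/co_ordge => n lt; rewrite vE; apply: (iffRL (co_ordge f k.+1) Hf).
exists u; split=> [|n]; first by rewrite fE vu exprS mulrA.
by rewrite Hu vE addnS.
Qed.

Lemma tXn_inj k (f g : S) : tX ^+ k * f = tX ^+ k * g -> f = g.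
Proof.
elim: k f g => [|k IH] f g; rewrite ?mul1r // exprSr -!mulrA => /IH E.
by apply: coP => n; have := congr1 (fun h => co h n.+1) E; rewrite /= !co_tXM.
Qed.

Lemma co_alg c n : co (c%:A : S) n = if n == 0%N then c else 0.
Proof.
rewrite /co fcoefZ fcoef1 -mdeg_eq0 mdeg_mon1; case: eqP => _; by rewrite ?mulr1 ?mulr0.
Qed.

Lemma co_algM (h : S) c n : co (h * c%:A) n = co h n * c.
Proof. exact: fcoef_algM. Qed.

Lemma co_deriv (f : S) n : co (fps_deriv ord0 f) n = co f n.+1 *+ n.+1.
Proof. by rewrite /co fcoef_deriv -mon1S /mon1 mulmnE mnm1E eqxx mul1n. Qed.

End OneVariable.

Section OneVariableField.
Variable K : fieldType.
Local Notation O := (fps 1 K).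

Lemma fps1_normal (f : O) : f != 0 ->
  exists k u, f = tX K ^+ k * u /\ fconst u != 0.
Proof.
move=> nz; have [|k ck min] := @ex_minnP (fun k => co f k != 0).
  apply/not_existsP => H; case/eqP: nz; apply: coP => n.
  by have /negP := H n; rewrite negbK => /eqP ->.
have [|u [fu Hu]] := @ordge_tXn K k f.
  apply/co_ordge => j lt; apply/eqP; apply: contraTT lt => /min.
  by rewrite -leqNgt.
by exists k, u; split=> //; rewrite -co0 Hu.
Qed.

Fact fps1_integral (f g : O) : f * g = 0 -> (f == 0) || (g == 0).
Proof.
have [//|/fps1_normal[k [u [fu u0]]]] := eqVneq f 0.
have [//|/fps1_normal[l [v [gv v0]]]] := eqVneq g 0.
move=> fg; have : fconst (u * v) = 0.
  suff -> : u * v = 0 by [].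
  apply: (@tXn_inj K (k + l)); rewrite mulr0 -[RHS]fg fu gv exprD; ring.
by rewrite /fconst fcoef0M => /eqP; rewrite mulf_eq0 (negbTE u0) (negbTE v0).
Qed.

Definition fps1_inv (f : O) : O :=
  if fconst f == 0 then f else xget 0 [set h | f * h = 1].

Definition fps1_unit : pred O := fun f => fconst f != 0.

Fact fps1_mulVr : {in fps1_unit, left_inverse 1 fps1_inv *%R}.
Proof.
move=> f f0'; have f0 : fconst f != 0 := f0'; rewrite /fps1_inv (negbTE f0) mulrC.
have [h Hh] := unit_inverseK f0.
exact: (@xgetPex _ 0 [set h | f * h = 1] (ex_intro _ h Hh)).
Qed.

Fact fps1_unitP (f g : O) : g * f = 1 -> fps1_unit f.
Proof.
move=> H; apply/eqP => f0; have := congr1 (@fconst 1 K) H.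
by rewrite {1}/fconst fcoef0M [X in _ * X]f0 mulr0 /fconst fcoef1 eqxx => /eqP; rewrite eq_sym oner_eq0.
Qed.

Fact fps1_inv_out : {in [predC fps1_unit], fps1_inv =1 id}.
Proof. by move=> f; rewrite inE /= negbK /fps1_inv => ->. Qed.

HB.instance Definition _ := GRing.ComNzRing_hasMulInverse.Build O
  fps1_mulVr fps1_unitP fps1_inv_out.
HB.instance Definition _ := GRing.ComUnitRing_isIntegral.Build O fps1_integral.

End OneVariableField.

Section Expansion.
Variables (d e n : nat) (K : fieldType) (T : finType).
Local Notation R := (fps d K).
Local Notation S := (fps e R).
Local Notation P := (fps e K).

Definition plift : P -> S := fps_map (in_alg R).

HB.instance Definition _ := GRing.RMorphism.copy plift (fps_map (in_alg R)).

Lemma fcoef_plift q m : fcoef (plift q) m = (fcoef q m)%:A. Proof. by []. Qed.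

Lemma ordge_plift k q : ordge k q -> ordge k (plift q).
Proof. by move=> H m lt; rewrite fcoef_plift H // scale0r. Qed.

Lemma pliftX i : plift (fps_X K i) = fps_X R i.
Proof. by apply/fpsP => m; rewrite fcoef_plift !fcoef_X; case: eqP; rewrite ?scale1r ?scale0r. Qed.

Lemma fcoef_algplift (v : R) q m : fcoef (v%:A * plift q) m = fcoef q m *: v.
Proof. by rewrite mulr_algl fcoefZ fcoef_plift mulrC mulr_algl. Qed.

Variables (g : 'I_n -> R) (p : 'I_n -> S) (v : T -> R).
Hypothesis p1 : forall j, ordge 1 (p j).

(** The relations [g j = p j], which deform the ideal of [g] over the space of the [e]
    parameters. *)
Definition pgen j : S := (g j)%:A - p j.

(** Division degree by degree in the parameters: the lowest coefficients of the remainder are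
    divided by [g] in [R], and replacing [g j] by [pgen j] creates an error of higher order because
    [p j] has positive order. *)
Lemma expansion : spans (idl g) v -> forall b : S,
  exists q : T -> P, idl pgen (b - \sum_t (v t)%:A * plift (q t)).
Proof.
move=> sv b.
have H0 (r : R) : exists ca : (T -> K) * ('I_n -> R),
    r = \sum_t ca.1 t *: v t + \sum_j ca.2 j * g j.
  have [c [a E]] := sv r; exists (c, a).
  by rewrite -E /= addrC subrK.
have [sp spE] := choice H0.
pose res (st : (T -> P) * ('I_n -> S)) : S :=
  b - \sum_t (v t)%:A * plift (st.1 t) - \sum_j st.2 j * pgen j.
pose lq k (r : S) t : P := Fps (fun m => if mdeg m == k then (sp (fcoef r m)).1 t else 0).
pose lh k (r : S) j : S := Fps (fun m => if mdeg m == k then (sp (fcoef r m)).2 j else 0).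
pose next k st := (fun t => st.1 t + lq k (res st) t, fun j => st.2 j + lh k (res st) j).
(* After [k] stages the remainder has order at least [k], and the coefficients of degree below [k]
   of the quotients no longer change; the limits [q] and [h] below are read off there. *)
pose fix st k := if k is k'.+1 then next k' (st k') else (fun _ => 0, fun _ => 0).
have lqE k r t m : fcoef (lq k r t) m = if mdeg m == k then (sp (fcoef r m)).1 t else 0 by [].
have lhE k r t m : fcoef (lh k r t) m = if mdeg m == k then (sp (fcoef r m)).2 t else 0 by [].
have lqk k r t : ordge k (lq k r t) by move=> m lt; rewrite fcoefE ltn_eqF.
have lhk k r j : ordge k (lh k r j) by move=> m lt; rewrite fcoefE ltn_eqF.
have resE k : res (st k.+1) = res (st k) - \sum_t (v t)%:A * plift (lq k (res (st k)) t)
    - \sum_j lh k (res (st k)) j * pgen j.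
  rewrite {1}/res /=.
  under eq_bigr do rewrite rmorphD mulrDr.
  under [X in _ - X]eq_bigr do rewrite mulrDl.
  rewrite !big_split /= /res; ring.
have resk k : ordge k (res (st k)).
  elim: k => [|k IH]; first exact: ordge0.
  move=> m; rewrite ltnS leq_eqVlt => /orP[/eqP mk|lt].
    rewrite resE; move: (res (st k)) => r; rewrite !fcoefB !fcoef_sum.
    under eq_bigr do rewrite fcoef_algplift lqE mk eqxx.
    under [X in _ - X]eq_bigr => j _.
      rewrite /pgen mulrBr fcoefB fcoef_algM (_ : fcoef (_ * p j) m = 0) ?subr0.
        by rewrite lhE mk eqxx; over.
      by apply: (ordgeM (lhk k r j) (p1 j)); rewrite mk addn1.
    by rewrite -addrA -opprD -spE subrr.
  rewrite resE; apply: (ordgeB (n := k)) lt.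
    apply: ordgeB => //; apply: ordge_sum => t _.
    by apply: ordgeMl; apply: ordge_plift.
  by apply: ordge_sum => j _; apply: ordgeMr.
pose q t : P := Fps (fun m => fcoef ((st (mdeg m).+1).1 t) m).
pose h j : S := Fps (fun m => fcoef ((st (mdeg m).+1).2 j) m).
have stab k i m : (mdeg m < k)%N -> (forall t, fcoef ((st (k + i)%N).1 t) m = fcoef ((st k).1 t) m) /\
   (forall j, fcoef ((st (k + i)%N).2 j) m = fcoef ((st k).2 j) m).
  move=> lt; elim: i => [|i [IH1 IH2]]; first by rewrite addn0.
  have lt' : (mdeg m < k + i)%N by apply: leq_trans lt _; exact: leq_addr.
  rewrite addnS; split=> [t|j] /=.
    by rewrite fcoefD lqk // addr0.
  by rewrite fcoefD lhk // addr0.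
have qk k t : ordge k (q t - (st k).1 t).
  move=> m lt; rewrite fcoefB /q fcoefE; have [E _] := @stab (mdeg m).+1 (k - (mdeg m).+1)%N m (ltnSn _).
  by have := E t; rewrite subnKC // => ->; rewrite subrr.
have hk k j : ordge k (h j - (st k).2 j).
  move=> m lt; rewrite fcoefB /h fcoefE; have [_ E] := @stab (mdeg m).+1 (k - (mdeg m).+1)%N m (ltnSn _).
  by have := E j; rewrite subnKC // => ->; rewrite subrr.
exists q; exists h; apply/eqP; rewrite -subr_eq0; apply/eqP/ordge_eq0 => k.
have -> : b - \sum_t (v t)%:A * plift (q t) - \sum_j h j * pgen j = res (st k)
    - \sum_t (v t)%:A * plift (q t - (st k).1 t) - \sum_j (h j - (st k).2 j) * pgen j.
  under [X in _ = _ - X - _]eq_bigr do rewrite rmorphB mulrBr.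
  under [X in _ = _ - X]eq_bigr do rewrite mulrBl.
  rewrite !sumrB /res; ring.
apply: ordgeB; first apply: ordgeB => //; apply: ordge_sum => i _.
  by apply: ordgeMl; apply: ordge_plift.
exact: ordgeMr.
Qed.

(** By [perturb_lowest], the lowest coefficients of such a combination lie in the ideal of [g],
    where [v] is independent; so the order of the [q t] can be raised forever. *)
Lemma expansion_unique : syz_trivial g -> indep (idl g) v -> forall q : T -> P,
  idl pgen (\sum_t (v t)%:A * plift (q t)) -> forall t, q t = 0.
Proof.
move=> syzg iv q Hq.
suff Hk k : forall t, ordge k (q t) by move=> t; apply: ordge_eq0 => k; exact: Hk.
elim: k => [|k IH]; first by move=> t; exact: ordge0.
have HG : ordge k (\sum_t (v t)%:A * plift (q t)).
  by apply: ordge_sum => t _; apply: ordgeMl; apply: ordge_plift.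
move=> t m; rewrite ltnS leq_eqVlt => /orP[/eqP mk|]; last exact: IH.
have := perturb_lowest syzg p1 Hq HG mk.
rewrite fcoef_sum; under eq_bigr do rewrite fcoef_algplift.
by move/iv; apply.
Qed.

End Expansion.

(** * Torsion-free quotients as matrix algebras *)

(** Division by the least order among the [q l], which is the content in a discrete valuation
    ring. *)
Lemma fps1_content (K : fieldType) n (q : 'I_n -> fps 1 K) l0 : q l0 != 0 ->
  exists k (q' : 'I_n -> fps 1 K) j w,
    (forall l, q l = tX K ^+ k * q' l) /\ q' j * w = 1.
Proof.
move=> nz.
pose P k := `[< exists l, co (q l) k != 0 >].
have [k0 Pk0] : exists k, P k.
  have [k [u [E u0]]] := fps1_normal nz; exists k; apply/asboolP; exists l0.
  apply: contraNneq nz => ck; case/eqP: u0; rewrite -co0.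
  have : co (tX K ^+ k * u) k = co u 0.
    by elim: k {E ck} => [|k IH]; rewrite ?mul1r // exprS -mulrA co_tXM.
  by rewrite -E ck => <-.
have [k /asboolP[j cj] min] := ex_minnP (ex_intro P k0 Pk0).
have qk l : ordge k (q l).
  apply/co_ordge => i lt; apply/eqP; apply: contraTT lt => ci; rewrite -leqNgt.
  by apply: min; apply/asboolP; exists l.
have [q' Hq'] := choice (fun l => ordge_tXn (qk l)).
have [w Hw] : exists w, q' j * w = 1.
  by apply: unit_inverseK; rewrite -co0; have [_ ->] := Hq' j.
by exists k, q', j, w; split=> // l; have [] := Hq' l.
Qed.

Section Representation.
Variables (S O : comNzRingType) (pl : {rmorphism O -> S}) (T : set S).
Hypothesis idT : ideal T.

Definition gens r (b : 'I_r -> S) :=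
  forall h, exists q : 'I_r -> O, T (h - \sum_l b l * pl (q l)).
Definition free_mod r (b : 'I_r -> S) :=
  forall q : 'I_r -> O, T (\sum_l b l * pl (q l)) -> forall l, q l = 0.

Lemma free_gens (t : O) n (b : 'I_n -> S) :
    (forall h, T (pl t * h) -> T h) ->
    (forall n (q : 'I_n -> O) l0, q l0 != 0 -> exists k (q' : 'I_n -> O) j w,
       (forall l, q l = t ^+ k * q' l) /\ q' j * w = 1) ->
    gens b ->
  exists r (b' : 'I_r -> S), [/\ (r <= n)%N, gens b' & free_mod b'].
Proof.
move=> satT content.
have satTn k h : T (pl (t ^+ k) * h) -> T h.
  by elim: k h => [|k IH] h; rewrite ?rmorph1 ?mul1r // exprS rmorphM -mulrA => /satT/IH.
elim: n b => [|n IH] b gb; first by exists 0%N, b; split=> // q _ [].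
have [fb|] := pselect (free_mod b); first by exists n.+1, b.
move/existsNP => [q] /not_implyP[Tq] /existsNP[l0] /eqP ql0.
have [k [q' [j [w [qE jw]]]]] := content _ q l0 ql0.
have Tq' : T (\sum_l b l * pl (q' l)).
  apply: (satTn k); rewrite mulr_sumr; apply: (ideal_eq idT _ Tq).
  rewrite -sumrB big1 => [|l _]; first exact: ideal0.
  by rewrite qE rmorphM mulrCA subrr.
have [|r [b' [le gb' fb']]] := IH (fun l => b (lift j l)); last first.
  by exists r, b'; split=> //; apply: leqW.
move=> h; have [p Hp] := gb h.
exists (fun l => p (lift j l) - p j * w * q' (lift j l)).
have -> : h - \sum_l b (lift j l) * pl (p (lift j l) - p j * w * q' (lift j l)) =
  (h - \sum_l b l * pl (p l)) + pl (p j * w) * \sum_l b l * pl (q' l).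
  rewrite (bigD1_ord j (F := fun l => b l * pl (p l))) //=.
  rewrite (bigD1_ord j (F := fun l => b l * pl (q' l))) //=.
  rewrite mulrDr mulr_sumr.
  have -> : pl (p j * w) * (b j * pl (q' j)) = b j * pl (p j).
    by rewrite mulrCA -rmorphM -mulrA [w * _]mulrC jw mulr1.
  have -> : \sum_(l < n) b (lift j l) * pl (p (lift j l) - p j * w * q' (lift j l)) =
     \sum_(l < n) b (lift j l) * pl (p (lift j l)) -
     \sum_(l < n) pl (p j * w) * (b (lift j l) * pl (q' (lift j l))).
    rewrite -sumrB; apply: eq_bigr => l _.
    by rewrite rmorphB mulrBr; congr (_ - _); rewrite (rmorphM pl (p j * w)) mulrCA.
  by rewrite opprB opprD -[RHS]addrA addrACA addNr add0r; congr (_ + _); rewrite addrC.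
by apply: (idealD idT) => //; apply: (idealM idT).
Qed.

Lemma free_eq r (b : 'I_r -> S) (q q' : 'I_r -> O) : free_mod b ->
  T (\sum_i b i * pl (q i) - \sum_i b i * pl (q' i)) -> q =1 q'.
Proof.
move=> fb H i; apply/eqP; rewrite -subr_eq0; apply/eqP.
apply: (fb (fun i => q i - q' i)).
by under eq_bigr do rewrite rmorphB mulrBr; rewrite sumrB.
Qed.

(** The regular representation of the quotient by [T]. It is faithful because 1 is a combination of
    the basis, and a kernel vector of [rep h] is the coordinate vector of an element killed by
    [h]. *)
Lemma free_rep r (b : 'I_r -> S) : gens b -> free_mod b ->
  exists rep : S -> 'M[O]_r,
    [/\ {morph rep : h h' / h + h'},
        forall h h', rep (h * h') = rep h *m rep h',
        forall q, rep (pl q) = q%:M,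
        forall h, rep h = 0 <-> T h &
        (forall h (v : 'cV_r), rep h *m v = 0 -> T (h * \sum_l b l * pl (v l ord0)))
        /\ forall h l, T (h * b l - \sum_i b i * pl (rep h i l))].
Proof.
move=> gb fb.
have rep0 h : exists A : 'M[O]_r, forall l, T (h * b l - \sum_i b i * pl (A i l)).
  have [A HA] := choice (fun l => gb (h * b l)).
  by exists (\matrix_(i, l) A l i) => l; under eq_bigr do rewrite mxE.
have [rep repP] := choice rep0.
have uniq h (A : 'M[O]_r) :
  (forall l, T (h * b l - \sum_i b i * pl (A i l))) -> rep h = A.
  move=> HA; apply/matrixP => i l.
  apply: (free_eq fb (q := fun i => rep h i l) (q' := fun i => A i l)).
  by apply: (ideal_trans idT) (HA l); apply: (ideal_sym idT); exact: repP.
have repM h h' : rep (h * h') = rep h *m rep h'.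
  apply: uniq => l.
  have -> : h * h' * b l - \sum_i b i * pl ((rep h *m rep h') i l) =
     h * (h' * b l - \sum_k b k * pl (rep h' k l)) +
     \sum_k pl (rep h' k l) * (h * b k - \sum_i b i * pl (rep h i k)).
    under [X in _ = _ + X]eq_bigr do rewrite mulrBr mulr_sumr.
    rewrite sumrB exchange_big /= mulrBr mulr_sumr mulrA.
    under eq_bigr do rewrite mxE rmorph_sum mulr_sumr.
    rewrite -!addrA; congr (_ + _).
    rewrite addrA [X in _ = X + _](_ : _ = 0) ?add0r; last first.
      by rewrite addrC -sumrB big1 // => k _; rewrite mulrCA [b k * _]mulrC mulrCA subrr.
    congr (- _); apply: eq_bigr => i _; apply: eq_bigr => k _.
    by rewrite rmorphM [RHS]mulrCA [pl _ * pl _]mulrC.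
  apply: (idealD idT); first by apply: (idealM idT); exact: repP.
  by apply: (ideal_sum idT) => k _; apply: (idealM idT); exact: repP.
have repT h : T h -> rep h = 0.
  move=> Th; apply: uniq => l; rewrite big1 ?subr0; first exact: (idealMr idT).
  by move=> i _; rewrite mxE rmorph0 mulr0.
exists rep; split=> //.
- move=> h h'; apply: uniq => l.
  have -> : (h + h') * b l - \sum_i b i * pl ((rep h + rep h') i l) =
     (h * b l - \sum_i b i * pl (rep h i l)) + (h' * b l - \sum_i b i * pl (rep h' i l)).
    under eq_bigr do rewrite mxE rmorphD mulrDr.
    by rewrite big_split /= mulrDl opprD addrACA.
  by apply: (idealD idT); exact: repP.
- move=> q; apply: uniq => l; rewrite (bigD1 l) //= big1 => [|i nl].
    by rewrite mxE eqxx mulr1n addr0 mulrC subrr; exact: ideal0.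
  by rewrite mxE (negbTE nl) mulr0n rmorph0 mulr0.
- move=> h; split=> [h0|]; last exact: repT.
  have [q Hq] := gb 1.
  rewrite -[h]mulr1; apply: (ideal_eq idT (y := h * \sum_l b l * pl (q l))).
    by rewrite -mulrBr; apply: (idealM idT).
  rewrite mulr_sumr; apply: (ideal_sum idT) => l _; rewrite mulrA.
  apply: (idealMr idT).
  have := repP h l; rewrite h0 big1 ?subr0 // => i _.
  by rewrite mxE rmorph0 mulr0.
split=> // h v hv.
have -> : h * \sum_l b l * pl (v l ord0) =
  \sum_l pl (v l ord0) * (h * b l - \sum_i b i * pl (rep h i l)) +
  \sum_i b i * pl ((rep h *m v) i ord0).
  under [X in _ = X + _]eq_bigr do rewrite mulrBr mulr_sumr.
  rewrite sumrB exchange_big /= mulr_sumr.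
  under [X in _ = _ + X]eq_bigr do rewrite mxE rmorph_sum mulr_sumr.
  rewrite -addrA [X in _ + X](_ : _ = 0) ?addr0; last first.
    rewrite addrC -sumrB big1 // => i _; rewrite -sumrB big1 // => l _.
    by rewrite rmorphM [X in _ - X]mulrCA [pl (v _ _) * _]mulrC subrr.
  by apply: eq_bigr => l _; rewrite [RHS]mulrC mulrA.
apply: (idealD idT).
  by apply: (ideal_sum idT) => l _; apply: (idealM idT); exact: repP.
rewrite hv big1 => [|i _]; first exact: ideal0.
by rewrite mxE rmorph0 mulr0.
Qed.

End Representation.

(** * The chain rule under the trace *)

Section ChainRule.
Variables (d : nat) (K : fieldType) (O : comNzRingType).
Variables (kappa : {rmorphism K -> O}) (D : O -> O) (t : O).
Hypotheses (DD : forall x y, D (x + y) = D x + D y)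
  (DM : forall x y, D (x * y) = D x * y + x * D y)
  (Dc : forall c, D (kappa c) = 0).
Local Notation R := (fps d K).
Variables (r L : nat) (rp : R -> 'M[O]_r).
Definition rp_comm (G : 'M[O]_r) := forall x, G *m rp x = rp x *m G.
Hypotheses (rpD : {morph rp : x y / x + y})
  (rpM : forall x y, rp (x * y) = rp x *m rp y)
  (rpC : forall c : K, rp c%:A = (kappa c)%:M).
(** Continuity of the representation: series of large order act by multiples of [t]. *)
Hypothesis deep : forall x, ordge L x -> exists B, rp x = t *: B /\ rp_comm B.

Definition Dmx m n (A : 'M[O]_(m, n)) : 'M[O]_(m, n) := map_mx D A.
Local Notation dX i := (Dmx (rp (fps_X K i))).

Lemma deriv0 : D 0 = 0. Proof. by have := Dc 0; rewrite rmorph0. Qed.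

Lemma deriv_sum I (s : seq I) (P : pred I) (F : I -> O) :
  D (\sum_(i <- s | P i) F i) = \sum_(i <- s | P i) D (F i).
Proof. exact: (big_morph D DD deriv0). Qed.

Lemma DmxD m n (A B : 'M[O]_(m, n)) : Dmx (A + B) = Dmx A + Dmx B.
Proof. by apply/matrixP => i j; rewrite !mxE DD. Qed.

Lemma DmxM m n p (A : 'M[O]_(m, n)) (B : 'M[O]_(n, p)) :
  Dmx (A *m B) = Dmx A *m B + A *m Dmx B.
Proof.
apply/matrixP => i j; rewrite !mxE deriv_sum -big_split /=.
by apply: eq_bigr => k _; rewrite DM !mxE.
Qed.

Lemma rpCC x y : rp x *m rp y = rp y *m rp x.
Proof. by rewrite -!rpM mulrC. Qed.

Lemma rp0 : rp 0 = 0.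
Proof. by have := rpC 0; rewrite scale0r rmorph0 => ->; rewrite raddf0. Qed.

Lemma rp1 : rp 1 = 1%:M.
Proof. by have := rpC 1; rewrite scale1r rmorph1. Qed.

(** The failure of [dx = sum_i (dx/dX_i) dX_i]. It is measured under a trace because the entrywise
    derivative of [rp x] need not commute with the matrices [rp y]. *)
Definition defect (G : 'M[O]_r) (x : R) : O :=
  \tr (G *m Dmx (rp x)) - \sum_i \tr (G *m rp (fps_deriv i x) *m dX i).

Lemma defectD G x y : defect G (x + y) = defect G x + defect G y.
Proof.
rewrite /defect rpD DmxD mulmxDr mxtraceD.
rewrite [X in _ - X](_ : _ = \sum_i \tr (G *m rp (fps_deriv i x) *m dX i) +
    \sum_i \tr (G *m rp (fps_deriv i y) *m dX i)); first by rewrite opprD addrACA.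
rewrite -big_split; apply: eq_bigr => i _ /=.
by rewrite fps_derivD rpD mulmxDr mulmxDl mxtraceD.
Qed.

Lemma defect_const G (c : K) : defect G c%:A = 0.
Proof.
rewrite /defect rpC (_ : Dmx _ = 0); last first.
  apply/matrixP => i j; rewrite !mxE; case: (i == j); rewrite ?mulr1n ?mulr0n ?Dc ?deriv0 //.
rewrite mulmx0 mxtrace0 big1 ?subr0 // => i _.
by rewrite fps_derivZ fps_deriv1 scaler0 rp0 mulmx0 mul0mx mxtrace0.
Qed.

Lemma defect_X G i : defect G (fps_X K i) = 0.
Proof.
rewrite /defect (bigD1 i) //= fps_derivX eqxx rp1 mulmx1 big1 ?addr0 ?subrr // => j nj.
by rewrite fps_derivX (negbTE nj) rp0 mulmx0 mul0mx mxtrace0.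
Qed.

(** Cyclicity of the trace, with [G] commuting with the representation, moves [rp y] across the
    derivative of [rp x]. *)
Lemma defectM G x y : rp_comm G ->
  defect G (x * y) = defect (G *m rp y) x + defect (G *m rp x) y.
Proof.
move=> GC; rewrite /defect rpM DmxM mulmxDr mxtraceD.
rewrite [X in _ - X](_ : _ = \sum_i \tr (G *m rp y *m rp (fps_deriv i x) *m dX i) +
    \sum_i \tr (G *m rp x *m rp (fps_deriv i y) *m dX i)); last first.
  rewrite -big_split; apply: eq_bigr => i _ /=.
  rewrite fps_derivM rpD !rpM mulmxDr mulmxDl mxtraceD !mulmxA.
  by congr (\tr (_ *m _) + _); rewrite -!mulmxA rpCC.
have -> : \tr (G *m (Dmx (rp x) *m rp y)) = \tr (G *m rp y *m Dmx (rp x)).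
  by rewrite mulmxA mxtrace_mulC mulmxA -GC.
by rewrite (mulmxA G (rp x)) opprD addrACA.
Qed.

Lemma defect_sum G I (s : seq I) (P : pred I) (F : I -> R) :
  defect G (\sum_(i <- s | P i) F i) = \sum_(i <- s | P i) defect G (F i).
Proof.
apply: (big_morph (defect G)) => [x y|]; first exact: defectD.
by have := defect_const G 0; rewrite scale0r.
Qed.

Lemma defectZl G c x : defect (c *: G) x = c * defect G x.
Proof.
rewrite /defect -scalemxAl mxtraceZ mulrBr; congr (_ - _).
by rewrite mulr_sumr; apply: eq_bigr => i _; rewrite -!scalemxAl mxtraceZ.
Qed.

Lemma rp_commM A B : rp_comm A -> rp_comm B -> rp_comm (A *m B).
Proof. by move=> HA HB x; rewrite -mulmxA HB mulmxA HA mulmxA. Qed.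

Lemma rp_comm_rp x : rp_comm (rp x).
Proof. by move=> y; exact: rpCC. Qed.

(* Splitting [y] along the variables moves one variable from [y] into the
   trace coefficient; after [L] steps that coefficient is divisible by [t]. *)
Lemma defect_divisible k G x : rp_comm G -> exists u, defect G x = t ^+ k * u.
Proof.
elim: k G x => [|k IH] G x GC; first by exists (defect G x); rewrite mul1r.
suff Hj j : (j <= L)%N -> forall s y, ordge (L - j) s ->
    exists u, defect (G *m rp s) y = t ^+ k.+1 * u.
  have := Hj L (leqnn _) 1 x; rewrite subnn rp1 mulmx1; apply.
  exact: ordge0.
elim: j => [|j IHj] jL s y Hs.
  rewrite subn0 in Hs; have [B [-> BC]] := deep Hs.
  have [u Hu] := IH (G *m B) y (rp_commM GC BC).
  by exists u; rewrite -scalemxAr defectZl Hu exprS mulrA.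
have HC := rp_commM GC (rp_comm_rp s).
have : ordge 1 (y - (fconst y)%:A).
  by apply/ordge1P; rewrite fcoefB fcoefZ fcoef1 eqxx mulr1 subrr.
move/ordgeS_decomp => [u [_ Hu]].
have Hui i : exists w, defect (G *m rp s *m rp (fps_X K i)) (u i) = t ^+ k.+1 * w.
  rewrite -mulmxA -rpM; apply: IHj; first exact: ltnW.
  have -> : (L - j = L - j.+1 + 1)%N by rewrite addn1 subnSK.
  by apply: ordgeM => //; exact: ordge_X.
have [w Hw] := choice Hui; exists (\sum_i w i).
rewrite -[y](subrK (fconst y)%:A) defectD defect_const addr0 Hu defect_sum mulr_sumr.
by apply: eq_bigr => i _; rewrite defectM // defect_X add0r Hw.
Qed.

End ChainRule.

Section JacobiFormula.
Variables (O : comNzRingType) (D : O -> O).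
Hypotheses (D0 : D 0 = 0) (D1 : D 1 = 0) (DD : forall x y, D (x + y) = D x + D y)
  (DM : forall x y, D (x * y) = D x * y + x * D y).

Lemma deriv_bigprod n (F : 'I_n -> O) :
  D (\prod_i F i) = \sum_i D (F i) * \prod_(j | j != i) F j.
Proof.
elim: n F => [|n IH] F; first by rewrite !big_ord0.
rewrite big_ord_recl DM IH big_ord_recl; congr (_ * _ + _).
  by rewrite [RHS]big_mkcond big_ord_recl /= mul1r; apply: eq_bigr.
rewrite mulr_sumr; apply: eq_bigr => i _; rewrite mulrCA; congr (_ * _).
by rewrite [RHS]big_mkcond big_ord_recl /= big_mkcond; congr (_ * _).
Qed.

Lemma deriv_det n (A : 'M[O]_n) : D (\det A) = \tr (\adj A *m map_mx D A).
Proof.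
pose B i := \matrix_(j, k) if j == i then D (A j k) else A j k.
have DS I (s : seq I) (P : pred I) (F : I -> O) :
  D (\sum_(i <- s | P i) F i) = \sum_(i <- s | P i) D (F i).
  exact: (big_morph D DD D0).
have Dsign (b : bool) x : D ((-1) ^+ b * x) = (-1) ^+ b * D x.
  case: b; rewrite ?mul1r // expr1 !mulN1r.
  by apply/eqP; rewrite -subr_eq0 opprK -DD addNr D0.
transitivity (\sum_i \det (B i)).
  rewrite /determinant DS exchange_big; apply: eq_bigr => s _ /=.
  rewrite Dsign deriv_bigprod mulr_sumr; apply: eq_bigr => i _.
  rewrite [in RHS](bigD1 i) //= /B mxE eqxx; congr (_ * (_ * _)).
  by apply: eq_bigr => j /negbTE nj; rewrite mxE nj.
rewrite mxtrace_mulC; apply: eq_bigr => i _; rewrite (expand_det_row _ i) mxE.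
apply: eq_bigr => k _; rewrite !mxE eqxx; congr (_ * _).
rewrite /cofactor; congr (_ * \det _); apply/matrixP => j l.
by rewrite !mxE eq_sym (negbTE (neq_lift _ _)).
Qed.

End JacobiFormula.

(** * Nilpotence of f modulo the Jacobian ideal *)

(** [B] is the sequence of the powers of [A]. Their ranks drop strictly until they become stable,
    and since some power vanishes the stable rank is 0; this takes at most [n] steps. *)
Lemma nilpotent_pow_field (F : fieldType) n (A : 'M[F]_n) (B : nat -> 'M[F]_n) :
    B 0%N = 1%:M -> (forall k, B k.+1 = B k *m A) -> (forall k, B k.+1 = A *m B k) ->
  forall k, B k = 0 -> B n = 0.
Proof.
move=> B0 BS BS' k Bk.
have dec i : (B i.+1 <= B i)%MS by rewrite BS' submxMl.
have stab i : (B i <= B i.+1)%MS -> forall j, (B i <= B (i + j)%N)%MS.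
  move=> Hi; elim=> [|j IH]; first by rewrite addn0.
  apply: submx_trans IH _; rewrite addnS.
  elim: j => [|j IH]; first by rewrite addn0.
  by rewrite addnS BS [X in (_ <= X)%MS]BS; apply: submxMr.
have decj i j : (B (i + j)%N <= B i)%MS.
  elim: j => [|j IH]; first by rewrite addn0.
  by rewrite addnS; apply: submx_trans (dec _) IH.
have rk i : (\rank (B i) <= n - i)%N.
  elim: i => [|i IH]; first by rewrite subn0 rank_leq_row.
  have [le|nle] := boolP (B i <= B i.+1)%MS.
    have Bi0 : B i = 0.
      apply/eqP; rewrite -submx0; apply: submx_trans (stab i le k) _.
      by rewrite addnC; apply: submx_trans (decj k i) _; rewrite Bk.
    by rewrite BS Bi0 mul0mx mxrank0.
  have := IH; rewrite leq_eqVlt => /orP[/eqP e|lt].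
    have : (\rank (B i.+1) < \rank (B i))%N.
      by rewrite ltn_neqAle mxrankS ?dec // andbT; apply: contra nle => /eqP e'; rewrite -(geq_leqif (mxrank_leqif_sup (dec i))) e'.
    by rewrite e; lia.
  by apply: leq_trans (mxrankS (dec i)) _; lia.
by apply/eqP; rewrite -mxrank_eq0 -leqn0 -[X in (_ <= X)%N](subnn n) rk.
Qed.

Lemma nilpotent_pow (O : idomainType) n (A : 'M[O]_n) (B : nat -> 'M[O]_n) :
    B 0%N = 1%:M -> (forall k, B k.+1 = B k *m A) -> (forall k, B k.+1 = A *m B k) ->
  forall k, B k = 0 -> B n = 0.
Proof.
move=> B0 BS BS' k Bk; pose fr := @FracField.tofrac O.
have : map_mx fr (B n) = 0.
  apply: (@nilpotent_pow_field _ n (map_mx fr A) (fun k => map_mx fr (B k)) _ _ _ k).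
  - by rewrite B0 map_mx1.
  - by move=> i; rewrite BS map_mxM.
  - by move=> i; rewrite BS' map_mxM.
  - by rewrite Bk map_mx0.
move/matrixP => E; apply/matrixP => i j; have := E i j; rewrite !mxE.
by move/eqP; rewrite tofrac_eq0 => /eqP.
Qed.

Lemma adj_comm (O : idomainType) n (Z X : 'M[O]_n) :
  \det Z != 0 -> Z *m X = X *m Z -> \adj Z *m X = X *m \adj Z.
Proof.
move=> nz ZX.
have E : \det Z *: (\adj Z *m X) = \det Z *: (X *m \adj Z).
  rewrite -!mul_scalar_mx -[in RHS]mul_adj_mx mul_scalar_mx -mul_mx_scalar -mul_mx_adj.
  by rewrite !mulmxA -(mulmxA _ X) -ZX !mulmxA.
apply/matrixP => i j; have := congr1 (fun A : 'M[O]_n => A i j) E.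
by rewrite /= !mxE => /(mulfI nz).
Qed.

Lemma plift_tX d (K : fieldType) : plift d (tX K) = tX (fps d K).
Proof. exact: pliftX. Qed.

Lemma plift_alg d e (K : fieldType) (c : K) :
  plift d (c%:A : fps e K) = (c%:A : fps d K)%:A.
Proof.
apply/fpsP => k; rewrite fcoef_plift !fcoefZ !fcoef1.
by case: eqP; rewrite ?mulr1 ?mulr0 ?scale0r.
Qed.

Lemma algM (d e : nat) (K : fieldType) (x y : fps d K) :
  (x * y)%:A = x%:A * y%:A :> fps e (fps d K).
Proof. exact: (rmorphM (in_alg _)). Qed.

Lemma algX (d e : nat) (K : fieldType) (x : fps d K) k :
  (x ^+ k)%:A = x%:A ^+ k :> fps e (fps d K).
Proof. exact: (rmorphXn (in_alg _)). Qed.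

Lemma algZ (d e : nat) (K : fieldType) (c : K) (x : fps d K) :
  (c *: x)%:A = (c%:A : fps d K)%:A * x%:A :> fps e (fps d K).
Proof. by rewrite -algM -scalerAl mul1r. Qed.

(** In characteristic zero, differentiation lowers a positive order by exactly one, whereas the
    right-hand side has larger order than [N]. *)
Lemma log_deriv_unit (K : numFieldType) (N u : fps 1 K) :
  N != 0 -> fps_deriv ord0 N = tX K * (N * u) -> fconst N != 0.
Proof.
move=> nz DN; have [|k ck min] := @ex_minnP (fun k => co N k != 0).
  apply/not_existsP => H; case/eqP: nz; apply: coP => n.
  by have /negP := H n; rewrite negbK => /eqP ->.
case: k ck min => [//|k] ck min.
have Nk : ordge k.+1 N.
  apply/co_ordge => j lt; apply/eqP; apply: contraTT lt => /min.
  by rewrite -leqNgt.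
have := congr1 (fun x => co x k) DN; rewrite /= co_deriv.
have -> : co (tX K * (N * u)) k = 0.
  have /co_ordge -> // : ordge k.+2 (tX K * (N * u)).
  by apply: (@ordgeM _ _ 1 k.+1); [exact: ordge_X | exact: ordgeMr].
by move/eqP; rewrite mulrn_eq0 /= (negbTE ck).
Qed.

Section SeriesRep.
Variables (d : nat) (K : fieldType).
Local Notation R := (fps d K).
Local Notation S := (fps 1 R).
Local Notation O := (fps 1 K).
Local Notation t := (tX R).
Local Notation pl := (@plift d 1 K).
Local Notation Dt := (map_mx (@fps_deriv 1 K ord0)).
Variables (n m : nat) (g : 'I_n -> R) (p : 'I_n -> S) (v : 'I_m -> R) (T : set S).
Hypotheses (idT : ideal T) (satT : forall h, T (t * h) -> T h)
  (sv : spans (idl g) v) (Tg : forall j, T ((g j)%:A - t * p j)).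

(** Modulo [T] the series form a free module of finite rank over [K[[t]]]. The chain rule holds
    exactly under the trace, since its defect is divisible by every power of [t]. *)
Lemma series_rep : exists r (rep : S -> 'M[O]_r),
  [/\ (r <= m)%N,
      [/\ {morph rep : h h' / h + h'}, forall h h', rep (h * h') = rep h *m rep h',
          forall q, rep (pl q) = q%:M & forall h, rep h = 0 <-> T h],
      forall h, \det (rep h) = 0 -> exists h', T (h * h') /\ ~ T h' &
      forall G, (forall h, G *m rep h = rep h *m G) -> forall x : R,
        \tr (G *m Dt (rep x%:A)) =
        \sum_i \tr (G *m rep (fps_deriv i x)%:A *m Dt (rep (fps_X K i)%:A))].
Proof.
have gb : gens pl T (fun l => (v l)%:A : S).
  move=> h; have [j|q Hq] := @expansion d 1 n K 'I_m g (fun j => t * p j) v _ sv h.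
    by apply: (@ordgeM _ _ 1 0) => //; exact: ordge_X.
  exists q; apply: idl_min Hq => // j; exact: Tg.
have [||r [b [rm gb' fb]]] := @free_gens S O pl T idT (tX K) m _ _ _ gb.
- by move=> h Hh; apply: satT; rewrite -plift_tX; exact: Hh.
- by move=> k q l0; apply: fps1_content.
have [rep [repD repM repl repT [repv _]]] := free_rep idT gb' fb.
have rep_eq h h' : T (h - h') -> rep h = rep h'.
  by move/repT => E; rewrite -[h](subrK h') repD E add0r.
have rept h : rep (t * h) = tX K *: rep h.
  by rewrite -plift_tX repM repl mul_scalar_mx.
exists r, rep; split=> //.
  move=> h h0; have /det0P[u u0 hu] : \det (rep h)^T == 0 by rewrite det_tr h0.
  exists (\sum_l b l * pl ((u^T) l ord0)); split.
    by apply: repv; rewrite -[rep h]trmxK -trmx_mul hu trmx0.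
  move=> /fb H; case/eqP: u0; apply/rowP => l; rewrite mxE.
  by have := H l; rewrite mxE.
move=> G GC x; have [L HL] := fin_codim_ordge (idl_ideal g) sv.
have rpC (c : K) : rep (c%:A : R)%:A = (in_alg O c)%:M.
  by rewrite -repl; congr rep; exact: esym (plift_alg d 1 c).
have deep y : ordge L y -> exists B, rep y%:A = tX K *: B /\ rp_comm (fun x : R => rep x%:A) B.
  move=> /HL [a ->]; exists (rep (\sum_j (a j)%:A * p j)); split; last first.
    by move=> z; rewrite -!repM mulrC.
  rewrite -rept; apply: rep_eq; rewrite scaler_suml mulr_sumr -sumrB.
  apply: (ideal_sum idT) => j _.
  have -> : (a j * g j)%:A - t * ((a j)%:A * p j) = (a j)%:A * ((g j)%:A - t * p j).
    by rewrite algM mulrBr [t * _]mulrCA.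
  exact: (idealM idT).
apply/eqP; rewrite -subr_eq0; apply/eqP/ordge_eq0 => k.
have [||||||u Hu] := @defect_divisible d K O (in_alg O) (fps_deriv ord0) (tX K) _ _ _ r L
   (fun x => rep x%:A) _ _ rpC deep k G x.
- exact: fps_derivD.
- exact: fps_derivM.
- by move=> c /=; rewrite fps_derivZ fps_deriv1 scaler0.
- by move=> y z; rewrite -repD scalerDl.
- by move=> y z; rewrite -repM algM.
- by move=> y; apply: GC.
apply: (@eq_ind_r _ (tX K ^+ k * u) (ordge k) _ _ Hu); apply: ordgeMr; apply: ordgeXn; exact: ordge_X.
Qed.

End SeriesRep.

Section CriticalValues.
Variables (d : nat) (K : numFieldType).
Local Notation R := (fps d K).
Local Notation S := (fps 1 R).
Local Notation O := (fps 1 K).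
Local Notation t := (tX R).
Local Notation pl := (@plift d 1 K).
Local Notation Dt := (map_mx (@fps_deriv 1 K ord0)).
Variable f : R.
Hypothesis f0 : ordge 1 f.
Local Notation df := (fun i => fps_deriv i f).

Lemma natr_fps_eq0 e k : (k%:R == 0 :> fps e K) = (k == 0%N).
Proof.
apply/eqP/eqP => [E|->//]; have := congr1 (@fconst e K) E.
by rewrite rmorph_nat /fconst fcoef0 => /eqP; rewrite pnatr_eq0 => /eqP.
Qed.

(* Where [f] is invertible on the critical scheme, [t = f] gives
   [1 = dt/dt = sum_i f_i dx_i/dt = 0]. *)
Lemma nilpotent_mod_jacobian m (v : 'I_m -> R) :
  spans (idl (fcons f df)) v -> exists k, idl df (f ^+ k).
Proof.
move=> sv; pose g := fcons f df; pose p : 'I_d.+1 -> S := fcons 1 (fun=> 0).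
pose I := idl (pgen g (fun j => t * p j)).
have idI : ideal I := idl_ideal _.
(* The relations [f = t] and [f_i = 0], saturated by [t], which discards what is supported at
   [t = 0]. *)
pose T : set S := [set h | exists k, I (t ^+ k * h)].
have idT : ideal T.
  split=> [|x y [k Hx] [l Hy]|a x [k Hx]].
  - by exists 0%N; rewrite mulr0; exact: ideal0.
  - exists (k + l)%N; rewrite mulrDr exprD; apply: (idealD idI).
      by rewrite [t ^+ k * _]mulrC -mulrA; apply: (idealM idI).
    by rewrite -mulrA; apply: (idealM idI).
  - by exists k; rewrite mulrCA; apply: (idealM idI).
have satT h : T (t * h) -> T h by move=> [k Hk]; exists k.+1; rewrite exprSr -mulrA.
have Tg j : T ((g j)%:A - t * p j) by exists 0%N; rewrite mul1r; exact: idl_mem.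
have [r [rep [_ [repD repM repl repT] _ chain]]] := series_rep idT satT sv Tg.
have rep_eq h h' : T (h - h') -> rep h = rep h'.
  by move/repT => E; rewrite -[h](subrK h') repD E add0r.
(* With [G = 1] the chain rule for [f] reads [r = 0] in [K[[t]]]. *)
have r0 : r = 0%N.
  have E := chain 1%:M (fun h => etrans (mul1mx _) (esym (mulmx1 _))) f.
  have Ef : rep f%:A = (tX K)%:M.
    rewrite -repl; apply: rep_eq; rewrite plift_tX.
    by have := Tg ord0; rewrite /g /p !fcons0 mulr1.
  have Edf i : rep (df i)%:A = 0.
    by apply/repT; have := Tg (lift ord0 i); rewrite /g /p !fconsS mulr0 subr0.
  move: E; rewrite Ef mul1mx big1 => [|i _]; last first.
    by rewrite Edf mulmx0 mul0mx mxtrace0.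
  have -> : Dt (tX K)%:M = 1%:M :> 'M[O]_r.
    apply/matrixP => i j; rewrite !mxE; case: (i == j); rewrite ?mulr1n ?mulr0n.
      by rewrite fps_derivX eqxx.
    by apply/fpsP => k; rewrite fcoef_deriv fcoef0 mul0rn.
  by rewrite mxtrace1 => /eqP; rewrite natr_fps_eq0 => /eqP.
have [k Ik] : T 1 by apply/repT; apply/matrixP => i; have := ltn_ord i; rewrite {2}r0.
exists k; rewrite mulr1 in Ik; case: Ik => h hE.
pose J := idl df; have idJ : ideal J := idl_ideal _.
pose a j := co (h ord0) j.
pose a' j := if j is j'.+1 then a j' else 0.
(* The coefficient of [t^j] in the expression of [t^k] by the generators, taken modulo [J].
   Eliminating the [a j] in turn leaves [f^k (1 - a_k f)] in [J], where the second factor is a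
   unit. *)
have rel j : J ((j == k)%:R - (a j * f - a' j)).
  have := congr1 (fun x => co x j) hE; rewrite /= co_tXn => ->.
  rewrite big_ord_recl coD /pgen /g /p !fcons0 mulr1 mulrBr coD coN co_algM.
  rewrite [h ord0 * t]mulrC co_tXM -/(a' j) -/(a j) addrC addKr co_sum.
  apply: (ideal_sum idJ) => i _; rewrite !fconsS mulr0 subr0 co_algM.
  by apply: (idealM idJ); exact: idl_mem.
have low j : (j <= k)%N -> J (f ^+ j * a' j).
  elim: j => [|j IH] jk; first by rewrite mulr0; exact: ideal0.
  rewrite /= exprSr -mulrA [f * _]mulrC.
  have := rel j; rewrite (ltn_eqF jk) sub0r opprB => H.
  apply: (ideal_eq idJ _ (IH (ltnW jk))).
  by rewrite -mulrBr; apply: (idealM idJ); apply: (ideal_sym idJ).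
have := rel k; rewrite eqxx => H.
have [w Hw] := @geom_inverse _ _ (a k * f) (@ordgeMl _ _ 1 (a k) f f0).
have : J (f ^+ k * (1 - a k * f)).
  have -> : f ^+ k * (1 - a k * f) = f ^+ k * (1 - (a k * f - a' k)) - f ^+ k * a' k.
    by rewrite -mulrBr; congr (_ * _); rewrite opprB addrA -[RHS]addrA -opprD [RHS]addrAC; ring.
  by apply: (idealB idJ); [apply: (idealM idJ) | apply: low].
by move=> H'; have := idealM idJ w H'; rewrite mulrC -mulrA Hw mulr1.
Qed.

(* [N = det f] on the part of the family where [f] is invertible satisfies
   [N' = t N (sum_i c_i tr x_i)'] because [f' = sum_i f_i x_i' = t f (sum_i c_i x_i)'],
   so [N] cannot vanish at [t = 0]. *)
Lemma nilpotent_on_line m (v : 'I_m -> R) (c : 'I_d -> K) :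
    spans (idl df) v ->
  exists k, idl (pgen df (fun i => t * (c i *: f)%:A)) (t ^+ k * (f ^+ m)%:A).
Proof.
move=> sv; pose p i : S := (c i *: f)%:A.
pose I := idl (pgen df (fun i => t * p i)); rewrite -/I.
have idI : ideal I := idl_ideal _.
pose sat (u : S) : set S := [set h | exists k, I (u ^+ k * h)].
have idsat u : ideal (sat u).
  split=> [|x y [k Hx] [l Hy]|a x [k Hx]].
  - by exists 0%N; rewrite mulr0; exact: ideal0.
  - exists (k + l)%N; rewrite mulrDr exprD; apply: (idealD idI).
      by rewrite [u ^+ k * _]mulrC -mulrA; apply: (idealM idI).
    by rewrite -mulrA; apply: (idealM idI).
  - by exists k; rewrite mulrCA; apply: (idealM idI).
have satK (a b x h : S) : a * b * x * h = b * (x * (a * h)) by ring.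
have sat1 a b h : sat (a * b) (a * h) -> sat (a * b) h.
  by move=> [k Hk]; exists k.+1; rewrite exprS satK; apply: (idealM idI).
have satI u j : sat u ((df j)%:A - t * p j).
  by exists 0%N; rewrite mul1r; exact: idl_mem.
(* The part where [t] and [f] are both invertible is empty: its determinant [\det Z] would be
   nonzero at [t = 0] by [log_deriv_unit], while a power of [f] lies in the Jacobian ideal and so
   acts by a multiple of [t]. *)
have [k Hk] : sat (t * f%:A) 1.
  have satt h : sat (t * f%:A) (t * h) -> sat (t * f%:A) h by apply: sat1.
  have satf h : sat (t * f%:A) (f%:A * h) -> sat (t * f%:A) h by rewrite mulrC; apply: sat1.
  have [r [rep [_ [repD repM repl repT] det0 chain]]] :=
    series_rep (idsat (t * f%:A)) satt sv (satI (t * f%:A)).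
  have rep_eq h h' : sat (t * f%:A) (h - h') -> rep h = rep h'.
    by move/repT => E; rewrite -[h](subrK h') repD E add0r.
  have rept h : rep (t * h) = tX K *: rep h.
    by rewrite -plift_tX repM repl mul_scalar_mx.
  have repCC h h' : rep h *m rep h' = rep h' *m rep h by rewrite -!repM mulrC.
  pose Z := rep f%:A.
  have N0 : \det Z != 0.
    by apply/eqP => /det0 [h' [/satf]].
  have repdf i : rep (df i)%:A = (tX K * (c i)%:A) *: Z.
    by rewrite (rep_eq _ _ (satI _ i)) rept /p algZ repM -plift_alg repl mul_scalar_mx scalerA.
  pose u : O := \sum_i (c i)%:A * \tr (Dt (rep (fps_X K i)%:A)).
  have DN : fps_deriv ord0 (\det Z) = tX K * (\det Z * u).
    rewrite (deriv_det _ _ (@fps_derivD 1 K ord0) (@fps_derivM 1 K ord0)); last 2 first.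
    - by have := @fps_derivZ 1 K ord0 0 0; rewrite !scale0r.
    - exact: fps_deriv1.
    rewrite (chain _ (fun h => adj_comm N0 (repCC f%:A h))).
    rewrite /u !mulr_sumr; apply: eq_bigr => i _.
    rewrite repdf -scalemxAr mul_adj_mx -scalemxAl mul_scalar_mx !mxtraceZ.
    by rewrite -mulrA; congr (_ * _); rewrite mulrCA.
  have cN := log_deriv_unit N0 DN.
  have [L HL] := fin_codim_ordge (idl_ideal df) sv.
  have [a aE] := HL _ (ordgeXn (n := L) f0).
  have detX l : \det (rep (f ^+ l)%:A) = \det Z ^+ l.
    elim: l => [|l IH]; first by rewrite !expr0 scale1r -(rmorph1 pl) repl det1.
    by rewrite !exprS algM repM det_mulmx IH.
  have [B HB] : exists B, rep (f ^+ L)%:A = tX K *: B.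
    exists (rep (\sum_i (a i)%:A * p i)); rewrite -rept; apply: rep_eq.
    rewrite aE scaler_suml mulr_sumr -sumrB; apply: (ideal_sum (idsat _)) => j _.
    have -> : (a j * df j)%:A - t * ((a j)%:A * p j) = (a j)%:A * ((df j)%:A - t * p j).
      by rewrite algM mulrBr [t * _]mulrCA.
    exact: (idealM (idsat _)).
  apply/repT; have := detX L; rewrite HB detZ => E.
  have [r0|r0] := posnP r.
    by apply/matrixP => i; have := ltn_ord i; rewrite {2}r0.
  have : fconst (\det Z ^+ L) != 0 by rewrite rmorphXn expf_neq0.
  rewrite -E (_ : fconst _ = 0) ?eqxx //; apply/ordge1P; apply: ordgeMr.
  by apply: (ordgeW r0); apply: ordgeXn; exact: ordge_X.
(* With saturation by [t] alone, [f] is now nilpotent on a free module of rank at most [m], so its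
   [m]-th power vanishes there. *)
have idT := idsat t.
have satt h : sat t (t * h) -> sat t h.
  by move=> [j Hj]; exists j.+1; rewrite exprSr -mulrA.
have [r [rep [rm [repD repM repl repT] _ _]]] := series_rep idT satt sv (satI t).
suff [l Hl] : sat t (f ^+ m)%:A by exists l.
rewrite -(subnK rm) exprD algM; apply: (idealM idT); apply/repT.
apply: (@nilpotent_pow O r (rep f%:A) (fun i => rep (f ^+ i)%:A) _ _ _ k).
- by rewrite expr0 scale1r -(rmorph1 pl) repl.
- by move=> i; rewrite exprSr algM repM.
- by move=> i; rewrite exprS algM repM.
- by apply/repT; exists k; rewrite algX -exprMn -[X in I X]mulr1.
Qed.

End CriticalValues.

(** * Coordinates over the partial derivatives *)

Section HomogeneousValues.
Variables (d : nat) (A : comNzRingType) (c : 'I_d -> A).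
Implicit Types x y : fps d A.

Definition cmon (k : multinom d) : A := \prod_i c i ^+ k i.

Lemma cmonD k l : cmon (mnm_add k l) = cmon k * cmon l.
Proof. by rewrite /cmon -big_split; apply: eq_bigr => i _; rewrite mnmDE exprD. Qed.

(** The value at the point [c] of the homogeneous part of degree [n]. *)
Definition hval n x : A := \sum_(k : bmultinom d n.+1 | mdeg k == n) fcoef x k * cmon k.

Lemma big_bmultinom (F : multinom d -> A) (P : pred (multinom d)) b b' : (b <= b')%N ->
    (forall k, P k -> (mdeg k < b)%N) ->
  \sum_(k : bmultinom d b' | P k) F k = \sum_(k : bmultinom d b | P k) F k.
Proof.
move=> le HP.
pose h (k : bmultinom d b) : bmultinom d b' := BMultinom (leq_trans (bmdeg k) le).
rewrite (reindex_omap h (fun k : bmultinom d b' => insub (k : multinom d))) /=.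
  apply: eq_bigl => k; rewrite /h /= insubT ?bmdeg // => lt /=.
  by rewrite (_ : Sub _ _ = k) ?eqxx ?andbT //; apply: val_inj.
move=> k Pk; rewrite insubT ?HP // => lt /=; congr Some; exact: val_inj.
Qed.

Lemma hvalE n b x : (n < b)%N ->
  hval n x = \sum_(k : bmultinom d b | mdeg k == n) fcoef x k * cmon k.
Proof.
move=> lt; rewrite (@big_bmultinom (fun k => fcoef x k * cmon k) (fun k => mdeg k == n) n.+1 b) //.
by move=> k /eqP ->.
Qed.

Lemma hvalD n x y : hval n (x + y) = hval n x + hval n y.
Proof. by rewrite -big_split; apply: eq_bigr => k _; rewrite fcoefD mulrDl. Qed.

Lemma hvalN n x : hval n (- x) = - hval n x.
Proof. by rewrite -sumrN; apply: eq_bigr => k _; rewrite fcoefN mulNr. Qed.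

Lemma hvalZ n a x : hval n (a *: x) = a * hval n x.
Proof. by rewrite mulr_sumr; apply: eq_bigr => k _; rewrite fcoefZ mulrA. Qed.

Lemma hvalM n x y : hval n (x * y) = \sum_(i < n.+1) hval i x * hval (n - i) y.
Proof.
pose B := bmultinom d n.+1.
transitivity (\sum_(p : B * B | (mdeg p.1 + mdeg p.2)%N == n)
    fcoef x p.1 * cmon p.1 * (fcoef y p.2 * cmon p.2)).
  rewrite /hval (eq_bigr (fun k : B => \sum_(p : B * B | bmnm k == mnm_add p.1 p.2)
     fcoef x p.1 * cmon p.1 * (fcoef y p.2 * cmon p.2))); last first.
    move=> k _; rewrite (fps_mulE _ _ (bmdeg k)) [LHS](_ : _ =
      (\sum_(p : B * B | bmnm k == mnm_add p.1 p.2) fcoef x p.1 * fcoef y p.2) * cmon k).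
      rewrite mulr_suml; apply: eq_bigr => p /eqP ->; rewrite cmonD; ring.
    congr (_ * _); rewrite [LHS](mcoeff_poly_mul _ _ (bmdeg k)).
    by apply: eq_bigr => p _; rewrite !fps_truncE ?bmdeg.
  rewrite (exchange_big_dep (fun p : B * B => (mdeg p.1 + mdeg p.2)%N == n)) /=.
    apply: eq_bigr => p /eqP dp.
    have lt : (mdeg (mnm_add p.1 p.2) < n.+1)%N by rewrite mdegD dp.
    rewrite (big_pred1 (BMultinom lt)) // => k /=.
    rewrite -[RHS](inj_eq val_inj) /=.
    case: (eqVneq (bmnm k) (mnm_add p.1 p.2)) => [->|_]; rewrite ?andbF //.
    by rewrite mdegD dp eqxx.
  by move=> k p /eqP dk /eqP kp; rewrite -mdegD -kp dk eqxx.
under [RHS]eq_bigr => i _.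
  rewrite (hvalE x (ltn_ord i)) (hvalE (b := n.+1) y); last by rewrite ltnS leq_subr.
  rewrite mulr_suml; under eq_bigr do rewrite mulr_sumr; over.
rewrite /=; under [RHS]eq_bigr do rewrite pair_big /=.
rewrite (exchange_big_dep (fun p : B * B => (mdeg p.1 + mdeg p.2)%N == n)) /=; last first.
  by move=> i p _ /andP[/eqP -> /eqP ->]; rewrite subnKC // -ltnS.
apply: eq_bigr => p /eqP dp.
have lt : (mdeg p.1 < n.+1)%N by rewrite ltnS; apply: leq_trans (leq_addr _ _) (eq_leq dp).
rewrite (big_pred1 (Ordinal lt)) // => i /=.
rewrite -[RHS](inj_eq val_inj) /= eq_sym; case: eqP => //= ->.
have -> : (n - mdeg p.1)%N = mdeg p.2 by rewrite -[X in (X - _)%N]dp addKn.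
exact: eqxx.
Qed.

Lemma hval1 n : hval n 1 = (n == 0%N)%:R.
Proof.
rewrite /hval; case: n => [|n].
  rewrite (big_pred1 (@bm0 d 0)) /= ?fcoef1 ?eqxx ?mul1r.
    by rewrite /cmon big1 // => i _; rewrite mnm0E.
  by move=> k /=; rewrite mdeg_eq0 -[RHS](inj_eq val_inj).
rewrite big1 // => k /eqP dk; rewrite fcoef1; case: eqP => [e|_]; rewrite ?mul0r //.
by move: dk; rewrite e mdeg0.
Qed.

Lemma hvalX n i : hval n (fps_X A i) = if n == 1%N then c i else 0.
Proof.
rewrite /hval; case: eqP => [->|n1].
  have lt : (mdeg (mnm1 i) < 2)%N by rewrite mdeg1.
  rewrite (bigD1 (BMultinom lt)) /= ?mdeg1 // fcoef_X eqxx mul1r big1 ?addr0.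
    rewrite /cmon (bigD1 i) //= mnm1E eqxx big1 ?mulr1 // => j nj.
    by rewrite mnm1E eq_sym (negbTE nj).
  move=> k /andP[_ nk]; rewrite fcoef_X; case: eqP => [e|_]; rewrite ?mul0r //.
  by case/eqP: nk; apply: val_inj.
rewrite big1 // => k /eqP dk; rewrite fcoef_X; case: eqP => [e|_]; rewrite ?mul0r //.
by case: n1; rewrite -dk e mdeg1.
Qed.

End HomogeneousValues.

Section LineEvaluation.
Variable A : comNzRingType.

Lemma hval_co n (x : fps 1 A) : hval (fun=> 1) n x = co x n.
Proof.
have lt : (mdeg (mon1 n) < n.+1)%N by rewrite mdeg_mon1.
rewrite /hval (big_pred1 (BMultinom lt)) /=.
  by rewrite /cmon big1 ?mulr1 // => i _; rewrite expr1n.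
move=> k /=; rewrite -[RHS](inj_eq val_inj) /=; apply/eqP/eqP => [dk|->].
  by rewrite (mon1E k) dk.
exact: mdeg_mon1.
Qed.

Lemma coM (x y : fps 1 A) n : co (x * y) n = \sum_(i < n.+1) co x i * co y (n - i).
Proof. by rewrite -hval_co hvalM; apply: eq_bigr => i _; rewrite !hval_co. Qed.

Variables (d : nat) (c : 'I_d -> A).

(** Restriction to the line through the origin with direction [c]. *)
Definition ev_line (x : fps d A) : fps 1 A := Fps (fun m => hval c (mdeg m) x).

Lemma co_ev_line x n : co (ev_line x) n = hval c n x.
Proof. by rewrite /co fcoefE mdeg_mon1. Qed.

Fact ev_line_is_zmod_morphism : zmod_morphism ev_line.
Proof. by move=> x y; apply: coP => n; rewrite coD coN !co_ev_line hvalD hvalN. Qed.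

Fact ev_line_is_monoid_morphism : monoid_morphism ev_line.
Proof.
split=> [|x y]; apply: coP => n.
  by rewrite co_ev_line hval1 -(expr0 (tX A)) co_tXn.
by rewrite co_ev_line hvalM coM; apply: eq_bigr => i _; rewrite !co_ev_line.
Qed.

HB.instance Definition _ :=
  GRing.isZmodMorphism.Build (fps d A) (fps 1 A) ev_line ev_line_is_zmod_morphism.
HB.instance Definition _ :=
  GRing.isMonoidMorphism.Build (fps d A) (fps 1 A) ev_line ev_line_is_monoid_morphism.

Lemma ev_lineX i : ev_line (fps_X A i) = c i *: tX A.
Proof.
apply: coP => n; rewrite co_ev_line hvalX -[c i *: _](mulr_algl) mulrC co_algM.
rewrite -[tX A]expr1 co_tXn; case: eqP; by rewrite ?mul1r ?mul0r.
Qed.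

Lemma ev_line_alg a : ev_line (a%:A) = a%:A.
Proof.
apply: coP => n; rewrite co_ev_line hvalZ hval1 co_alg.
by case: (n == 0%N); rewrite ?mulr1 ?mulr0.
Qed.

End LineEvaluation.

Lemma base_expansion_inj b d (k l : 'I_d -> nat) :
    (forall i, (k i < b)%N) -> (forall i, (l i < b)%N) ->
  (\sum_i k i * b ^ i = \sum_i l i * b ^ i)%N -> k =1 l.
Proof.
elim: d k l => [|d IH] k l hk hl; first by move=> _ [].
have E (m : 'I_d.+1 -> nat) : (\sum_(i < d.+1) m i * b ^ i =
   (\sum_(i < d) m (lift ord0 i) * b ^ i) * b + m ord0)%N.
  rewrite big_ord_recl muln1 addnC; congr (_ + _)%N.
  by rewrite big_distrl; apply: eq_bigr => i _ /=; rewrite /bump /= add1n expnSr mulnA.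
rewrite !E => H.
have b0 : (0 < b)%N by apply: leq_ltn_trans (hk ord0).
have k0 : k ord0 = l ord0.
  by have := congr1 (fun x => x %% b)%N H; rewrite !modnMDl !modn_small.
have := IH (fun i => k (lift ord0 i)) (fun i => l (lift ord0 i)) (fun i => hk _) (fun i => hl _).
move: H; rewrite k0 => /addIn/eqP; rewrite eqn_pmul2r // => /eqP -> /(_ erefl) kl i.
by have [j ->|->] := unliftP ord0 i; [exact: kl | exact: k0].
Qed.

Lemma poly_nat_roots (K : numFieldType) (q : {poly K}) :
  (forall j : nat, q.[j%:R] = 0) -> q = 0.
Proof.
move=> H; apply/eqP; apply: contraT => nz.
have := @max_poly_roots K q [seq j%:R | j <- iota 0 (size q)] nz.
rewrite size_map size_iota ltnn; apply.
  by apply/allP => _ /mapP[j _ ->]; rewrite /root H.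
by rewrite map_inj_uniq ?iota_uniq // => i j /eqP; rewrite eqr_nat => /eqP.
Qed.

(* Evaluate at the points [a ^ (b ^ i)], where monomials become distinct powers of [a]. *)
Lemma hval_eq0 (K : numFieldType) d n (x : fps d K) :
  (forall c : 'I_d -> K, hval c n x = 0) -> forall k, mdeg k = n -> fcoef x k = 0.
Proof.
move=> H k0 dk0.
pose w (k : multinom d) := (\sum_i k i * n.+1 ^ i)%N.
pose q : {poly K} := \sum_(k : bmultinom d n.+1 | mdeg k == n) fcoef x k *: 'X^(w k).
have q0 : q = 0.
  apply: poly_nat_roots => a; rewrite -[RHS](H (fun i => a%:R ^+ (n.+1 ^ i))) /q /hval horner_sum.
  apply: eq_bigr => k _; rewrite hornerZ hornerXn; congr (_ * _).
  by rewrite /w /cmon expr_sum; apply: eq_bigr => i _; rewrite -exprM mulnC.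
have lt0 : (mdeg k0 < n.+1)%N by rewrite dk0.
have := congr1 (fun p : {poly K} => p`_(w k0)) q0.
rewrite /q coef_sum coef0 (bigD1 (BMultinom lt0)) /= ?dk0 // coefZ coefXn eqxx mulr1.
rewrite big1 ?addr0 // => k /andP[/eqP dk nk]; rewrite coefZ coefXn.
case: eqP => [e|_]; last by rewrite mulr0.
case/eqP: nk; apply/val_inj/mnmP => /= i.
by apply: (base_expansion_inj (b := n.+1) _ _ (esym e)) => j; rewrite ltnS;
  apply: leq_trans (mnm1_le_deg j _) _; rewrite ?dk ?dk0.
Qed.

Section JacobianCoordinates.
Variables (d : nat) (K : numFieldType) (f : fps d K) (mu : nat) (v : 'I_mu -> fps d K).
Local Notation R := (fps d K).
Local Notation P := (fps d K).
Local Notation df := (fun i => fps_deriv i f).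
Local Notation pl := (@plift d d K).
Hypotheses (f0 : ordge 1 f) (bv : basis_mod (idl df) v).

(* [R] is free over the power series in the partial derivatives of [f]: [kap] gives
   the coordinates and [M] the matrices of multiplication in the basis [v]. *)
Lemma jacobian_coordinates : exists (kap : R -> 'cV[P]_mu) (M : R -> 'M[P]_mu),
  [/\ (forall x y, kap (x + y) = kap x + kap y) /\
      (forall (a : K) x, kap (a *: x) = (a%:A : P) *: kap x),
      forall l, kap (v l) = \col_i (i == l)%:R,
      forall x y, kap (x * y) = M x *m kap y,
      forall i x, kap (df i * x) = fps_X K i *: kap x &
      forall l i j, ordge l.+1 (M (f ^+ (mu + l)) i j)].
Proof.
have [iv sv] := bv.
(* The relations [f_i = y_i] with independent parameters [y_i]: they turn [R] into a module over
   [K[[y_1, ..., y_d]]]. *)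
pose g := df; pose p i : fps d R := fps_X R i.
have p1 i : ordge 1 (p i) by exact: ordge_X.
pose T := idl (pgen g p); have idT : ideal T := idl_ideal _.
have [L HL] := fin_codim_ordge (idl_ideal g) sv.
have syz : syz_trivial g.
  apply: (@parameters_syz_trivial d K g L) => i.
  by apply: HL; apply: ordgeXn; exact: ordge_X.
pose b l : fps d R := (v l)%:A.
have gb : gens pl T b by exact: (expansion p1 sv).
have fb : free_mod pl T b by exact: (expansion_unique p1 syz iv).
have [rep [repD repM repl repT [_ repP]]] := free_rep idT gb fb.
have rep_eq h h' : T (h - h') -> rep h = rep h'.
  by move/repT => E; rewrite -[h](subrK h') repD E add0r.
have [kq kqP] := choice (fun x : R => gb x%:A).
pose kap (x : R) : 'cV[P]_mu := \col_i kq x i.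
have kapP x : T (x%:A - \sum_i b i * pl (kap x i ord0)).
  by under eq_bigr do rewrite mxE; exact: kqP.
have kapu x (w : 'cV[P]_mu) : T (x%:A - \sum_i b i * pl (w i ord0)) -> kap x = w.
  move=> H; apply/colP => i.
  apply: (free_eq fb (q := fun i => kap x i ord0) (q' := fun i => w i ord0)).
  by apply: (ideal_trans idT) H; apply: (ideal_sym idT); exact: kapP.
pose M (x : R) := rep x%:A.
have Mdf i : M (df i) = (fps_X K i)%:M.
  have E : T ((df i)%:A - pl (fps_X K i)) by have -> : pl (fps_X K i) = fps_X R i := @pliftX d d K i; exact: idl_mem.
  exact: etrans (rep_eq _ _ E) (repl _).
have kapM x y : kap (x * y) = M x *m kap y.
  apply: kapu; rewrite algM.
  apply: (ideal_trans idT (y := x%:A * \sum_l b l * pl (kap y l ord0))).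
    by rewrite -mulrBr; apply: (idealM idT).
  have -> : x%:A * (\sum_l b l * pl (kap y l ord0)) - \sum_i b i * pl ((M x *m kap y) i ord0) =
    \sum_l pl (kap y l ord0) * (x%:A * b l - \sum_i b i * pl (M x i l)).
    under [RHS]eq_bigr do rewrite mulrBr mulr_sumr.
    rewrite sumrB exchange_big mulr_sumr /=; congr (_ - _).
      by apply: eq_bigr => l _; rewrite [RHS]mulrC mulrA.
    apply: eq_bigr => i _; rewrite mxE rmorph_sum mulr_sumr.
    by apply: eq_bigr => l _; rewrite rmorphM [RHS]mulrCA [pl (kap y _ _) * _]mulrC.
  by apply: (ideal_sum idT) => l _; apply: (idealM idT); exact: repP.
exists kap, M; split=> //.
- split=> [x y|a x]; apply: kapu.
    rewrite (_ : _ - _ = (x%:A - \sum_i b i * pl (kap x i ord0)) +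
      (y%:A - \sum_i b i * pl (kap y i ord0))); first by apply: (idealD idT).
    under eq_bigr do rewrite mxE rmorphD mulrDr.
    by rewrite big_split /= scalerDl opprD addrACA.
  rewrite (_ : _ - _ = (a%:A : R)%:A * (x%:A - \sum_i b i * pl (kap x i ord0))).
    by apply: (idealM idT).
  under eq_bigr do rewrite mxE rmorphM /= plift_alg mulrCA.
  by rewrite -mulr_sumr algZ mulrBr.
- move=> l; apply: kapu; rewrite (bigD1 l) //= mxE eqxx rmorph1 mulr1 big1 ?addr0 ?subrr.
    exact: ideal0.
  by move=> i ni; rewrite mxE (negbTE ni) rmorph0 mulr0.
- by move=> i x; rewrite kapM Mdf mul_scalar_mx.
move=> l i j m lt.
(* The homogeneous part of an entry vanishes if it vanishes on every line [y_i = c_i s]. *)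
apply: (@hval_eq0 K d (mdeg m)) => // c.
rewrite -co_ev_line.
pose ev := ev_line c; pose Mc x := map_mx ev (M x).
have MD x y : M (x + y) = M x + M y by rewrite -repD -scalerDl.
have MM x y : M (x * y) = M x *m M y by rewrite -repM -algM.
have MZ a x : M (a *: x) = (a%:A : P) *: M x.
  by rewrite /M algZ repM -plift_alg repl mul_scalar_mx.
have McD x y : Mc (x + y) = Mc x + Mc y by rewrite /Mc MD map_mxD.
have Mc0 : Mc 0 = 0 by apply: (addrI (Mc 0)); rewrite -McD !addr0.
have McN x : Mc (- x) = - Mc x by apply: (addrI (Mc x)); rewrite -McD !subrr.
have McM x y : Mc (x * y) = Mc x *m Mc y by rewrite /Mc MM map_mxM.
have McZ a x : Mc (a *: x) = (a%:A : fps 1 K) *: Mc x.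
  by rewrite /Mc MZ map_mxZ; congr (_ *: _); exact: ev_line_alg.
have Mcsum (F : 'I_d -> R) : Mc (\sum_i F i) = \sum_i Mc (F i).
  exact: (big_morph Mc McD Mc0).
have [k [h hE]] := nilpotent_on_line f0 c sv.
(* By [nilpotent_on_line], [t^k f^mu] lies in the ideal of the [f_i - t c_i f]. On the line
   [f_i = c_i s], the coefficient of [t^n] gives [s A_n = f A_(n-1)], plus [f^mu] for [n = k]. Hence
   [A_n = 0] below [k], and [f^(mu+l) = s^(l+1) A_(k+l)], which is the claimed gain of order. *)
pose u n : R := \sum_i c i *: co (h i) n.
pose A n := Mc (u n); pose A' n := if n is n'.+1 then A n' else 0.
have Mcdf n : Mc (\sum_i co (h i) n * df i) = tX K *: A n.
  rewrite /A /u !Mcsum scaler_sumr; apply: eq_bigr => i' _; rewrite McM McZ.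
  have -> : Mc (df i') = (c i' *: tX K)%:M.
    rewrite /Mc Mdf map_scalar_mx; congr (_%:M); exact: ev_lineX.
  rewrite mul_mx_scalar [RHS]scalerA; congr (_ *: _).
  by rewrite [RHS]mulrC; exact: esym (mulr_algl _ _).
have rel n : tX K *: A n = Mc f *m A' n + Mc ((n == k)%:R * f ^+ mu).
  have E : (n == k)%:R * f ^+ mu = (\sum_i co (h i) n * df i) -
     (if n is n'.+1 then f * u n' else 0).
    have := congr1 (fun x => co x n) hE; rewrite /= co_algM co_tXn => ->.
    rewrite co_sum /pgen.
    have Et i' : co (h i' * ((df i')%:A - tX R * (c i' *: f)%:A)) n = co (h i') n * df i' -
        (if n is n'.+1 then co (h i') n' * (c i' *: f) else 0).
      have -> : h i' * ((df i')%:A - tX R * (c i' *: f)%:A) =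
        h i' * (df i')%:A - tX R * (h i' * (c i' *: f)%:A) by ring.
      rewrite coD coN co_algM co_tXM; congr (_ - _).
      by case: (n) => // n'; rewrite co_algM.
    rewrite (eq_bigr _ (fun i' _ => Et i')) sumrB; congr (_ - _).
    case: (n) => [|n']; first by rewrite big1.
    rewrite /u mulr_sumr; apply: eq_bigr => i' _.
    by rewrite -!scalerAr mulrC.
  rewrite E McD McN Mcdf addrCA; case: n {E} => [|n]; first by rewrite Mc0 mulmx0 subrr addr0.
  by rewrite McM /= subrr addr0.
have tinj (B B' : 'M[fps 1 K]_mu) : tX K *: B = tX K *: B' -> B = B'.
  move=> E; apply/matrixP => i' j'; apply: (@tXn_inj K 1); rewrite expr1.
  by have := congr1 (fun C : 'M[fps 1 K]_mu => C i' j') E; rewrite /= !mxE.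
have low n : (n < k)%N -> A n = 0.
  elim: n => [|n IH] nk; apply: tinj; rewrite rel scaler0 (ltn_eqF nk) mul0r Mc0 addr0.
    by rewrite mulmx0.
  by rewrite /= IH ?mulmx0 // ltnW.
have high n : tX K ^+ n.+1 *: A (k + n)%N = Mc (f ^+ (mu + n)).
  elim: n => [|n IH].
    rewrite expr1 !addn0 rel eqxx mul1r (_ : A' k = 0) ?mulmx0 ?add0r //.
    by case: (k) low => // k' low; apply: low.
  rewrite exprSr -scalerA addnS rel /= (_ : (_ == k) = false) ?mul0r ?Mc0 ?addr0.
    by rewrite scalemxAr IH -McM addnS exprS.
  by apply/eqP; lia.
have <- : tX K ^+ l.+1 * A (k + l)%N i j = ev_line c (M (f ^+ (mu + l)) i j).
  by have := congr1 (fun C : 'M[fps 1 K]_mu => C i j) (high l); rewrite /= !mxE.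
apply: (proj2 (co_ordge (tX K ^+ l.+1 * A (k + l)%N i j) l.+1)) => //.
by apply: ordgeMr; apply: ordgeXn; exact: ordge_X.
Qed.

End JacobianCoordinates.

(** * Box counts and Frobenius powers *)

Section Boxes.
Variable d : nat.

Definition box p u : {set {ffun 'I_d -> 'I_p}} := [set a : {ffun 'I_d -> 'I_p} | (\sum_i (a i : nat) < u)%N].

Definition box_mon p (a : {ffun 'I_d -> 'I_p}) : multinom d := Multinom [tuple (a i : nat) | i < d].

Lemma box_monE p (a : {ffun 'I_d -> 'I_p}) i : box_mon a i = a i.
Proof. by rewrite multinomE tnth_mktuple. Qed.

Lemma mdeg_box_mon p (a : {ffun 'I_d -> 'I_p}) : mdeg (box_mon a) = (\sum_i (a i : nat))%N.
Proof. by rewrite mdegE; apply: eq_bigr => i _; rewrite box_monE. Qed.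

Lemma box_mon_inj p : injective (@box_mon p).
Proof.
by move=> a b ab; apply/ffunP => i; apply: val_inj; rewrite /= -!box_monE ab.
Qed.

Lemma box_monP p (m : multinom d) : (forall i, m i < p)%N -> exists a : {ffun 'I_d -> 'I_p}, box_mon a = m.
Proof.
move=> H; exists [ffun i => Ordinal (H i)]; apply/mnmP => i.
by rewrite box_monE ffunE.
Qed.

End Boxes.

Lemma fmon_prod d (A : comNzRingType) (m : multinom d) : fmon A m = \prod_i fps_X A i ^+ m i.
Proof.
rewrite [in LHS](multinomUE_id m) (big_morph _ (@fmonD d A) (fmon0 d A)).
by apply: eq_bigr => i _; rewrite -fmonX.
Qed.

Section PowerCount.
Variables (d : nat) (K : numFieldType) (f : fps d K) (mu : nat) (v : 'I_mu -> fps d K).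
Local Notation R := (fps d K).
Local Notation df := (fun i => fps_deriv i f).
Hypotheses (f0 : ordge 1 f) (bv : basis_mod (idl df) v).

Lemma kap_vanish_subsp (kap : R -> 'cV[R]_mu) (P : pred (multinom d)) :
    (forall x y, kap (x + y) = kap x + kap y) ->
    (forall (a : K) x, kap (a *: x) = (a%:A : R) *: kap x) ->
  subsp [set x | forall l m, P m -> fcoef (kap x l ord0) m = 0].
Proof.
move=> kD kZ; split=> [|x y hx hy|a x hx] l m Pm.
- by rewrite -(scale0r 0) kZ !scale0r mxE.
- by rewrite kD mxE fcoefD hx // hy // addr0.
- by rewrite kZ mxE mulr_algl fcoefZ hx // mulr0.
Qed.

(* In the coordinates of [jacobian_coordinates], multiplication by [f ^+ p] raises
   the order by more than [p - mu], so it maps [b t] into [b u]. *)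
Lemma power_box_count p t u n (w : 'I_n -> R) : (mu <= p)%N -> (u + mu <= t + p.+1)%N ->
    spans (idl (fcons (f ^+ p) (fun i => df i ^+ p))) w ->
  (mu * #|box d p u| <= n + mu * #|box d p t|)%N.
Proof.
move=> mup ut sw.
have [kap [M [[kD kZ] kv kM kdf Mord]]] := jacobian_coordinates f0 bv.
pose S u (m : multinom d) := (mdeg m < u)%N && [forall i, m i < p]%N.
(* The quotient by [b s] has dimension [mu * #|box d p s|], with basis the [e s] below: products of
   basis elements with monomials in the partial derivatives. *)
pose b u : set R := [set x | forall l m, S u m -> fcoef (kap x l ord0) m = 0].
have sb s : subsp (b s) by exact: kap_vanish_subsp.
have kdfX x (m : multinom d) : kap (x * \prod_i df i ^+ m i) = fmon K m *: kap x.
  rewrite fmon_prod; elim/big_ind2: _ x => [x|F F' G G' hF hG x|i _ x].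
  - by rewrite mulr1 scale1r.
  - by rewrite mulrA hG hF scalerA mulrC.
  elim: (m i) => [|l IH]; first by rewrite !expr0 mulr1 scale1r.
  by rewrite !exprS mulrCA kdf IH scalerA.
pose e s (q : 'I_mu * {x | x \in box d p s}) : R :=
  v q.1 * \prod_i df i ^+ (box_mon (val q.2) i).
have kap_e s q : kap (e s q) = \col_i ((i == q.1)%:R * fmon K (box_mon (val q.2))).
  rewrite /e; have -> : forall x (m : multinom d), kap (x * \prod_i df i ^+ m i) = fmon K m *: kap x.
    exact: kdfX.
  by rewrite kv; apply/colP => i; rewrite !mxE mulrC.
have kap_sum s (c : 'I_mu * {x | x \in box d p s} -> K) l (q : {x | x \in box d p s}) :
    fcoef (kap (\sum_r c r *: e s r) l ord0) (box_mon (val q)) = c (l, q).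
  have kS : kap (\sum_r c r *: e s r) = \sum_r (c r)%:A *: kap (e s r).
    have k0 : kap 0 = 0 by rewrite -(scale0r 0) kZ !scale0r.
    by rewrite (big_morph kap kD k0); apply: eq_bigr => r _.
  rewrite kS summxE fcoef_sum (bigD1 (l, q)) //= !mxE mulr_algl fcoefZ kap_e mxE eqxx mul1r.
  rewrite fcoef_mon eqxx mulr1 big1 ?addr0 // => -[l' q'] ne.
  rewrite mxE mulr_algl fcoefZ kap_e mxE /=.
  case: (eqVneq l l') => [ll|_]; last by rewrite mul0r fcoef0 mulr0.
  rewrite mul1r fcoef_mon; case: eqP => [E|_]; last by rewrite mulr0.
  case/eqP: ne; rewrite ll; congr (_, _); apply: val_inj.
  by apply: (@box_mon_inj d p); rewrite E.
have inS s (q : {x | x \in box d p s}) : S s (box_mon (val q)).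
  rewrite /S mdeg_box_mon; have := valP q; rewrite inE => -> /=.
  by apply/forallP => i; rewrite box_monE.
have ie s : indep (b s) (e s).
  by move=> c bc [l q]; rewrite -(kap_sum s c l q); apply: bc.
have se s : spans (b s) (e s).
  move=> x; exists (fun q => fcoef (kap x q.1 ord0) (box_mon (val q.2))) => l m Sm.
  have /andP[ms /forallP mp] := Sm; have [a am] := box_monP mp.
  have ab : a \in box d p s by rewrite inE -mdeg_box_mon am.
  have kB y : kap (x - y) = kap x - kap y.
    by rewrite kD -[- y]scaleN1r kZ scaleNr scale1r scaleN1r.
  rewrite kB mxE fcoefD [X in _ + fcoef X _]mxE fcoefN.
  have := kap_sum s (fun q => fcoef (kap x q.1 ord0) (box_mon (val q.2))) l (exist _ a ab).
  by rewrite /= am => ->; rewrite subrr.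
have card_e s : #|{: 'I_mu * {x | x \in box d p s}}| = (mu * #|box d p s|)%N.
  by rewrite card_prod card_ord card_sig.
(* Modulo [b u], the powers [f_i^p] vanish, and a multiple of [f^p] depends only on its cofactor
   modulo [b t]; so [w] and [f^p] times the basis of the quotient by [b t] span. *)
pose w' (r : 'I_n + ('I_mu * {x | x \in box d p t})) : R :=
  match r with inl i => w i | inr q => f ^+ p * e t q end.
have sw' : spans (b u) w'.
  move=> x; have [c [a /= ca]] := sw x.
  have [c' hc'] := se t (a ord0).
  exists (fun r => match r with inl i => c i | inr q => c' q end).
  rewrite big_sumType /= -/w'.
  rewrite (_ : _ - _ = (f ^+ p * (a ord0 - \sum_q c' q *: e t q)) +
    \sum_i a (lift ord0 i) * df i ^+ p); last first.
    rewrite opprD addrA ca big_ord_recl fcons0 mulrBr mulr_sumr addrAC [_ * f ^+ p]mulrC.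
    congr (_ - _ + _); first by apply: eq_bigr => q _; rewrite scalerAr.
    by apply: eq_bigr => i _; rewrite fconsS.
  apply: (subspD (sb u)); last first.
    apply: (subsp_sum (sb u)) => i _ l m /andP[_ /forallP/(_ i) mi].
    rewrite mulrC (_ : kap _ = fps_X K i ^+ p *: kap (a (lift ord0 i))); last first.
      elim: (p) => [|p' IH]; first by rewrite !expr0 mul1r scale1r.
      by rewrite !exprS -mulrA kdf IH scalerA.
    rewrite mxE fmonXn fcoef_monM; case: ifP => // /mnm_lepP/(_ i).
    by rewrite mulmnE mnm1E eqxx mul1n leqNgt mi.
  move=> l m /andP[mu' /forallP mp]; rewrite kM mxE fcoef_sum big1 // => j _.
  rewrite fcoefM big1 // => k lk.
  have [dk|dk] := ltnP (mdeg k) (p - mu).+1.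
    by rewrite -[X in f ^+ X](subnKC mup) Mord ?mul0r.
  rewrite hc' ?mulr0 //; apply/andP; split.
    have := mdeg_sub lk; move: ut mup mu' dk; lia.
  apply/forallP => i; rewrite mnmBE; apply: leq_ltn_trans (leq_subr _ _) (mp i).
have := indep_le_spans (sb u) (ie u) sw'.
by rewrite card_sum !card_e card_ord.
Qed.

End PowerCount.

(** * Rings in which large primes are not units *)

Record subring (S : nzRingType) (A : set S) : Prop := Subring {
  subring1 : A 1;
  subringB : forall x y, A x -> A y -> A (x - y);
  subringM : forall x y, A x -> A y -> A (x * y) }.

Section SubringTheory.
Variables (S : nzRingType) (A : set S).
Hypothesis rA : subring A.

Lemma subring0 : A 0.
Proof. by rewrite -(subrr 1); apply: subringB => //; exact: subring1. Qed.

Lemma subringN x : A x -> A (- x).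
Proof. by move=> Ax; rewrite -sub0r; apply: subringB => //; exact: subring0. Qed.

Lemma subringD x y : A x -> A y -> A (x + y).
Proof. by move=> Ax Ay; rewrite -[y]opprK; apply: subringB => //; exact: subringN. Qed.

Lemma subring_sum T (r : seq T) (P : pred T) (F : T -> S) :
  (forall t, P t -> A (F t)) -> A (\sum_(t <- r | P t) F t).
Proof. by move=> H; apply: big_ind => //; [exact: subring0 | exact: subringD]. Qed.

Lemma subringX x n : A x -> A (x ^+ n).
Proof.
move=> Ax; elim: n => [|n IH]; first exact: subring1.
by rewrite exprS; exact: subringM.
Qed.

Lemma subring_nat n : A n%:R.
Proof.
elim: n => [|n IH]; first exact: subring0.
by rewrite -addn1 natrD; apply: subringD => //; exact: subring1.
Qed.

Lemma subring_natmul x n : A x -> A (x *+ n).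
Proof. by move=> Ax; rewrite -mulr_natl; apply: subringM => //; exact: subring_nat. Qed.

End SubringTheory.

(* Almost every prime is a non-unit in [A], even after inverting a nonzero element. *)
Definition many_primes (A : nzRingType) := forall s : A, s != 0 ->
  exists n0 : nat, forall p, prime p -> (n0 <= p)%N -> forall k a, s ^+ k <> p%:R * a.

Lemma many_primes_int : many_primes int.
Proof.
move=> s nz; exists `|s|%N.+1 => p pp le k a E.
have : (p %| `|s| ^ k)%N by rewrite -abszX E abszM pmulrn intz absz_nat dvdn_mulr.
rewrite Euclid_dvdX // => /andP[/dvdn_leq]; rewrite absz_gt0 nz => /(_ isT) H.
by move: (leq_trans le H); rewrite ltnn.
Qed.

(** Leading coefficients are multiplicative over a domain, which reduces the claim to [D]. *)
Lemma many_primes_poly (D : idomainType) : many_primes D -> many_primes {poly D}.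
Proof.
move=> HD s nz; have [|n0 H] := HD (lead_coef s); first by rewrite lead_coef_eq0.
exists n0 => p pp le k a E; apply: (H p pp le k a`_((size (s ^+ k)).-1)).
by rewrite -lead_coef_exp lead_coefE E mulr_natl coefMn mulr_natl.
Qed.

(** Multiplying the equation of degree [n] by the power [n-1] of its leading coefficient [s] makes
    it monic in [s y]. *)
Lemma integral_lead_coef (D : comNzRingType) (K : fieldType) (phi : {rmorphism D -> K}) (q : {poly D}) y :
  injective phi -> q != 0 -> root (map_poly phi q) y -> integralOver phi (phi (lead_coef q) * y).
Proof.
move=> inj nz /rootP qy; set s := lead_coef q.
case E : (size q) => [|n]; first by move/eqP: E nz; rewrite size_poly_eq0 => ->.
have sn : s = q`_n by rewrite /s lead_coefE E.
have n0 : (0 < n)%N.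
  case: n E sn => // E sn; have sz : (size q <= 1)%N by rewrite E.
  move: qy nz; rewrite (size1_polyC sz) map_polyC hornerC /= => /eqP.
  by rewrite -(rmorph0 phi) (inj_eq inj) => /eqP ->; rewrite eqxx.
exists ('X^n + \poly_(i < n) (q`_i * s ^+ (n.-1 - i))).
  apply/monicP; rewrite lead_coefDl ?lead_coefXn // size_polyXn ltnS; exact: size_poly.
apply/rootP; rewrite rmorphD rmorphXn /= map_polyX hornerD hornerXn.
rewrite map_polyE; set Q := \poly_(i < n) _.
have -> : (Poly [seq phi i | i <- Q]) = \poly_(i < n) phi (Q`_i).
  rewrite -map_polyE; apply/polyP => i; rewrite coef_map coef_poly /Q coef_poly.
  by case: ltnP => // _; exact: rmorph0.
rewrite horner_poly exprMn -{1}(prednK n0) exprSr -mulrA.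
transitivity (phi s ^+ n.-1 * (map_poly phi q).[y]); last by rewrite qy mulr0.
rewrite (horner_coef_wide (n := n.+1)) ?size_map_poly_id0 ?E //; last first.
  by rewrite -(rmorph0 phi) (inj_eq inj) lead_coef_eq0.
rewrite big_ord_recr /= mulrDr addrC coef_map /= -sn; congr (_ + _).
rewrite mulr_sumr; apply: eq_bigr => i _.
rewrite /Q coef_poly ltn_ord coef_map /= rmorphM rmorphXn exprMn.
have le : (i <= n.-1)%N by rewrite -ltnS (prednK n0).
by rewrite -{2}(subnK le) exprD; ring.
Qed.

Lemma integral_pow (D : comNzRingType) (K : comNzRingType) (phi : {rmorphism D -> K}) x k :
  integralOver phi x -> integralOver phi (x ^+ k).
Proof.
move=> ix; elim: k => [|k IH]; first exact: integral1.
by rewrite exprS; exact: integral_mul.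
Qed.

(** Noether normalization over the integers, one element at a time: an element algebraic over [D]
    multiplies [s] by a leading coefficient, a transcendental one adjoins a variable to [D]. *)
Lemma many_primes_subfield (K : numFieldType) n (l : 'I_n -> K) :
  exists (D : idomainType) (phi : {rmorphism D -> K}) (s : D),
   [/\ injective phi, many_primes D, s != 0 & forall i, integralOver phi (phi s * l i)].
Proof.
elim: n l => [|n IH] l.
  exists int, (intr : {rmorphism int -> K}), 1; split=> //; last by case.
    by move=> x y /eqP; rewrite eqr_int => /eqP.
  exact: many_primes_int.
have [D [phi [s [inj mp nz H]]]] := IH (fun i => l (lift ord0 i)).
have [[q [qnz rq]]|nalg] := pselect (exists q : {poly D}, q != 0 /\ root (map_poly phi q) (l ord0)).
  exists D, phi, (s * lead_coef q); split=> //; first by rewrite mulf_neq0 ?lead_coef_eq0.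
  move=> i; rewrite rmorphM; have [j ->|->] := unliftP ord0 i.
    by rewrite mulrAC; apply: integral_mul => //; exact: integral_id.
  rewrite -mulrA; apply: integral_mul; first exact: integral_id.
  exact: integral_lead_coef.
pose phi' : {rmorphism {poly D} -> K} := horner_eval (l ord0) \o map_poly phi.
have pE q : phi' q = (map_poly phi q).[l ord0] by [].
have pC c : phi' c%:P = phi c by rewrite pE map_polyC hornerC.
exists {poly D}, phi', s%:P; split.
- move=> q q' E; apply/eqP; rewrite -subr_eq0; apply: contraT => nz'.
  case: nalg; exists (q - q'); split=> //; apply/rootP.
  by rewrite -pE rmorphB E subrr.
- exact: many_primes_poly.
- by rewrite polyC_eq0.
move=> i; rewrite pC; have [j ->|->] := unliftP ord0 i.
  have [P mP rP] := H j; exists (map_poly polyC P); first by rewrite monic_map.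
  by rewrite -map_poly_comp (eq_map_poly pC).
apply: integral_mul; first by rewrite -pC; exact: integral_id.
by have := integral_id phi' 'X; rewrite pE map_polyX hornerX.
Qed.

(* [A] is the ring of the elements that become integral over [D] after multiplication by a power of [s]. *)
Lemma subring_primes (K : numFieldType) n (l : 'I_n -> K) :
  exists A : set K, [/\ subring A, forall i, A (l i) &
    exists n0 : nat, forall p, prime p -> (n0 <= p)%N -> forall a, A a -> p%:R * a <> 1].
Proof.
have [D [phi [s [inj mp nz H]]]] := many_primes_subfield l.
pose A : set K := [set y | exists M, integralOver phi (phi s ^+ M * y)].
have up M M' y : (M <= M')%N -> integralOver phi (phi s ^+ M * y) -> integralOver phi (phi s ^+ M' * y).
  move=> /subnK <- i; rewrite exprD -mulrA; apply: integral_mul => //.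
  by apply: integral_pow; exact: integral_id.
exists A; split.
- split=> [|x y [M Mx] [M' My]|x y [M Mx] [M' My]].
  + by exists 0%N; rewrite mulr1; exact: integral1.
  + exists (maxn M M'); rewrite mulrBr; apply: integral_sub.
      by apply: up Mx; rewrite leq_maxl.
    by apply: up My; rewrite leq_maxr.
  + exists (M + M')%N; rewrite exprD mulrACA; exact: integral_mul.
- by move=> i; exists 1%N; rewrite expr1.
have [n0 hn0] := mp s nz; exists n0 => p pp le a [M [q mq /rootP rq]] pa1.
have p0 : p%:R != 0 :> K by rewrite pnatr_eq0 -lt0n prime_gt0.
pose z := phi s ^+ M * a; pose r := (size q).-1.
have szq : size q = r.+1 by rewrite /r prednK // size_poly_gt0 monic_neq0.
have E : \sum_(i < r.+1) phi q`_i * z ^+ i = 0.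
  rewrite -[RHS]rq (horner_coef_wide (n := r.+1)); last by rewrite (leq_trans (size_poly _ _)) ?szq.
  by apply: eq_bigr => i _; rewrite coef_map.
(* Multiply the monic equation of [z = s^M a] by [p^r]. As [p a = 1], the top term becomes [s^(M r)]
   and every other term keeps a factor [p] in [D]. *)
apply: (hn0 p pp le (M * r)%N (- \sum_(i < r) q`_i * s ^+ (M * i) * p%:R ^+ (r.-1 - i))).
apply: inj; rewrite rmorphXn rmorphM rmorphN rmorph_nat /= mulrN; apply/eqP; rewrite -addr_eq0.
apply/eqP; rewrite -[RHS](mulr0 (p%:R ^+ r)) -E big_ord_recr /= mulrDr addrC; congr (_ + _).
  rewrite rmorph_sum !mulr_sumr; apply: eq_bigr => i _.
  have ir : (i < r)%N := ltn_ord i.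
  have -> : p%:R ^+ r = p%:R * p%:R ^+ (r.-1 - i) * p%:R ^+ i :> K.
    rewrite -exprS -exprD; congr (_ ^+ _); lia.
  rewrite /= !rmorphM !rmorphXn rmorph_nat /z exprMn -exprM.
  transitivity (p%:R * p%:R ^+ (r.-1 - i) * phi q`_i * phi s ^+ (M * i) * (p%:R * a) ^+ i); last first.
    by rewrite exprMn; ring.
  by rewrite pa1 expr1n; ring.
have -> : q`_r = 1 by have /monicP := mq; rewrite lead_coefE.
by rewrite rmorph1 mul1r /z exprMn -exprM mulrCA -exprMn pa1 expr1n mulr1.
Qed.

(** * Congruences modulo a prime and the Frobenius *)

Section NatCongruence.
Variables (S : comNzRingType) (B : set S) (p : nat).
Hypothesis rB : subring B.

(** The quotient [z] must lie in [B], since [p] may be invertible in the ambient ring. *)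
Definition pcong x y := [/\ B x, B y & exists2 z, B z & x - y = p%:R * z].

Lemma pcong_refl x : B x -> pcong x x.
Proof. by move=> Bx; split=> //; exists 0; rewrite ?subrr ?mulr0 //; exact: subring0. Qed.

Lemma pcong_trans x y z : pcong x y -> pcong y z -> pcong x z.
Proof.
move=> [Bx By [a Ba E]] [_ Bz [b Bb F]]; split=> //; exists (a + b); first exact: subringD.
by rewrite mulrDr -E -F; ring.
Qed.

Lemma pcongD x x' y y' : pcong x x' -> pcong y y' -> pcong (x + y) (x' + y').
Proof.
move=> [Bx By [a Ba E]] [Bx' By' [b Bb F]]; split; try exact: subringD.
by exists (a + b); [exact: subringD | rewrite mulrDr -E -F; ring].
Qed.

Lemma pcongM x x' y y' : pcong x x' -> pcong y y' -> pcong (x * y) (x' * y').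
Proof.
move=> [Bx By [a Ba E]] [Bx' By' [b Bb F]]; split; try exact: subringM.
exists (a * y + x' * b); first by apply: subringD => //; apply: subringM.
rewrite mulrDr mulrA -E [p%:R * _]mulrCA -F; ring.
Qed.

Lemma pcong_sum T (r : seq T) (P : pred T) (F G : T -> S) :
  (forall t, P t -> pcong (F t) (G t)) ->
  pcong (\sum_(t <- r | P t) F t) (\sum_(t <- r | P t) G t).
Proof.
move=> H; apply: big_ind2 => //; first by apply: pcong_refl; exact: subring0.
by move=> *; exact: pcongD.
Qed.

Lemma pcong_prod T (r : seq T) (P : pred T) (F G : T -> S) :
  (forall t, P t -> pcong (F t) (G t)) ->
  pcong (\prod_(t <- r | P t) F t) (\prod_(t <- r | P t) G t).
Proof.
move=> H; apply: big_ind2 => //; first by apply: pcong_refl; exact: subring1.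
by move=> *; exact: pcongM.
Qed.

Lemma pcong_det n (M : 'M[S]_n) :
  (forall i j, pcong (M i j) (i == j)%:R) -> pcong (\det M) 1.
Proof.
move=> H; rewrite -[X in pcong _ X](det1 S n); apply: pcong_sum => s _.
apply: pcongM; last by apply: pcong_prod => i _; rewrite mxE.
by apply: pcong_refl; apply: subringX => //; apply: subringN => //; exact: subring1.
Qed.

Hypothesis pp : prime p.

Lemma pcong_FrobeniusD x y : B x -> B y -> pcong ((x + y) ^+ p) (x ^+ p + y ^+ p).
Proof.
move=> Bx By; split.
- by apply: subringX => //; exact: subringD.
- by apply: subringD => //; exact: subringX.
case: p pp => // -[//|q] pq.
rewrite exprDn big_ord_recl big_ord_recr /= bin0 binn subnn !expr0 mulr1 mul1r !mulr1n.
rewrite subn0 /bump /=.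
exists (\sum_(i < q.+1) x ^+ (q.+2 - i.+1) * y ^+ i.+1 *+ ('C(q.+2, i.+1) %/ q.+2)).
  by apply: subring_sum => // i _; apply: subring_natmul => //; apply: subringM => //; exact: subringX.
have cancel3 (u w z : S) : u + (w + z) - (u + z) = w by ring.
rewrite [X in X = _](cancel3 (x ^+ q.+2) _ (y ^+ q.+2)) mulr_sumr.
apply: eq_bigr => i _; rewrite mulr_natl -mulrnA divnK // prime_dvd_bin //.
by rewrite /= ltnS; exact: ltn_ord.
Qed.

Lemma pcong_Frobenius T (r : seq T) (P : pred T) (F : T -> S) : (forall t, P t -> B (F t)) ->
  pcong ((\sum_(t <- r | P t) F t) ^+ p) (\sum_(t <- r | P t) F t ^+ p).
Proof.
move=> H; elim: r => [|t r IH].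
  rewrite !big_nil expr0n; have /gtn_eqF -> := prime_gt0 pp.
  by apply: pcong_refl; exact: subring0.
rewrite !big_cons; case: ifP => // Pt.
apply: pcong_trans (pcong_FrobeniusD _ _) _; [exact: H | exact: subring_sum |].
by apply: pcongD IH; apply: pcong_refl; apply: subringX => //; exact: H.
Qed.

End NatCongruence.

Lemma ideal_pow_add (S : comNzRingType) (I : set S) x y a b : ideal I ->
  I (x ^+ a) -> I (y ^+ b) -> I ((x + y) ^+ (a + b)).
Proof.
move=> idI Ix Iy; rewrite exprDn; apply: ideal_sum => // i _.
rewrite -mulr_natl; apply: (idealM idI).
have [le|lt] := leqP b i.
  by rewrite -(subnK le) exprD mulrA; apply: (idealM idI).
have le : (a <= a + b - i)%N by lia.
by rewrite -(subnK le) exprD mulrAC; apply: (idealM idI).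
Qed.

Lemma idl_pow (S : comNzRingType) n (g : 'I_n -> S) p x : idl g x ->
  exists k, idl (fun i => g i ^+ p) (x ^+ k).
Proof.
move=> [a ->]; set I := idl _; have idI : ideal I by exact: idl_ideal.
elim/big_ind: _ => [|y z [k ky] [l lz]|i _].
- by exists 1%N; rewrite expr1; exact: ideal0.
- by exists (k + l)%N; exact: ideal_pow_add.
by exists p; rewrite exprMn; apply: (idealM idI); exact: (idl_mem (fun i => g i ^+ p)).
Qed.

Section FrobeniusBound.
Variables (d : nat) (K : fieldType) (A : set K).
Hypothesis rA : subring A.
Local Notation R := (fps d K).

Definition coefs_in : set R := [set h | forall m, A (fcoef h m)].

Lemma coefs_in_subring : subring coefs_in.
Proof.
split=> [m|x y Ax Ay m|x y Ax Ay m].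
- by rewrite fcoef1; exact: subring_nat.
- by rewrite fcoefB; exact: subringB.
by rewrite fcoefM; apply: subring_sum => // k _; exact: subringM.
Qed.

Lemma coefs_in_mon m : coefs_in (fmon K m).
Proof. by move=> k; rewrite fcoef_mon; exact: subring_nat. Qed.

Lemma coefs_in_alg a : A a -> coefs_in a%:A.
Proof. by move=> Aa m; rewrite fcoefZ fcoef1; apply: subringM => //; exact: subring_nat. Qed.

Variables (p n tau L : nat) (g : 'I_n -> R) (v : 'I_tau -> R).
Hypotheses (pp : prime p) (pA : forall a, A a -> p%:R * a <> 1).
Hypotheses (gA : forall i, coefs_in (g i)) (vA : forall j, coefs_in (v j)).
(** Division of the monomials of the box [[0, L)^d] by [g] with coefficients in [A], up to multiples
    of the [x_k^L]. By [high] these multiples can be pushed to larger order, as the [s l] have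
    positive order. *)
Hypothesis low : forall m : multinom d, (forall i, m i < L)%N -> exists (c : 'I_tau -> K) (a : 'I_n -> R) (e : 'I_d -> R),
  [/\ forall j, A (c j), forall i, coefs_in (a i), forall k, coefs_in (e k) &
   fmon K m = \sum_j c j *: v j + \sum_i a i * g i + \sum_k fps_X K k ^+ L * e k].
Hypothesis high : forall k, exists (a : 'I_n -> R) (s : 'I_d -> R),
  [/\ forall i, coefs_in (a i), forall l, coefs_in (s l), forall l, ordge 1 (s l) &
   fps_X K k ^+ L = \sum_i a i * g i + \sum_l fps_X K l ^+ L * s l].

(** The basis predicted by flatness of the Frobenius: series form a free module over their [p]-th
    powers, with basis the monomials of the box [[0, p)^d]. *)
Definition frob_gen (q : {ffun 'I_d -> 'I_p} * 'I_tau) : R := fmon K (box_mon q.1) * v q.2 ^+ p.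

Let J := idl (fun i => g i ^+ p).
Let U : set R := span_mod J frob_gen.

Lemma frob_subsp : subsp U.
Proof. exact: (span_mod_subsp frob_gen (ideal_subsp (idl_ideal _))). Qed.

Lemma frob_ideal x : J x -> U x.
Proof. exact: span_mod_sub. Qed.

Let Q : set R := [set h | exists2 h', coefs_in h' & U (h - p%:R * h')].

Lemma frobQ_U h : U h -> Q h.
Proof. by move=> Uh; exists 0; [exact: subring0 coefs_in_subring | rewrite mulr0 subr0]. Qed.

Lemma frobQ_D x y : Q x -> Q y -> Q (x + y).
Proof.
move=> [x' Ax Ux] [y' Ay Uy]; exists (x' + y'); first exact: (subringD coefs_in_subring).
by rewrite mulrDr opprD addrACA; exact: (subspD frob_subsp).
Qed.

Lemma frobQ_cong x y : pcong coefs_in p x y -> Q y -> Q x.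
Proof.
move=> [_ _ [z Az E]] Qy; rewrite -[x](subrK y) E; apply: frobQ_D => //.
by exists z => //; rewrite subrr; exact: subsp0 frob_subsp.
Qed.

Variable M : nat.
Hypothesis UM : forall h, ordge M h -> J h.

(** The [p]-th power of [high] rewrites [x_i^(L p)], modulo [p] and [J], as a combination of the
    [x_l^(L p)] with coefficients [s_l^p] of positive order. After [M] rounds the cofactors lie in
    [J]. *)
Lemma frobQ_high k (h : 'I_d -> R) : (forall i, coefs_in (h i)) -> (forall i, ordge (M - k) (h i)) ->
  Q (\sum_i fps_X K i ^+ (L * p) * h i).
Proof.
have rR := coefs_in_subring.
elim: k h => [|k IH] h Ah oh.
  apply: frobQ_U; apply: frob_ideal; apply: (ideal_sum (idl_ideal _)) => i _.
  by apply: (idealM (idl_ideal _)); apply: UM; rewrite -[M]subn0.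
have [a Ha] := choice high; have [s Hs] := choice Ha.
have cX i : pcong coefs_in p (fps_X K i ^+ (L * p))
    (\sum_j (a i j * g j) ^+ p + \sum_l (fps_X K l ^+ L * s i l) ^+ p).
  have [Aa As _ E] := Hs i; rewrite exprM E.
  have AX l : coefs_in (fps_X K l ^+ L * s i l).
    by apply: (subringM rR) => //; apply: (subringX rR); exact: coefs_in_mon.
  have Aag j : coefs_in (a i j * g j) by exact: (subringM rR).
  apply: (pcong_trans rR) (pcong_FrobeniusD rR pp _ _) _; try by apply: (subring_sum rR).
  by apply: (pcongD rR); apply: (pcong_Frobenius rR pp).
apply: (@frobQ_cong _ (\sum_i (\sum_j (a i j * g j) ^+ p + \sum_l (fps_X K l ^+ L * s i l) ^+ p) * h i)).
  by apply: (pcong_sum rR) => i _; apply: (pcongM rR) => //; exact: pcong_refl.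
under eq_bigr do rewrite mulrDl.
rewrite big_split; apply: frobQ_D.
  apply: frobQ_U; apply: frob_ideal; apply: (ideal_sum (idl_ideal _)) => i _.
  apply: (idealMr (idl_ideal _)); apply: (ideal_sum (idl_ideal _)) => j _.
  by rewrite exprMn; apply: (idealM (idl_ideal _)); exact: (idl_mem (fun i => g i ^+ p)).
rewrite [X in Q X](_ : _ = \sum_l fps_X K l ^+ (L * p) * \sum_i s i l ^+ p * h i).
  apply: IH => l.
    apply: (subring_sum rR) => i _; apply: (subringM rR) => //; apply: (subringX rR).
    by have [_ + _ _] := Hs i; apply.
  apply: ordge_sum => i _; have [_ _ os _] := Hs i.
  apply: (@ordgeW _ _ (p + (M - k.+1))); first by have := prime_gt0 pp; lia.
  by apply: ordgeM => //; exact: ordgeXn.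
under eq_bigr do rewrite mulr_suml.
rewrite exchange_big; apply: eq_bigr => l _; rewrite mulr_sumr; apply: eq_bigr => i _.
by rewrite exprMn -exprM mulrA.
Qed.

(** Write the exponent as [p * al + ga] with [ga] in the box. If [al] lies in [[0, L)^d], the [p]-th
    power of the division of [x^al] has the required form modulo [p]; otherwise some [x_k^(L p)]
    divides the monomial. *)
Lemma frobQ_mon m : Q (fmon K m).
Proof.
have rR := coefs_in_subring.
have p0 := prime_gt0 pp.
have [[k hk]|nk] := pselect (exists k, (L * p <= m k)%N).
  have := @frobQ_high M (fun i => if i == k then fmon K (mnm_sub m (mnm_muln (mnm1 k) (L * p))) else 0).
  rewrite (bigD1 k) //= eqxx big1 ?addr0 => [|i /negbTE ->]; last by rewrite mulr0.
  rewrite fmonXn -fmonD addmC submK; last first.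
    by apply/mnm_lepP => j; rewrite mulmnE mnm1E; case: eqP => [<-|_]; rewrite ?mul1n ?mul0n.
  apply=> i; last by rewrite subnn.
  by case: ifP => _; [exact: coefs_in_mon | exact: subring0 rR].
pose al : multinom d := Multinom [tuple (m i %/ p)%N | i < d].
have alE i : al i = (m i %/ p)%N by rewrite multinomE tnth_mktuple.
pose ga : {ffun 'I_d -> 'I_p} := [ffun i => Ordinal (ltn_pmod (m i) p0)].
have -> : fmon K m = fmon K al ^+ p * fmon K (box_mon ga).
  rewrite fmonX -fmonD; congr fmon; apply/mnmP => i.
  by rewrite mnmDE mulmnE alE box_monE ffunE /= -divn_eq.
have [i|c [a [e [Ac Aa Ae E]]]] := low (m := al).
  rewrite alE ltn_divLR // ltnNge; apply/negP => le; apply: nk; by exists i.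
have Acv j : coefs_in (c j *: v j).
  by rewrite -mulr_algl; apply: (subringM rR) => //; exact: coefs_in_alg.
have AX l : coefs_in (fps_X K l ^+ L * e l).
  by apply: (subringM rR) => //; apply: (subringX rR); exact: coefs_in_mon.
have Aag j : coefs_in (a j * g j) by exact: (subringM rR).
apply: (@frobQ_cong _ ((\sum_j (c j *: v j) ^+ p + \sum_i (a i * g i) ^+ p +
    \sum_k (fps_X K k ^+ L * e k) ^+ p) * fmon K (box_mon ga))).
  apply: (pcongM rR); last by apply: (pcong_refl _ rR); exact: coefs_in_mon.
  rewrite E; apply: (pcong_trans rR) (pcong_FrobeniusD rR pp _ _) _.
  - by apply: (subringD rR); apply: (subring_sum rR).
  - by apply: (subring_sum rR).
  apply: (pcongD rR); last exact: (pcong_Frobenius rR pp).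
  apply: (pcong_trans rR) (pcong_FrobeniusD rR pp _ _) _; try by apply: (subring_sum rR).
  by apply: (pcongD rR); apply: (pcong_Frobenius rR pp).
rewrite !mulrDl; apply: frobQ_D; first apply: frobQ_D.
- rewrite mulr_suml; apply: frobQ_U; apply: (subsp_sum frob_subsp) => j _.
  rewrite exprZn -scalerAl mulrC; apply: (subspZ frob_subsp).
  exact: (span_mod_gen frob_gen (ideal_subsp (idl_ideal _)) (ga, j)).
- apply: frobQ_U; apply: frob_ideal; apply: (idealMr (idl_ideal _)).
  apply: (ideal_sum (idl_ideal _)) => j _.
  by rewrite exprMn; apply: (idealM (idl_ideal _)); exact: (idl_mem (fun i => g i ^+ p)).
rewrite mulr_suml (eq_bigr (fun k => fps_X K k ^+ (L * p) * (e k ^+ p * fmon K (box_mon ga)))).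
  apply: (frobQ_high (k := M)) => i; last by rewrite subnn.
  by apply: (subringM rR); [exact: (subringX rR) | exact: coefs_in_mon].
by move=> k _; rewrite exprMn -exprM mulrA.
Qed.

(* Up to [U], each monomial is [p] times a combination, with coefficients in [A],
   of monomials; [det (1 - p B)] is not zero since [p] is not a unit of [A]. *)
Lemma frob_spans : spans J frob_gen.
Proof.
suff UT h : U h by [].
pose T : finType := bmultinom d M; pose N := #|T|; pose y (i : 'I_N) : R := fmon K (enum_val i : T).
have sU := frob_subsp.
have dec (x : R) : U (x - \sum_i fcoef x (enum_val i : T) *: y i).
  have [r or E] := fps_decomp M x.
  rewrite {1}E (reindex _ (onW_bij _ (enum_val_bij T))) /= addrAC subrr add0r.
  by apply: frob_ideal; exact: UM.
suff Uy i : U (y i).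
  rewrite -[h](subrK (\sum_i fcoef h (enum_val i : T) *: y i)); apply: (subspD sU) => //.
  by apply: (subsp_sum sU) => i _; exact: (subspZ sU).
have Qy (i' : 'I_N) : exists h', coefs_in h' /\ U (y i' - p%:R * h').
  by have [h' Ah' Uh'] := frobQ_mon (enum_val i' : T); exists h'.
have [h' Hh'] := choice Qy.
pose C : 'M[K]_N := \matrix_(i, j) ((i == j)%:R - p%:R * fcoef (h' i) (enum_val j : T)).
have UC i' : U (\sum_j C i' j *: y j).
  rewrite (_ : \sum_j _ = (y i' - p%:R * h' i') + p%:R *: (h' i' - \sum_j fcoef (h' i') (enum_val j : T) *: y j)).
    apply: (subspD sU); first by have [] := Hh' i'.
    by apply: (subspZ sU); exact: dec.
  have -> : p%:R * h' i' = p%:R *: h' i' by rewrite scaler_nat mulr_natl.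
  rewrite scalerBr addrA subrK.
  under eq_bigr do rewrite mxE scalerBl -scalerA.
  rewrite sumrB -scaler_sumr (bigD1 i') //= eqxx scale1r big1 ?addr0 // => j nj.
  by rewrite eq_sym (negbTE nj) scale0r.
have uC : C \in unitmx.
  rewrite unitmxE unitfE; apply/eqP => d0.
  have [i' j'|_ _ [z Az]] := @pcong_det K A p rA N C.
    rewrite mxE; split; last first.
    - exists (- fcoef (h' i') (enum_val j' : T)); last by rewrite addrAC subrr add0r mulrN.
      by apply: (subringN rA); have [+ _] := Hh' i'; apply.
    - exact: subring_nat.
    apply: (subringB rA); first exact: subring_nat.
    by apply: (subringM rA); [exact: subring_nat | have [+ _] := Hh' i'; apply].
  rewrite d0 sub0r => E; apply: (pA (subringN rA Az)).
  by rewrite mulrN -E opprK.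
rewrite (_ : y i = \sum_j invmx C i j *: \sum_k C j k *: y k).
  by apply: (subsp_sum sU) => j _; exact: (subspZ sU).
under eq_bigr do rewrite scaler_sumr; rewrite exchange_big /=.
under eq_bigr => k _ do under eq_bigr do rewrite scalerA.
transitivity (\sum_k (invmx C *m C) i k *: y k).
  rewrite mulVmx // (bigD1 i) //= mxE eqxx scale1r big1 ?addr0 // => j nj.
  by rewrite mxE eq_sym (negbTE nj) scale0r.
by apply: eq_bigr => k _; rewrite mxE scaler_suml.
Qed.

End FrobeniusBound.

Section Truncation.
Variables (d : nat) (A : nzRingType).
Local Notation R := (fps d A).

Definition fps_lt D (h : R) := forall m, (D <= mdeg m)%N -> fcoef h m = 0.

Lemma fps_ltW D D' h : (D <= D')%N -> fps_lt D h -> fps_lt D' h.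
Proof. by move=> le H m le'; apply: H; apply: leq_trans le'. Qed.

Definition fps_cut b (h : R) : R := Fps (fun m => if (mdeg m < b)%N then fcoef h m else 0).

Lemma fps_cut_lt b h : fps_lt b (fps_cut b h).
Proof. by move=> m le; rewrite /fcoef /= ltnNge le. Qed.

End Truncation.

Lemma ordge_cut d (A : comNzRingType) b (h : fps d A) : ordge b (h - fps_cut b h).
Proof. by move=> m lt; rewrite fcoefB [X in _ - X]fcoefE lt subrr. Qed.

(** Polynomials of bounded degree involve finitely many scalars. The list is chosen before the
    subring, so that the subring can be built from it. *)
Lemma coefs_in_seq d (K : fieldType) D (hs : seq (fps d K)) : exists s : seq K,
  forall A, subring A -> (forall x, x \in s -> A x) ->
    forall h, h \in hs -> fps_lt D h -> coefs_in A h.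
Proof.
exists [seq fcoef h (k : bmultinom d D) | h <- hs, k <- enum {: bmultinom d D}] => A rA As h hh hD m.
have [lt|ge] := ltnP (mdeg m) D; last by rewrite hD //; exact: subring0.
apply: As; rewrite (_ : m = BMultinom lt) //.
by apply/allpairsP; exists (h, BMultinom lt); split=> //; rewrite mem_enum.
Qed.

Lemma subring_primes_seq (K : numFieldType) (l : seq K) :
  exists A : set K, [/\ subring A, forall x, x \in l -> A x &
    exists n0 : nat, forall p, prime p -> (n0 <= p)%N -> forall a, A a -> p%:R * a <> 1].
Proof.
have [A [rA Al H]] := subring_primes (tnth (in_tuple l)).
by exists A; split=> // x /(@tnthP _ _ (in_tuple l)) [i ->].
Qed.

(** The divisions fed to the Frobenius argument do not depend on [p]. Once cut to polynomials they
    involve finitely many scalars, so one ring [A] serves all large primes. *)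
Lemma power_spans d (K : numFieldType) n tau D (g : 'I_n -> fps d K) (v : 'I_tau -> fps d K) :
    (forall i, fps_lt D (g i)) -> spans (idl g) v ->
  exists p0, forall p, prime p -> (p0 <= p)%N ->
    exists w : 'I_(p ^ d * tau) -> fps d K, spans (idl (fun i => g i ^+ p)) w.
Proof.
move=> gD sv; pose R := fps d K; have idI := idl_ideal g.
have [L HL] := fin_codim_ordge idI sv.
pose v' j := fps_cut L (v j).
have sv' : spans (idl g) v'.
  move=> x; have [c hc] := sv x; exists c.
  apply: (ideal_trans idI) hc _; rewrite -sumrB; apply: (ideal_sum idI) => j _.
  by rewrite -scalerBr; apply: (subspZ (ideal_subsp idI)); apply: HL; exact: ordge_cut.
pose T := {ffun 'I_d -> 'I_L}.
have lowx (q : T) : exists ca : ('I_tau -> K) * ('I_n -> R),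
    fmon K (box_mon q) - \sum_j ca.1 j *: v' j = \sum_i ca.2 i * g i.
  by have [c [a E]] := sv' (fmon K (box_mon q)); exists (c, a).
have [ca Hca] := choice lowx.
have highx k : exists a : 'I_n -> R, fps_X K k ^+ L = \sum_i a i * g i.
  by apply: HL; apply: ordgeXn; exact: ordge_X.
have [b Hb] := choice highx.
(* Order above [d * L] forces factors [x_k^L]; the further [L] keeps the cofactors of positive
   order. *)
pose B := (d * L + L).+1.
pose D' := maxn D B.
pose hs : seq R := codom g ++ codom v' ++
  [seq ((ca q.1).1 q.2)%:A | q : T * 'I_tau] ++
  [seq fps_cut B ((ca q.1).2 q.2) | q : T * 'I_n] ++
  [seq fps_cut B (b q.1 q.2) | q : 'I_d * 'I_n].
have [s Hs] := coefs_in_seq D' hs.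
have [A [rA As [n0 Hn0]]] := subring_primes_seq s.
exists n0 => p pp le; have pA := Hn0 p pp le.
have BD : (B <= D')%N := leq_maxr _ _.
have gA i : coefs_in A (g i).
  apply: (Hs A rA As); first by rewrite !mem_cat codom_f.
  by apply: fps_ltW (gD i); exact: leq_maxl.
have vA j : coefs_in A (v' j).
  apply: (Hs A rA As); first by rewrite !mem_cat codom_f orbT.
  by apply: fps_ltW (@fps_cut_lt _ _ _ _); rewrite /D' /B; lia.
have cA q j : A ((ca q).1 j).
  have := Hs A rA As ((ca q).1 j)%:A; rewrite !mem_cat (codom_f (fun q => ((ca q.1).1 q.2)%:A) (q, j)) !orbT.
  move=> /(_ isT); rewrite /coefs_in /= => H; have := H _ (@mnm0 d).
  rewrite fcoefZ fcoef1 eqxx mulr1; apply=> m mge.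
  rewrite fcoefZ fcoef1; case: eqP mge => [->|_ _]; last by rewrite mulr0.
  by rewrite mdeg0 /D' /B; lia.
have aA q i : coefs_in A (fps_cut B ((ca q).2 i)).
  apply: (Hs A rA As); last by apply: fps_ltW BD _; exact: fps_cut_lt.
  by rewrite !mem_cat (codom_f (fun q => fps_cut B ((ca q.1).2 q.2)) (q, i)) !orbT.
have bA k i : coefs_in A (fps_cut B (b k i)).
  apply: (Hs A rA As); last by apply: fps_ltW BD _; exact: fps_cut_lt.
  by rewrite !mem_cat (codom_f (fun q => fps_cut B (b q.1 q.2)) (k, i)) !orbT.
have rR := coefs_in_subring d rA.
have cutg (a : 'I_n -> R) : ordge B (\sum_i a i * g i - \sum_i fps_cut B (a i) * g i).
  by rewrite -sumrB; apply: ordge_sum => i _; rewrite -mulrBl; apply: ordgeMr; exact: ordge_cut.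
have decomp (r : R) : ordge B r -> coefs_in A r -> exists e : 'I_d -> R,
    [/\ forall k, coefs_in A (e k), forall k, ordge 1 (e k) & r = \sum_k fps_X K k ^+ L * e k].
  move=> or Ar; have [m Hm|e [eE [Ho HA]]] := @mono_decomp d K xpredT L r.
    apply: or; rewrite /B ltnS mdegE; apply: leq_trans (leq_addr _ _).
    rewrite -[X in (_ <= X * _)%N]card_ord -sum_nat_const.
    by apply: leq_sum => i _; apply/ltnW/Hm.
  exists e; split=> // k; first exact: (HA A (subring0 rA) Ar k).
  apply: ordgeW (Ho k _ or); rewrite /B; lia.
have low (m : multinom d) : (forall i, m i < L)%N -> exists (c : 'I_tau -> K) (a : 'I_n -> R) (e : 'I_d -> R),
    [/\ forall j, A (c j), forall i, coefs_in A (a i), forall k, coefs_in A (e k) &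
     fmon K m = \sum_j c j *: v' j + \sum_i a i * g i + \sum_k fps_X K k ^+ L * e k].
  move=> mL; have [q <-] := box_monP mL.
  have Eq := Hca q; move: (cA q) (aA q) Eq; case: (ca q) => c a /= cq aq Eq.
  have [||e [eA _ eE]] := decomp (fmon K (box_mon q) - \sum_j c j *: v' j - \sum_i fps_cut B (a i) * g i).
  - by rewrite Eq; exact: cutg.
  - apply: (subringB rR); first apply: (subringB rR); first exact: coefs_in_mon.
      apply: (subring_sum rR) => j _; rewrite -mulr_algl.
      by apply: (subringM rR) => //; exact: coefs_in_alg.
    by apply: (subring_sum rR) => i _; exact: (subringM rR).
  by exists c, (fun i => fps_cut B (a i)), e; split=> //; rewrite -eE; ring.
have high k : exists (a : 'I_n -> R) (s : 'I_d -> R),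
    [/\ forall i, coefs_in A (a i), forall l, coefs_in A (s l), forall l, ordge 1 (s l) &
     fps_X K k ^+ L = \sum_i a i * g i + \sum_l fps_X K l ^+ L * s l].
  have [||e [eA e1 eE]] := decomp (fps_X K k ^+ L - \sum_i fps_cut B (b k i) * g i).
  - by rewrite Hb; exact: cutg.
  - apply: (subringB rR); first by apply: (subringX rR); exact: coefs_in_mon.
    by apply: (subring_sum rR) => i _; exact: (subringM rR).
  by exists (fun i => fps_cut B (b k i)), e; split=> //; rewrite -eE; ring.
pose J := idl (fun i => g i ^+ p); have idJ : ideal J := idl_ideal _.
have Xp k : exists N, J (fps_X K k ^+ N).
  have Xk : idl g (fps_X K k ^+ L) by apply: HL; apply: ordgeXn; exact: ordge_X.
  have [N HN] := idl_pow p Xk.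
  by exists (L * N)%N; rewrite exprM.
have [N HN] := choice Xp.
have UM h : ordge (d * (\max_k N k)).+1 h -> J h.
  apply: ordge_mono_ideal => // k; rewrite -(subnK (leq_bigmax k)) exprD.
  exact: (idealM idJ).
have sf := frob_spans rA pp pA gA vA low high UM.
have E : #|{: {ffun 'I_d -> 'I_p} * 'I_tau}| = (p ^ d * tau)%N.
  by rewrite card_prod card_ffun !card_ord.
exists (fun i => frob_gen v' (enum_val (cast_ord (esym E) i))) => x.
have [c hc] := sf x; exists (fun i => c (enum_val (cast_ord (esym E) i))).
rewrite (_ : \sum_t _ = \sum_q c q *: frob_gen v' q) //.
rewrite [RHS](reindex _ (onW_bij _ (enum_val_bij _))) /=.
rewrite [RHS](reindex (cast_ord (esym E))) //=.
by exists (cast_ord E) => i _; rewrite ?cast_ordK ?cast_ordKV.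
Qed.

Section PrimeBound.
Variables (d : nat) (K : numFieldType).
Local Notation R := (fps d K).
Local Notation df f := (fun i => fps_deriv i f).

(** Cutting [f] at order [L.+2] changes its partial derivatives by elements of order [L.+1], that
    is, by combinations of the [x_i] with coefficients in the Jacobian ideal. Nakayama then gives
    the equality of the ideals. *)
Lemma cut_tjurina (f : R) (T : finType) (v : T -> R) : spans (idl (df f)) v ->
  exists D (f' : R), [/\ fps_lt D f', ordge 1 f -> ordge 1 f', idl (df f') = idl (df f) &
    idl (fcons f' (df f')) = idl (fcons f (df f))].
Proof.
move=> sv; have idJ := idl_ideal (df f).
have [L HL] := fin_codim_ordge idJ sv.
pose f' := fps_cut L.+2 f; exists L.+2, f'.
have ff : ordge L.+2 (f - f') by exact: ordge_cut.
have dff i : ordge L.+1 (fps_deriv i f - fps_deriv i f').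
  have -> : fps_deriv i f - fps_deriv i f' = fps_deriv i (f - f').
    by rewrite -[- f']scaleN1r fps_derivD fps_derivZ scaleN1r.
  exact: ordge_deriv.
have J'J : idl (df f') `<=` idl (df f).
  apply: idl_min => // i; apply: (ideal_eq idJ) (idl_mem (df f) i).
  by apply: (ideal_sym idJ); apply: HL; apply: ordgeW (dff i).
have JJ' : idl (df f) `<=` idl (df f').
  apply: idl_min; first exact: idl_ideal.
  apply: nakayama; first exact: idl_ideal.
  move=> l; have [u [ou uE]] := ordgeS_decomp (dff l).
  have Ju i : exists a : 'I_d -> R, u i = \sum_k a k * fps_deriv k f by exact: HL.
  have [a Ha] := choice Ju.
  exists (fun k => \sum_i fps_X K i * a i k); split=> [k|].
    by apply: ordge_sum => i _; apply: ordgeMr; exact: ordge_X.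
  rewrite (_ : _ - _ = fps_deriv l f'); first exact: (idl_mem (df f')).
  rewrite (_ : \sum_k _ = fps_deriv l f - fps_deriv l f'); first by rewrite opprB addrC subrK.
  rewrite uE; under eq_bigr do rewrite mulr_suml.
  rewrite exchange_big; apply: eq_bigr => i _; rewrite Ha mulr_sumr.
  by apply: eq_bigr => k _; rewrite mulrA.
have JE : idl (df f') = idl (df f) by apply/seteqP.
have Jf : idl (df f) (f - f') by apply: HL; apply: ordgeW ff; lia.
have sub g : idl (df g) `<=` idl (fcons g (df g)).
  apply: idl_min => [|i]; first exact: idl_ideal.
  rewrite -(fconsS g (df g)); exact: idl_mem.
have mem g : idl (fcons g (df g)) g by have := idl_mem (fcons g (df g)) ord0; rewrite fcons0.
split=> //; first exact: fps_cut_lt.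
  by move=> o1; rewrite -[f'](subKr f); apply: ordgeB => //; apply: ordgeW ff.
apply/seteqP; split; (apply: idl_min; [exact: idl_ideal | apply: fcons_ind => [|i]]).
- by rewrite -[f'](subKr f); apply: (idealB (idl_ideal _)); [exact: mem | exact: sub].
- by apply: sub; rewrite -JE; exact: (idl_mem (df f')).
- rewrite -[f](subrK f'); apply: (idealD (idl_ideal _)); last exact: mem.
  by apply: sub; rewrite JE.
- by apply: sub; rewrite JE; exact: (idl_mem (df f)).
Qed.

Lemma prime_box_bound (f : R) mu tau (v : 'I_mu -> R) (w : 'I_tau -> R) : ordge 1 f ->
    basis_mod (idl (df f)) v -> spans (idl (fcons f (df f))) w ->
  exists p0, forall p, prime p -> (p0 <= p)%N -> forall t u, (u + mu <= t + p.+1)%N ->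
    (mu * #|box d p u| <= p ^ d * tau + mu * #|box d p t|)%N.
Proof.
move=> f0 bv sw; have [_ sv] := bv.
have [D [f' [fD f'0 JE IE]]] := cut_tjurina sv.
have gD i : fps_lt D.+1 (fcons f' (df f') i).
  apply: (fcons_ind (P := fps_lt D.+1)) => [|j]; first exact: fps_ltW fD.
  by move=> m le; rewrite fcoef_deriv fD ?mul0rn // mdegD mdeg1; lia.
rewrite -IE in sw; rewrite -JE in bv.
have [p0 Hp] := power_spans gD sw.
exists (maxn mu p0) => p pp; rewrite geq_max => /andP[mup p0p] t u ut.
have [w' sw'] := Hp p pp p0p.
apply: (power_box_count (f'0 f0) bv mup ut (w := w')).
rewrite (_ : fcons (f' ^+ p) _ = fun i => fcons f' (df f') i ^+ p) //.
by apply/funext => i; rewrite /fcons; case: (unlift ord0 i).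
Qed.

End PrimeBound.

(** * Lattice points of boxes *)

Section BoxCount.
Variable A : comNzRingType.

Definition geom_poly p : {poly A} := \sum_(j < p) 'X^j.

Definition coef_psum (P : {poly A}) u : A := \sum_(k < u) P`_k.

Lemma card_box d p u : (#|box d p u|)%:R = coef_psum (geom_poly p ^+ d) u.
Proof.
have -> : geom_poly p ^+ d = \sum_(a : {ffun 'I_d -> 'I_p}) 'X^(\sum_i (a i : nat)).
  rewrite -[X in _ ^+ X]card_ord -prodr_const (bigA_distr_bigA (fun _ (j : 'I_p) => 'X^j)).
  by apply: eq_bigr => a _; rewrite expr_sum.
rewrite /coef_psum; under eq_bigr do rewrite coef_sum.
rewrite exchange_big -sum1_card natr_sum /= [LHS]big_mkcond /=; apply: eq_bigr => a _.
rewrite /box inE (eq_bigr (fun k : 'I_u => (k == \sum_i a i :> nat)%N%:R)) => [|k _]; last by rewrite coefXn.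
case: ltnP => [lt|ge].
  rewrite (bigD1 (Ordinal lt)) //= eqxx big1 ?addr0 // => k nk.
  by case: eqP => // e; case/eqP: nk; apply: val_inj.
by rewrite big1 // => k _; rewrite ltn_eqF // (leq_trans (ltn_ord k)).
Qed.

(** The number of points of [N^d] with coordinate sum below [n]. The separate value at 0 is needed
    for [d = 0], and makes truncated subtraction harmless below. *)
Definition cone_count d n : nat := if n is n'.+1 then 'C(n' + d, d) else 0%N.

Lemma cone_countS d n : cone_count d.+1 n.+1 = (cone_count d.+1 n + cone_count d n.+1)%N.
Proof.
case: n => [|n] /=; first by rewrite add0n !binn.
by rewrite addSn binS addnS addSn.
Qed.

Lemma sum_cone_count d m p :
  \sum_(j < p) (cone_count d (m - j))%:R = (cone_count d.+1 m)%:R - (cone_count d.+1 (m - p))%:R :> A.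
Proof.
elim: p => [|p IH]; first by rewrite big_ord0 subn0 subrr.
rewrite big_ord_recr IH /= subnS; case: (m - p)%N => [|n] /=; first by rewrite subr0 addr0.
by rewrite -[in X in _ - X + _]/(cone_count d.+1 n.+1) cone_countS natrD /=; ring.
Qed.

Lemma coef_psum_geom p P u : coef_psum (geom_poly p * P) u = \sum_(j < p) coef_psum P (u - j).
Proof.
rewrite /coef_psum /geom_poly mulr_suml; under eq_bigr do rewrite coef_sum.
rewrite exchange_big; apply: eq_bigr => j _.
under eq_bigr do rewrite coefXnM.
rewrite -(big_mkord xpredT (fun k => if (k < j)%N then 0 else P`_(k - j))).
rewrite -(big_mkord xpredT (fun k => P`_k)).
have [le|lt] := leqP u j.
  rewrite (eqP le) [RHS]big_geq // big1_seq // => k; rewrite mem_index_iota => /andP[_ ku].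
  by rewrite (leq_trans ku le).
rewrite (big_cat_nat (n := j)) //=; last exact: ltnW.
rewrite big1_seq ?add0r => [|k /andP[_]]; last by rewrite mem_index_iota => /andP[_ ->].
rewrite -{1}[nat_of_ord j]add0n big_addn; apply: eq_big_nat => k _.
by rewrite ltnNge leq_addl addnK.
Qed.

(** Inclusion-exclusion over the coordinates that are at least [p], proved by induction on [d]: one
    more factor [geom_poly p] takes a difference of cone counts, and Pascal's rule regroups the
    terms. *)
Lemma card_boxE d p u : (#|box d p u|)%:R =
  \sum_(i < d.+1) (-1) ^+ i * ('C(d, i))%:R * (cone_count d (u - i * p))%:R :> A.
Proof.
rewrite card_box; elim: d u => [|d IH] u.
  rewrite expr0 big_ord1 bin0 expr0 !mul1r mul0n subn0 /coef_psum.
  case: u => [|u]; first by rewrite big_ord0.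
  by rewrite big_ord_recl coef1 eqxx big1 ?addr0 /= ?bin0 // => i _; rewrite coef1.
rewrite exprS coef_psum_geom; under eq_bigr do rewrite IH.
rewrite exchange_big /=; pose g i : A := (cone_count d.+1 (u - i * p))%:R.
transitivity (\sum_(i < d.+1) (-1) ^+ i * ('C(d, i))%:R * (g i - g i.+1)).
  apply: eq_bigr => i _; rewrite -mulr_sumr; congr (_ * _).
  under eq_bigr do rewrite subnAC; rewrite sum_cone_count /g mulSn.
  by rewrite addnC subnDA.
rewrite [RHS]big_ord_recl /= bin0 expr0 !mul1r.
under [X in _ = _ + X]eq_bigr do rewrite /bump /= add1n binS natrD exprS -/(g _).
rewrite mul0n -/(g 0%N).
have -> : g 0%N + \sum_(i < d.+1) -1 * (-1) ^+ i * (('C(d, i.+1))%:R + ('C(d, i))%:R) * g i.+1 =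
   (g 0%N + \sum_(i < d.+1) (-1) ^+ i.+1 * ('C(d, i.+1))%:R * g i.+1) -
   \sum_(i < d.+1) (-1) ^+ i * ('C(d, i))%:R * g i.+1.
  rewrite -addrA; congr (_ + _); rewrite -sumrB; apply: eq_bigr => i _; rewrite exprS; ring.
under eq_bigr do rewrite mulrBr; rewrite sumrB; congr (_ - _).
have : \sum_(i < d.+2) (-1) ^+ i * ('C(d, i))%:R * g i = _ := big_ord_recl _ _.
rewrite big_ord_recr /= bin_small // mulr0 mul0r addr0 => ->.
by rewrite bin0 expr0 !mul1r; congr (_ + _); apply: eq_bigr => i _; rewrite /bump /= add1n.
Qed.

End BoxCount.

Lemma cone_count_prod d n : (0 < d)%N -> (cone_count d n * d`! = \prod_(j < d) (n + j))%N.
Proof.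
move=> d0; case: n => [|n] /=.
  by case: d d0 => // d _; rewrite big_ord_recl addn0 mul0n.
apply/eqP; rewrite -(eqn_pmul2r (fact_gt0 n)) -mulnA.
rewrite -{2}(addnK d n) bin_fact ?leq_addl //; apply/eqP.
elim: d {d0} => [|d IH]; first by rewrite big_ord0 mul1n addn0.
by rewrite addnS factS IH big_ord_recr /=; lia.
Qed.

Import numFieldNormedType.Exports.

(** * Limits of box counts *)

Section BoxLimit.
Variable R : realType.

Lemma cvg_prodr (I : Type) (r : seq I) (F : I -> nat -> R) (l : I -> R) :
  (forall i, F i n @[n --> \oo] --> l i) ->
  (\prod_(i <- r) F i n) @[n --> \oo] --> \prod_(i <- r) l i.
Proof.
move=> H; elim: r => [|i r IH].
  by rewrite big_nil; under eq_fun do rewrite big_nil; exact: cvg_cst.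
rewrite big_cons; under eq_fun do rewrite big_cons.
exact: cvgM.
Qed.

Lemma cvg_sumr (I : Type) (r : seq I) (F : I -> nat -> R) (l : I -> R) :
  (forall i, F i n @[n --> \oo] --> l i) ->
  (\sum_(i <- r) F i n) @[n --> \oo] --> \sum_(i <- r) l i.
Proof.
move=> H; elim: r => [|i r IH].
  by rewrite big_nil; under eq_fun do rewrite big_nil; exact: cvg_cst.
rewrite big_cons; under eq_fun do rewrite big_cons.
exact: cvgD.
Qed.

Lemma cvg_const_inv (c : R) : c / n%:R @[n --> \oo] --> (0 : R).
Proof.
rewrite -(mulr0 c); apply: cvgM; first exact: cvg_cst.
have := @gtr0_cvgV0 R nat \oo _ (fun n => n%:R); case=> [|_]; last by apply; exact: cvgr_idn.
by near=> n; rewrite ltr0n; near: n; exact: nbhs_infty_gt.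
Unshelve. all: by end_near.
Qed.

(** The Irwin-Hall distribution function. The truncated powers give the sum a fixed range, so that
    limits in [s] pass term by term. *)
Definition irwin_hall d (s : R) : R :=
  \sum_(i < d.+1) (-1) ^+ i * ('C(d, i))%:R * ((Num.max 0 (s - i%:R)) ^+ d / (d`!)%:R).

Lemma natr_subn (m n : nat) : (m - n)%:R = Num.max 0 (m%:R - n%:R) :> R.
Proof.
have [le|lt] := leqP n m; first by rewrite natrB // max_r // subr_ge0 ler_nat.
rewrite (eqP (ltnW lt)) max_l // subr_le0 ler_nat ltnW //.
Qed.

Lemma cvg_max0 (F : nat -> R) l : F n @[n --> \oo] --> l ->
  Num.max 0 (F n) @[n --> \oo] --> Num.max 0 l.
Proof.
have E x : Num.max 0 x = (x + `|x|) / 2 :> R.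
  by case: (lerP 0 x) => h; [rewrite ger0_norm // | rewrite ltr0_norm //]; field.
move=> H; rewrite E; under eq_fun do rewrite E.
by apply: cvgM; [apply: cvgD => //; exact: cvg_norm | exact: cvg_cst].
Qed.

Lemma box_limit d (u : nat -> nat) s : (0 < d)%N ->
    (u p)%:R / p%:R @[p --> \oo] --> (s : R) ->
  (#|box d p (u p)|)%:R / p%:R ^+ d @[p --> \oo] --> irwin_hall d s.
Proof.
move=> d0 us.
pose F p := \sum_(i < d.+1) (-1) ^+ i * ('C(d, i))%:R *
  ((\prod_(j < d) (Num.max 0 ((u p)%:R / p%:R - i%:R) + j%:R / p%:R)) / (d`!)%:R) : R.
have : F p @[p --> \oo] --> irwin_hall d s.
  apply: cvg_sumr => i; apply: cvgM; first exact: cvg_cst.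
  apply: cvgM; last exact: cvg_cst.
  have -> : Num.max 0 (s - i%:R) ^+ d = \prod_(j < d) (Num.max 0 (s - i%:R) + 0).
    by rewrite addr0 prodr_const card_ord.
  apply: cvg_prodr => j; apply: cvgD; last exact: cvg_const_inv.
  by apply: cvg_max0; apply: cvgB => //; exact: cvg_cst.
apply: cvg_trans; apply: near_eq_cvg; near=> p.
have p0 : (0 < p)%N by near: p; exact: nbhs_infty_gt.
have pn : p%:R != 0 :> R by rewrite pnatr_eq0 -lt0n.
rewrite card_boxE /F mulr_suml; apply: eq_bigr => i _; rewrite -!mulrA; congr (_ * (_ * _)).
have fn : (d`!)%:R != 0 :> R by rewrite pnatr_eq0 -lt0n fact_gt0.
apply: (mulIf fn); rewrite mulfVK // mulrAC -natrM cone_count_prod //.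
rewrite natr_prod -exprVn -[X in _ ^+ X]card_ord -prodr_const -big_split /=.
apply: eq_bigr => j _; rewrite natrD mulrDl natr_subn natrM; congr (_ + _).
by rewrite maxr_pMl ?invr_ge0 ?ler0n // mul0r mulrBl mulfK.
Unshelve. all: by end_near.
Qed.

Lemma hypercube_volE d (s : R) : (0 < d)%N -> 0 <= s -> hypercube_vol s d = irwin_hall d s.
Proof.
move=> d0 s0; rewrite /hypercube_vol /irwin_hall.
pose F i : R := (-1) ^+ i * ('C(d, i))%:R * (Num.max 0 (s - i%:R) ^+ d / (d`!)%:R).
pose m := maxn (Num.truncn s) d.
have ext n : (n <= m)%N -> (forall i, (n < i)%N -> F i = 0) -> \sum_(i < n.+1) F i = \sum_(i < m.+1) F i.
  move=> le H; rewrite -(big_mkord xpredT) -(big_mkord xpredT F) [RHS](big_cat_nat (n := n.+1)) //=.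
  by rewrite [X in _ = _ + X]big1_seq ?addr0 // => i; rewrite mem_index_iota => /andP[_ /andP[/H]].
transitivity (\sum_(i < (Num.truncn s).+1) F i).
  apply: eq_bigr => i _; rewrite /F max_r; first by field; rewrite pnatr_eq0 -lt0n fact_gt0.
  rewrite subr_ge0; apply: (@le_trans _ _ (Num.truncn s)%:R); last by rewrite truncn_le.
  by rewrite ler_nat -ltnS.
rewrite ext ?leq_maxl // => [|i lt]; last first.
  rewrite /F max_l ?expr0n ?gtn_eqF ?mul0r ?mulr0 //.
  by rewrite subr_le0; apply/ltW; have := truncnS_gt s; move=> h; apply: lt_le_trans h _; rewrite ler_nat.
by rewrite -(ext d) ?leq_maxr // => i lt; rewrite /F bin_small // mulr0 mul0r.
Qed.

End BoxLimit.

Section Window.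
Variable R : realType.

(** Stated for arbitrarily large [n], since the estimates are available at primes or at suitable
    multiples. *)
Lemma cvg_frequently_le (x : nat -> R) (l c : R) : x n @[n --> \oo] --> l ->
  (forall N, exists2 n, (N <= n)%N & x n <= c) -> l <= c.
Proof.
move=> xl H; rewrite leNgt; apply/negP => cl.
have [N _ HN] : \forall n \near \oo, c < x n by exact: (cvgr_gt l).
by have [n Nn] := H N; rewrite leNgt HN.
Qed.

Lemma cvg_ratio (u : nat -> nat) (s c : R) :
  (forall p, `|(u p)%:R - s * p%:R| <= c) -> (u p)%:R / p%:R @[p --> \oo] --> s.
Proof.
move=> H.
have lo : s - c / p%:R @[p --> \oo] --> s.
  rewrite -[X in _ --> X]subr0; apply: cvgB; [exact: cvg_cst | exact: cvg_const_inv].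
have hi : s + c / p%:R @[p --> \oo] --> s.
  rewrite -[X in _ --> X]addr0; apply: cvgD; [exact: cvg_cst | exact: cvg_const_inv].
apply: squeeze_cvgr lo hi; near=> p.
have p0 : 0 < p%:R :> R by rewrite ltr0n; near: p; exact: nbhs_infty_gt.
have := H p; rewrite ler_norml => /andP[h1 h2].
have pn : p%:R != 0 :> R by rewrite gt_eqF.
move: h1 h2; rewrite -{1 2}[c](divfK pn) -{1 2}[(u p)%:R](divfK pn).
set x := (u p)%:R / p%:R; set y := c / p%:R => h1 h2.
apply/andP; split; rewrite -(ler_pM2r p0); lra.
Unshelve. all: by end_near.
Qed.

Lemma half_bounds n : n%:R - 1 <= 2 * (n./2)%:R :> R /\ 2 * (n./2)%:R <= n%:R :> R.
Proof.
have E : n%:R = (odd n)%:R + 2 * (n./2)%:R :> R.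
  by rewrite -natrM -natrD mul2n odd_double_half.
by rewrite E; case: (odd n); rewrite ?mulr1n ?mulr0n; split; lra.
Qed.

(** The lower face of the slab of width [p] centred in the box of side [p]. *)
Definition lower_cut d p := (d.-1 * p)./2.

Definition window d : R := irwin_hall d ((d%:R + 1) / 2) - irwin_hall d ((d%:R - 1) / 2).

Lemma lower_cut_bounds d p : (0 < d)%N ->
  (d%:R - 1) / 2 * p%:R - 1 <= (lower_cut d p)%:R :> R /\
  (lower_cut d p)%:R <= (d%:R - 1) / 2 * p%:R :> R.
Proof.
move=> d0; have [h1 h2] := half_bounds (d.-1 * p).
have E : (d.-1 * p)%:R = (d%:R - 1) * p%:R :> R by rewrite natrM -{2}(prednK d0) -addn1 natrD addrK.
move: h1 h2; rewrite E /lower_cut => h1 h2; split; lra.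
Qed.

(** Both cuts may be moved by a bounded amount [b], which disappears after division by [p]. *)
Lemma window_cvg d (b : nat) (t u : nat -> nat) : (0 < d)%N ->
    (forall p, (t p <= lower_cut d p + b)%N /\ (lower_cut d p <= t p + b)%N) ->
    (forall p, (u p <= t p + p + b)%N /\ (t p + p <= u p + b)%N) ->
  ((#|box d p (u p)|)%:R - (#|box d p (t p)|)%:R) / p%:R ^+ d @[p --> \oo] --> window d.
Proof.
move=> d0 Ht Hu; under eq_fun do rewrite mulrBl.
have nat_ler (m n : nat) : (m <= n)%N -> m%:R <= n%:R :> R by rewrite ler_nat.
have tb p : (t p)%:R <= (lower_cut d p)%:R + b%:R :> R /\ (lower_cut d p)%:R <= (t p)%:R + b%:R :> R.
  by have [h1 h2] := Ht p; rewrite -!natrD; split; exact: nat_ler.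
have ub p : (u p)%:R <= (t p)%:R + p%:R + b%:R :> R /\ (t p)%:R + p%:R <= (u p)%:R + b%:R :> R.
  by have [h1 h2] := Hu p; rewrite -!natrD; split; exact: nat_ler.
apply: cvgB; apply: box_limit => //.
  apply: (@cvg_ratio _ _ (2 * b%:R + 1)) => p; have [h1 h2] := lower_cut_bounds p d0.
  have [h3 h4] := tb p; have [h5 h6] := ub p; rewrite ler_norml; apply/andP; split; nra.
apply: (@cvg_ratio _ _ (b%:R + 1)) => p; have [h1 h2] := lower_cut_bounds p d0.
have [h3 h4] := tb p; rewrite ler_norml; apply/andP; split; nra.
Qed.

(** The slab contains a cube about the centre: if all coordinates lie in [[d m - m, d m + m)], their
    sum lies between the two cuts. *)
Lemma box_window_lb d m : (0 < d)%N -> (0 < m)%N ->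
  (#|box d (2 * d * m) (d.-1 * (d * m))| + (2 * m) ^ d <= #|box d (2 * d * m) (d.+1 * (d * m))|)%N.
Proof.
move=> d0 m0.
have lt (b : 'I_(2 * m)) : (d * m - m + b < 2 * d * m)%N.
  have := ltn_ord b; have : (m <= d * m)%N by rewrite leq_pmull.
  by rewrite -mulnA; lia.
pose psi (b : {ffun 'I_d -> 'I_(2 * m)}) : {ffun 'I_d -> 'I_(2 * d * m)} := [ffun i => Ordinal (lt (b i))].
have psi_inj : injective psi.
  move=> b b' /ffunP E; apply/ffunP => i; have := congr1 val (E i); rewrite !ffunE /= => /addnI e.
  exact: val_inj.
have psi_sum b : (\sum_i (psi b i : nat) = d * (d * m - m) + \sum_i (b i : nat))%N.
  under eq_bigr do rewrite ffunE /=.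
  by rewrite big_split sum_nat_const card_ord.
have e : (d * (d * m - m) = d.-1 * (d * m))%N by rewrite -{2}[m]mul1n -mulnBl subn1 mulnCA.
rewrite -[X in (X ^ _)%N]card_ord -[X in (_ ^ X)%N]card_ord -card_ffun -(card_imset _ psi_inj).
rewrite -cardsUI [X in (_ + #|pred_of_set X| <= _)%N](_ : _ = finset.set0); last first.
  apply/setP => a; rewrite !inE; apply/negP => /andP[lt1 /imsetP[b _ ab]].
  by move: lt1; rewrite ab psi_sum e -ltn_subRL subnn.
rewrite cards0 addn0; apply: subset_leq_card; apply/fintype.subsetP => a; rewrite !inE => /orP[lt1|/imsetP[b _ ->]].
  by apply: leq_trans lt1 _; rewrite leq_mul2r; apply/orP; right; lia.
rewrite psi_sum e.
have : (\sum_i (b i : nat) <= d * (2 * m).-1)%N.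
  rewrite -[X in (_ <= X * _)%N](card_ord d) -sum_nat_const; apply: leq_sum => i _.
  by rewrite -ltnS prednK ?muln_gt0 ?m0.
have : (d.+1 * (d * m) = d.-1 * (d * m) + 2 * (d * m))%N by rewrite -mulnDl addn2 prednK.
have : (d * (2 * m).-1 + d = 2 * (d * m))%N by rewrite -mulnSr prednK ?muln_gt0 ?m0 // mulnCA.
move=> e1 e2 e3; rewrite e2 ltn_add2l -e1; apply: leq_ltn_trans e3 _.
by rewrite -[X in (X < _)%N]addn0 ltn_add2l.
Qed.

Lemma window_gt0 d : (0 < d)%N -> 0 < window d.
Proof.
move=> d0; have dn : d%:R != 0 :> R by rewrite pnatr_eq0 -lt0n.
(* The volume of the cube of side [1/d] about the centre. *)
suff : d%:R ^- d <= window d by apply: lt_le_trans; rewrite invr_gt0 exprn_gt0 // ltr0n.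
rewrite -lerN2.
pose u p := (d.+1 * p)./2.
have H : ((#|box d p (u p)|)%:R - (#|box d p (lower_cut d p)|)%:R) / p%:R ^+ d @[p --> \oo] --> window d.
  apply: (@window_cvg d 1) => // p; first by split; lia.
  rewrite /u /lower_cut -{1 4}(prednK d0) !mulSn; split; lia.
apply: (cvg_frequently_le (cvgN H)) => N.
have m0 : (0 < N.+1)%N by [].
(* An even side makes both halvings exact. *)
exists (2 * d * N.+1)%N; first by nia.
rewrite lerN2 /u /lower_cut.
have -> : ((d.+1 * (2 * d * N.+1))./2 = d.+1 * (d * N.+1))%N by rewrite -mulnA mulnCA mul2n doubleK.
have -> : ((d.-1 * (2 * d * N.+1))./2 = d.-1 * (d * N.+1))%N by rewrite -mulnA mulnCA mul2n doubleK.
have := box_window_lb d0 m0; rewrite -(ler_nat R) natrD => h.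
have p0 : 0 < (2 * d * N.+1)%:R ^+ d :> R by rewrite exprn_gt0 // ltr0n !muln_gt0 d0.
rewrite ler_pdivlMr // lerBrDl; apply: le_trans h; rewrite lerD2l.
rewrite -exprVn -exprMn natrX ler_pXn2r ?nnegrE ?mulr_ge0 ?invr_ge0 ?ler0n //.
by rewrite mulnAC natrM mulrCA mulVf // mulr1.
Qed.

Lemma mu_tau_boundE d : (0 < d)%N -> mu_tau_bound R d = (window d)^-1.
Proof.
move=> d0; have d1 : 1 <= d%:R :> R by rewrite ler1n.
by rewrite /mu_tau_bound !hypercube_volE // divr_ge0 //; lra.
Qed.

Lemma hypercube_vol_rat d (a : nat) : exists q : rat, hypercube_vol (a%:R / 2 : R) d = ratr q.
Proof.
rewrite /hypercube_vol; elim/big_ind: _ => [|x y [q ->] [r ->]|i _].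
- by exists 0; rewrite rmorph0.
- by exists (q + r); rewrite rmorphD.
exists ((-1) ^+ i / (d`!)%:R * ('C(d, i))%:R * (a%:R / 2 - i%:R) ^+ d).
rewrite !rmorphM !rmorphXn rmorphB !rmorphM !fmorphV !rmorph_nat rmorphN rmorph1 //.
Qed.

Lemma mu_tau_bound_rat d : (0 < d)%N -> exists q : rat, mu_tau_bound R d = ratr q.
Proof.
move=> d0; have [q hq] := hypercube_vol_rat d d.+1; have [r hr] := hypercube_vol_rat d d.-1.
exists ((q - r)^-1); rewrite fmorphV rmorphB /= -hq -hr /mu_tau_bound.
have -> : d.+1%:R = d%:R + 1 :> R by rewrite -addn1 natrD.
have -> // : d.-1%:R = d%:R - 1 :> R by rewrite -{2}(prednK d0) -addn1 natrD addrK.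
Qed.

Lemma mu_window_le (K : numFieldType) d (f : fps d K) mu tau (v : 'I_mu -> fps d K) (w : 'I_tau -> fps d K) :
    (0 < d)%N -> ordge 1 f -> basis_mod (idl (fun i => fps_deriv i f)) v ->
    spans (idl (fcons f (fun i => fps_deriv i f))) w ->
  mu%:R * window d <= tau%:R.
Proof.
move=> d0 f0 bv sw; have [p0 Hp] := prime_box_bound f0 bv sw.
(* The largest upper cut allowed by [prime_box_bound]; the subtraction is exact for [p] at least
   [mu]. *)
pose u p := (lower_cut d p + p.+1 - mu)%N.
have H : ((#|box d p (u p)|)%:R - (#|box d p (lower_cut d p)|)%:R) / p%:R ^+ d @[p --> \oo] --> window d.
  by apply: (@window_cvg d (mu + 1)) => // p; rewrite /u; split; lia.
have H' : mu%:R * (((#|box d p (u p)|)%:R - (#|box d p (lower_cut d p)|)%:R) / p%:R ^+ d)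
  @[p --> \oo] --> mu%:R * window d by apply: cvgM => //; exact: cvg_cst.
apply: (cvg_frequently_le H') => N.
have [p pN pp] := prime_above (N + p0 + mu).
exists p; first by lia.
have p0' : 0 < p%:R ^+ d :> R by rewrite exprn_gt0 // ltr0n prime_gt0.
have le0 : (p0 <= p)%N by lia.
have ut : (u p + mu <= lower_cut d p + p.+1)%N by rewrite /u; lia.
have := Hp p pp le0 _ _ ut; rewrite -(ler_nat R) natrD !natrM natrX => h.
rewrite mulrA ler_pdivrMr // mulrBr lerBlDr [tau%:R * _]mulrC; exact: h.
Qed.

End Window.

(** * The strong Lefschetz property *)

Section LinearForm.
Variables (d : nat) (K : numFieldType) (a : nat).
Local Notation R := (fps d K).

Definition sumX : R := \sum_i fps_X K i.

Definition homog (n : nat) (h : R) := forall m : multinom d, mdeg m != n -> fcoef h m = 0.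

Definition box_ideal : set R := [set h : R | forall m : multinom d, (forall i, m i < a)%N -> fcoef h m = 0].

(** In each variable [x^k] goes to [k (a - k) x^(k-1)]: the lowering operator of the irreducible
    [sl2]-module of dimension [a]. The factor vanishes at [k = a], so the operator preserves
    [box_ideal]. *)
Definition lowering (h : R) : R :=
  \sum_i ((a%:R - 1) *: fps_deriv i h - fps_X K i * fps_deriv i (fps_deriv i h)).

Lemma sumX_ord : ordge 1 sumX.
Proof. by apply: ordge_sum => i _; exact: ordge_X. Qed.

Lemma box_ideal_ideal : ideal box_ideal.
Proof.
split=> [m _|x y hx hy m hm|x y hy m hm]; first exact: fcoef0.
  by rewrite fcoefD hx // hy // addr0.
rewrite fcoefM big1 // => k lk; rewrite hy ?mulr0 // => i.
by rewrite mnmBE; apply: leq_ltn_trans (hm i); exact: leq_subr.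
Qed.

Lemma homogD n x y : homog n x -> homog n y -> homog n (x + y).
Proof. by move=> hx hy m nm; rewrite fcoefD hx // hy // addr0. Qed.

Lemma homogZ n c x : homog n x -> homog n (c *: x).
Proof. by move=> hx m nm; rewrite fcoefZ hx // mulr0. Qed.

Lemma homog_sum n T (r : seq T) (P : pred T) (F : T -> R) :
  (forall t, P t -> homog n (F t)) -> homog n (\sum_(t <- r | P t) F t).
Proof. by move=> H; apply: big_ind => // x y; exact: homogD. Qed.

Lemma homogM n n' x y : homog n x -> homog n' y -> homog (n + n') (x * y).
Proof.
move=> hx hy m nm; rewrite fcoefM big1 // => k lk.
have [dk|dk] := eqVneq (mdeg k) n; last by rewrite hx ?mul0r.
rewrite hy ?mulr0 //; apply: contra nm => /eqP dm.
by rewrite -(mdeg_sub lk) dm dk addnC.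
Qed.

Lemma homog_mon m : homog (mdeg m) (fmon K m).
Proof. by move=> k nk; rewrite fcoef_mon; case: (eqVneq k m) nk => // ->; rewrite eqxx. Qed.

Lemma homog_sumX : homog 1 sumX.
Proof. by apply: homog_sum => i _; have := @homog_mon (mnm1 i); rewrite mdeg1. Qed.

Lemma homog_sumXn n : homog n (sumX ^+ n).
Proof.
elim: n => [|n IH]; last by rewrite exprS; apply: (homogM homog_sumX).
by move=> m; rewrite expr0 fcoef1 mdeg_eq0; case: eqP.
Qed.

Lemma homog_ordge n h : homog n h -> ordge n h.
Proof. by move=> H m lt; apply: H; rewrite ltn_eqF. Qed.

Lemma euler n h : homog n h -> \sum_i fps_X K i * fps_deriv i h = n%:R *: h.
Proof.
move=> H; apply/fpsP => m; rewrite fcoef_sum fcoefZ.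
have E i : fcoef (fps_X K i * fps_deriv i h) m = (m i)%:R * fcoef h m.
  rewrite fcoef_XM; case: posnP => [->|m0]; first by rewrite mul0r.
  rewrite fcoef_deriv submK ?lep1mP -?lt0n // mnmBE mnm1E eqxx subn1 prednK //.
  by rewrite mulr_natl.
rewrite (eq_bigr _ (fun i _ => E i)) -mulr_suml -natr_sum -mdegE.
by have [->|/H ->] := eqVneq (mdeg m) n; rewrite ?mulr0.
Qed.

Lemma fcoef_lowering h m : fcoef (lowering h) m =
  \sum_i (m i).+1%:R * (a%:R - (m i).+1%:R) * fcoef h (mnm_add m (mnm1 i)).
Proof.
rewrite fcoef_sum; apply: eq_bigr => i _; rewrite fcoefB fcoefZ fcoef_deriv fcoef_XM.
have -> : (if (0 < m i)%N then fcoef (fps_deriv i (fps_deriv i h)) (mnm_sub m (mnm1 i)) else 0) =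
    (m i)%:R * ((m i).+1%:R * fcoef h (mnm_add m (mnm1 i))).
  case: posnP => [->|m0]; first by rewrite mul0r.
  rewrite !fcoef_deriv submK ?lep1mP -?lt0n // mnmBE mnm1E eqxx subn1 prednK //.
  by rewrite !mulr_natl.
rewrite -[X in (a%:R - 1) * X](mulr_natl _ (m i).+1) -addn1 natrD; ring.
Qed.

Lemma lowering_box h : box_ideal h -> box_ideal (lowering h).
Proof.
move=> hh m hm; rewrite fcoef_lowering big1 // => i _.
have := hm i; rewrite leq_eqVlt => /orP[/eqP <-|lt]; first by rewrite subrr mulr0 mul0r.
rewrite hh ?mulr0 // => j; rewrite mnmDE mnm1E.
by case: eqP => [<-|_]; rewrite ?addn1 ?addn0.
Qed.

Lemma lowering_homog n h : homog n.+1 h -> homog n (lowering h).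
Proof.
move=> H m nm; rewrite fcoef_lowering big1 // => i _; rewrite H ?mulr0 //.
by rewrite mdegD mdeg1 addn1 eqSS.
Qed.

Lemma lowering_homog0 h : homog 0 h -> lowering h = 0.
Proof.
move=> H; apply/fpsP => m; rewrite fcoef_lowering fcoef0 big1 // => i _.
by rewrite H ?mulr0 // mdegD mdeg1 addn1.
Qed.

Lemma deriv_sumX i h : fps_deriv i (sumX * h) = h + sumX * fps_deriv i h.
Proof.
rewrite fps_derivM; congr (_ + _).
rewrite /sumX (big_morph _ (fps_derivD i) (_ : fps_deriv i 0 = 0)); last first.
  by apply/fpsP => m; rewrite fcoef_deriv fcoef0 mul0rn.
rewrite (bigD1 i) //= fps_derivX eqxx big1 ?addr0 ?mul1r // => j nj.
by rewrite fps_derivX eq_sym (negbTE nj).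
Qed.

Lemma deriv_identity (S : comNzRingType) (c x s h D DD : S) :
  c * (h + s * D) - x * (D + (D + s * DD)) = s * (c * D - x * DD) + (c * h - (x * D) *+ 2).
Proof. ring. Qed.

(** The commutator relation of [sl2]: raising and lowering commute up to the weight
    [d (a - 1) - 2 n]. *)
Lemma lowering_sumX n h : homog n h ->
  lowering (sumX * h) = sumX * lowering h + (d%:R * (a%:R - 1) - 2 * n%:R) *: h.
Proof.
move=> hh; rewrite /lowering.
have E i : (a%:R - 1) *: fps_deriv i (sumX * h) - fps_X K i * fps_deriv i (fps_deriv i (sumX * h)) =
   sumX * ((a%:R - 1) *: fps_deriv i h - fps_X K i * fps_deriv i (fps_deriv i h)) +
   ((a%:R - 1) *: h - (fps_X K i * fps_deriv i h) *+ 2).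
  have [c Z] : exists c : R, forall u : R, (a%:R - 1) *: u = c * u.
    by exists (a%:R - 1)%:A => u; rewrite mulr_algl.
  by rewrite !deriv_sumX fps_derivD deriv_sumX !Z; exact: deriv_identity.
rewrite (eq_bigr _ (fun i _ => E i)) big_split /= -mulr_sumr; congr (_ + _).
rewrite sumrB sumrMnl (euler hh) sumr_const card_ord.
have Mn c (x : R) k : (c *: x) *+ k = (k%:R * c) *: x by rewrite -scalerA scaler_nat.
by rewrite !Mn -scalerBl.
Qed.

Lemma lowering_sumXn k n h : homog n h -> lowering (sumX ^+ k.+1 * h) =
  sumX ^+ k.+1 * lowering h + (k.+1%:R * (d%:R * (a%:R - 1) - 2 * n%:R - k%:R)) *: (sumX ^+ k * h).
Proof.
move=> hh; elim: k => [|k IH]; first by rewrite expr1 expr0 !mul1r (lowering_sumX hh) subr0.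
rewrite exprS -mulrA (lowering_sumX (homogM (@homog_sumXn k.+1) hh)) IH mulrDr mulrA -addrA; congr (_ + _).
rewrite -scalerAr mulrA -exprS -scalerDl; congr (_ *: _).
by rewrite natrD -[k.+2]addn1 -[k.+1]addn1 !natrD; ring.
Qed.

(** If [y] is killed by the lowering operator, that operator sends [sumX^(k+1) y] to [sumX^k y]
    times [(k+1) (d (a-1) - 2j - k)], a scalar that the degree bound makes nonzero. *)
Lemma lefschetz_step j k y : (0 < a)%N -> homog j y -> (2 * j + k < d * a.-1)%N ->
  box_ideal (lowering y) -> box_ideal (sumX ^+ k.+1 * y) -> box_ideal (sumX ^+ k * y).
Proof.
move=> a0 hy le Fy By; have idB := box_ideal_ideal.
have H := idealB idB (lowering_box By) (idealM idB (sumX ^+ k.+1) Fy).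
rewrite (lowering_sumXn k hy) addrAC subrr add0r in H; set c := (X in X *: _) in H.
have c0 : c != 0.
  rewrite mulf_neq0 ?pnatr_eq0 // gt_eqF //.
  have : (2 * j + k)%:R < (d * a.-1)%:R :> K by rewrite ltr_nat.
  have -> : (d * a.-1)%:R = d%:R * (a%:R - 1) :> K by rewrite natrM -subn1 natrB.
  by rewrite natrD natrM -subr_gt0 opprD addrA.
by have := subspZ (ideal_subsp idB) c^-1 H; rewrite scalerA mulVf // scale1r.
Qed.

(* [sumX], [lowering] and the degree generate [sl2] on the quotient by [box_ideal]. *)
Lemma lefschetz_inj j k y : (0 < a)%N -> homog j y -> (2 * j + k <= d * a.-1)%N ->
  box_ideal (sumX ^+ k * y) -> box_ideal y.
Proof.
move=> a0; have idB := box_ideal_ideal.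
elim: j k y => [|j IHj] k y hy; elim: k => [|k IHk] le;
  rewrite ?expr0 ?mul1r // => By; apply: IHk; try lia.
- apply: (lefschetz_step a0 hy) By; first by lia.
  by rewrite lowering_homog0 //; exact: ideal0.
- apply: (lefschetz_step a0 hy) (By); first by lia.
  (* Lowering [sumX^(k+2) y] leaves [sumX^(k+2)] times [lowering y] up to a multiple of
     [sumX^(k+1) y], which is in the ideal. The degree has dropped by one and the exponent grown by
     one, so the bound still holds. *)
  apply: (IHj k.+2 _ (lowering_homog hy)); first by lia.
  have := lowering_box (idealM idB sumX By); rewrite mulrA -exprS (lowering_sumXn k.+1 hy) => H.
  have H' := subspZ (ideal_subsp idB) (k.+2%:R * (d%:R * (a%:R - 1) - 2 * j.+1%:R - k.+1%:R)) By.
  by have := idealB idB H H'; rewrite addrK.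
Qed.

End LinearForm.

(** * Lefschetz maps between slices of the box *)

Section Slices.
Variables (d a : nat).
Hypothesis a0 : (0 < a)%N.
Local Notation top := (d * a.-1)%N.

Definition slice n : {set {ffun 'I_d -> 'I_a}} := [set x : {ffun 'I_d -> 'I_a} | (\sum_i (x i : nat))%N == n].

Lemma card_boxS u : #|box d a u.+1| = (#|box d a u| + #|slice u|)%N.
Proof.
rewrite -(cardsID (box d a u) (box d a u.+1)); congr (_ + _)%N; apply: eq_card => x; rewrite !inE.
  by rewrite ltnS andb_idl // => /ltnW.
by rewrite -leqNgt ltnS eqn_leq andbC.
Qed.

Lemma card_box_slice u : #|box d a u| = (\sum_(n < u) #|slice n|)%N.
Proof.
elim: u => [|u IH]; last by rewrite card_boxS IH big_ord_recr.
by rewrite big_ord0; apply: eq_card0 => x; rewrite inE.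
Qed.

Lemma slice_le (x : {ffun 'I_d -> 'I_a}) : (\sum_i (x i : nat) <= top)%N.
Proof.
rewrite -[X in (_ <= X * _)%N](card_ord d) -sum_nat_const; apply: leq_sum => i _.
by rewrite -ltnS prednK.
Qed.

Lemma card_slice_gt n : (top < n)%N -> #|slice n| = 0%N.
Proof.
move=> lt; apply: eq_card0 => x; rewrite inE; apply/eqP => e.
by have := slice_le x; rewrite e leqNgt lt.
Qed.

Lemma card_slice_sym n : (n <= top)%N -> #|slice (top - n)%N| = #|slice n|.
Proof.
pose rv (x : {ffun 'I_d -> 'I_a}) : {ffun 'I_d -> 'I_a} := [ffun i => rev_ord (x i)].
have rvK : involutive rv by move=> x; apply/ffunP => i; rewrite !ffunE rev_ordK.
have rv_sum x : (\sum_i (rv x i : nat) = top - \sum_i (x i : nat))%N.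
  apply/eqP; rewrite -(eqn_add2r (\sum_i (x i : nat))%N) subnK ?slice_le // -big_split /=.
  apply/eqP; rewrite -[X in (X * _)%N](card_ord d) -sum_nat_const; apply: eq_bigr => i _.
  by rewrite ffunE /= subnS -subn1; have := ltn_ord (x i); lia.
have le k : (k <= top)%N -> (#|slice k| <= #|slice (top - k)%N|)%N.
  move=> ktop; rewrite -(card_imset _ (inv_inj rvK)); apply: subset_leq_card.
  by apply/fintype.subsetP => _ /imsetP[x + ->]; rewrite !inE rv_sum => /eqP ->.
move=> ntop; apply/eqP; rewrite eqn_leq le // andbT.
by have := le (top - n)%N (leq_subr _ _); rewrite subKn.
Qed.

Variable K : numFieldType.
Local Notation R := (fps d K).
Local Notation ell := (sumX d K).
Local Notation boxI := (@box_ideal d K a).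

Definition slice_mon n (i : 'I_#|slice n|) : R := fmon K (box_mon (enum_val i)).

Definition crow n (h : R) : 'rV[K]_#|slice n| := \row_i fcoef h (box_mon (enum_val i)).

Definition slice_poly n (r : 'rV[K]_#|slice n|) : R := \sum_i r ord0 i *: slice_mon i.

Definition lefschetz_mx j n : 'M[K]_(#|slice j|, #|slice n|) :=
  \matrix_(i, k) crow n (ell ^+ (n - j) * slice_mon i) ord0 k.

Lemma mdeg_slice n (i : 'I_#|slice n|) : mdeg (box_mon (enum_val i)) = n.
Proof. by rewrite mdeg_box_mon; have := enum_valP i; rewrite inE => /eqP. Qed.

Lemma slice_poly_homog n r : homog n (@slice_poly n r).
Proof.
apply: homog_sum => i _; apply: homogZ; rewrite -[X in homog X](mdeg_slice i).
exact: (@homog_mon d K).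
Qed.

Lemma slice_polyD n r s : @slice_poly n (r + s) = slice_poly r + slice_poly s.
Proof. by rewrite -big_split; apply: eq_bigr => i _; rewrite mxE scalerDl. Qed.

Lemma fcoef_slice_poly n r (i : 'I_#|slice n|) : fcoef (slice_poly r) (box_mon (enum_val i)) = r ord0 i.
Proof.
rewrite fcoef_sum (bigD1 i) //= fcoefZ fcoef_mon eqxx mulr1 big1 ?addr0 // => k nk.
rewrite fcoefZ fcoef_mon; case: eqP => [/box_mon_inj/enum_val_inj e|_]; last by rewrite mulr0.
by rewrite e eqxx in nk.
Qed.

Lemma crow_poly n r : crow n (slice_poly r) = r.
Proof. by apply/rowP => i; rewrite mxE fcoef_slice_poly. Qed.

Lemma crowP n h : homog n h -> boxI (h - slice_poly (crow n h)).
Proof.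
move=> hh m hm; have [x xm] := box_monP hm; rewrite fcoefB.
have [dm|dm] := eqVneq (mdeg m) n; last by rewrite hh // slice_poly_homog // subrr.
have xs : x \in slice n by rewrite inE -mdeg_box_mon xm dm.
rewrite -xm -(enum_rankK_in xs xs) fcoef_slice_poly mxE subrr //.
Qed.

Lemma crow_box n h h' : boxI (h - h') -> crow n h = crow n h'.
Proof.
move=> H; apply/rowP => i; rewrite !mxE; apply/eqP; rewrite -subr_eq0 -fcoefB H // => k.
by rewrite box_monE.
Qed.

Lemma crow0 n h : homog n h -> crow n h = 0 -> boxI h.
Proof.
move=> hh E; have := crowP hh; rewrite E (_ : slice_poly 0 = 0) ?subr0 //.
by rewrite /slice_poly big1 // => i _; rewrite mxE scale0r.
Qed.

Lemma crow_sumXn j n h : homog j h -> crow n (ell ^+ (n - j) * h) = crow j h *m lefschetz_mx j n.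
Proof.
move=> hh; have idB := box_ideal_ideal d K a.
rewrite (@crow_box n _ (ell ^+ (n - j) * slice_poly (crow j h))); last first.
  by rewrite -mulrBr; apply: (idealM idB); exact: crowP.
apply/rowP => k; rewrite !mxE mulr_sumr fcoef_sum; apply: eq_bigr => i _.
by rewrite -scalerAr fcoefZ !mxE.
Qed.

Lemma lefschetz_mx_free j n : (j <= n)%N -> (j + n <= top)%N -> row_free (lefschetz_mx j n).
Proof.
move=> jn le; apply: inj_row_free => r r0.
have hr := @slice_poly_homog j r.
have : boxI (ell ^+ (n - j) * slice_poly r).
  apply: (@crow0 n); last by rewrite crow_sumXn // crow_poly.
  by rewrite -[n in homog n](subnK jn); apply: homogM => //; exact: homog_sumXn.
move/(lefschetz_inj a0 hr) => H.
rewrite -[r]crow_poly; apply/rowP => i; rewrite !mxE H //; first by lia.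
by move=> k; rewrite box_monE.
Qed.

(** The map from degree [top - n] to degree [n] is bijective, by injectivity and the symmetry of the
    slices, and it factors through degree [j]. *)
Lemma lefschetz_mx_full j n : (j <= n)%N -> (top <= j + n)%N -> row_full (lefschetz_mx j n).
Proof.
move=> jn le; rewrite /row_full eqn_leq rank_leq_col /=.
have [lt|ntop] := ltnP top n; first by rewrite [X in (X <= _)%N]card_slice_gt.
have nj : (top - n <= j)%N by lia.
have E : lefschetz_mx (top - n)%N n = lefschetz_mx (top - n)%N j *m lefschetz_mx j n.
  apply/row_matrixP => i; rewrite row_mul.
  have rowE k : row i (lefschetz_mx (top - n)%N k) = crow k (ell ^+ (k - (top - n))%N * slice_mon i).
    by apply/rowP => l; rewrite !mxE.
  have hi : homog (top - n)%N (slice_mon i).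
    by rewrite -[X in homog X](mdeg_slice i); exact: (@homog_mon d K).
  rewrite !rowE -crow_sumXn; last first.
    by rewrite -[j in homog j](subnK nj); apply: homogM => //; exact: homog_sumXn.
  by rewrite mulrA -exprD; congr (crow _ (_ ^+ _ * _)); lia.
apply: leq_trans (mxrankM_maxr (lefschetz_mx (top - n)%N j) _); rewrite -E.
have /eqP -> : row_free (lefschetz_mx (top - n)%N n) by apply: lefschetz_mx_free; lia.
by rewrite card_slice_sym.
Qed.

End Slices.

(** * The extremal family *)

Lemma sub_multinom d n (m : multinom d) : (n <= mdeg m)%N -> exists2 k, lem k m & mdeg k = n.
Proof.
move=> le; have [j E] : exists j, mdeg m = (j + n)%N by exists (mdeg m - n)%N; rewrite subnK.
elim: j m E {le} => [|j IH] m' E; first by exists m' => //; apply/mnm_lepP => i.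
have [i mi] : exists i, (0 < m' i)%N.
  apply/existsP; apply: contraT => /existsPn H.
  have : mdeg m' = 0%N by rewrite mdegE big1 // => i _; apply/eqP; rewrite -leqn0 leqNgt H.
  by move: E; lia.
have li : lem (mnm1 i) m' by rewrite lep1mP -lt0n.
have [|k lk dk] := IH (mnm_sub m' (mnm1 i)); first by have := mdeg_sub li; rewrite mdeg1; lia.
exists k => //; apply/mnm_lepP => l; move/mnm_lepP/(_ l): lk; rewrite mnmBE; lia.
Qed.

(** Each monomial of degree at least [n] is charged to one chosen divisor of degree [n]; the
    cofactors keep any excess of order. *)
Lemma ordge_monomials d (A : comNzRingType) n (h : fps d A) : ordge n h ->
  exists s : bmultinom d n.+1 -> fps d A,
    (forall j, ordge (n + j) h -> forall k, ordge j (s k)) /\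
    h = \sum_(k : bmultinom d n.+1 | mdeg k == n) s k * fmon A k.
Proof.
move=> oh.
have sub_n (m : multinom d) : exists k : bmultinom d n.+1,
    (n <= mdeg m)%N -> lem k m /\ mdeg k = n.
  have [/sub_multinom [k lk dk]|lt] := leqP n (mdeg m).
    have lt : (mdeg k < n.+1)%N by rewrite dk.
    by exists (BMultinom lt).
  by exists (@bm0 d n).
have [kk Hkk] := choice sub_n.
pose s (k : bmultinom d n.+1) : fps d A :=
  Fps (fun m => if kk (mnm_add m k) == k then fcoef h (mnm_add m k) else 0).
exists (fun k : bmultinom d n.+1 => if mdeg k == n then s k else 0); split=> [j oj k|].
  case: eqP => [dk|_]; last exact: ordge_0.
  move=> m lt; rewrite /s fcoefE; case: ifP => // _; apply: oj.
  by rewrite mdegD dk addnC ltn_add2l.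
apply/fpsP => m; rewrite fcoef_sum.
rewrite (eq_bigr (fun k : bmultinom d n.+1 => if lem k m && (kk m == k) then fcoef h m else 0)); last first.
  move=> k dk; rewrite dk mulrC fcoef_monM; case: ifP => // lk.
  by rewrite /s fcoefE submK.
have [le|lt] := leqP n (mdeg m); last first.
  rewrite (oh m lt) big1 // => k /eqP dk; rewrite ifF //; apply/negP => /andP[/lem_mdeg + _].
  by rewrite dk leqNgt lt.
have [lk dk] := Hkk m le.
rewrite (bigD1 (kk m)) /= ?dk ?eqxx // lk big1 ?addr0 // => k /andP[_ nk].
by rewrite eq_sym (negbTE nk) andbF.
Qed.

(** Nakayama for the [n]-th power of the maximal ideal, generated by the monomials of degree [n];
    the generators [y] of lower degree are set to 0. *)
Lemma ordge_nakayama d (K : fieldType) (I : set (fps d K)) n : ideal I ->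
    (forall h, ordge n h -> exists2 h', ordge n.+1 h' & I (h - h')) ->
  forall h, ordge n h -> I h.
Proof.
move=> idI H h oh.
pose T : finType := bmultinom d n.+1.
pose y (l : 'I_#|T|) : fps d K := if mdeg (enum_val l : T) == n then fmon K (enum_val l : T) else 0.
have dec j h' : ordge (n + j) h' -> exists s : 'I_#|T| -> fps d K,
    (forall k, ordge j (s k)) /\ h' = \sum_k s k * y k.
  move=> oh'; have [s [os E]] := ordge_monomials (ordgeW (leq_addr j n) oh').
  exists (fun k => s (enum_val k : T)); split=> [k|]; first exact: os.
  rewrite {1}E big_mkcond (reindex _ (onW_bij _ (enum_val_bij T))) /=.
  by apply: eq_bigr => k _; rewrite /y; case: ifP; rewrite ?mulr0.
have Iy : forall l, I (y l).
  apply: nakayama => // l; have oy : ordge n (y l).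
    rewrite /y; case: eqP => [dl|_]; last exact: ordge_0.
    by have := @ordge_mon d K (enum_val l : T); rewrite dl.
  have [h' oh' Ih'] := H _ oy.
  have [|s [os E]] := dec 1%N h'; first by rewrite addn1.
  by exists s; split=> //; rewrite -E.
have [|s [_ ->]] := dec 0%N h; first by rewrite addn0.
by apply: (ideal_sum idI) => k _; exact: idealM.
Qed.

(** * A lower bound for the Milnor number *)

Section MilnorLowerBound.
Variables (d : nat) (K : fieldType) (a mu : nat) (g : 'I_d -> fps d K) (v : 'I_mu -> fps d K).
Hypotheses (ga : forall i, ordge a (g i)) (sv : spans (idl g) v).
Local Notation R := (fps d K).

Definition simplex n := {x | x \in box d n n}.

Lemma simplex_ex n (m : multinom d) : (mdeg m < n)%N -> exists x : simplex n, box_mon (val x) = m.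
Proof.
move=> lt; have [|x xm] := @box_monP d n m.
  by move=> i; apply: leq_ltn_trans lt; exact: mnm1_le_deg.
have xb : x \in box d n n by rewrite inE -mdeg_box_mon xm.
by exists (exist _ x xb).
Qed.

Lemma simplex_lt n (x : simplex n) : (mdeg (box_mon (val x)) < n)%N.
Proof. by rewrite mdeg_box_mon; have := valP x; rewrite inE. Qed.

(** Iterated division by [g]: after [n] rounds the remaining terms carry [n] factors [g i], each of
    order [a]. *)
Lemma power_basis_spans n : spans [set h : R | ordge (n * a) h]
  (fun q : simplex n * 'I_mu => (\prod_i g i ^+ box_mon (val q.1) i) * v q.2).
Proof.
elim: n => [|n IH] h.
  by exists (fun=> 0); exact: ordge0.
pose e n (q : simplex n * 'I_mu) : R := (\prod_i g i ^+ box_mon (val q.1) i) * v q.2.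
have sO k : subsp [set h : R | ordge k h] := ideal_subsp (ordge_ideal d K k).
have sU := span_mod_subsp (e n.+1) (sO (n.+1 * a)%N).
suff : span_mod [set h : R | ordge (n.+1 * a) h] (e n.+1) h by [].
have mem (m : multinom d) j : (mdeg m < n.+1)%N ->
    span_mod [set h : R | ordge (n.+1 * a) h] (e n.+1) ((\prod_i g i ^+ m i) * v j).
  move=> lt; have [x <-] := simplex_ex lt.
  exact: (span_mod_gen (e n.+1) (sO _) (x, j)).
have [c [b E]] := sv h.
rewrite -[h](subrK (\sum_t c t *: v t)) E; apply: (subspD sU); last first.
  apply: (subsp_sum sU) => j _; apply: (subspZ sU).
  have := @mem (@mnm0 d) j; rewrite mdeg0 big1 ?mul1r; first by apply.
  by move=> i _; rewrite mnm0E expr0.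
apply: (subsp_sum sU) => i _; have [c' hc'] := IH (b i).
rewrite -[b i](subrK (\sum_t c' t *: e n t)) mulrDl; apply: (subspD sU).
  by apply: span_mod_sub; rewrite /= mulSn addnC; apply: ordgeM.
rewrite mulr_suml; apply: (subsp_sum sU) => q _; rewrite -scalerAl; apply: (subspZ sU).
have := @mem (mnm_add (box_mon (val q.1)) (mnm1 i)) q.2.
rewrite mdegD mdeg1 addn1 ltnS => /(_ (simplex_lt _)).
rewrite [X in _ X -> _](_ : _ = e n q * g i) //.
rewrite /e mulrAC; congr (_ * _).
under eq_bigr do rewrite mnmDE exprD; rewrite big_split; congr (_ * _).
rewrite (bigD1 i) //= mnm1E eqxx expr1 big1 ?mulr1 // => k nk.
by rewrite mnm1E eq_sym (negbTE nk).
Qed.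

Lemma simplex_indep n : indep [set h : R | ordge n h] (fun x : simplex n => fmon K (box_mon (val x))).
Proof.
move=> c H x; have := H _ (simplex_lt x).
rewrite fcoef_sum (bigD1 x) //= fcoefZ fcoef_mon eqxx mulr1 big1 ?addr0 // => y ny.
rewrite fcoefZ fcoef_mon; case: eqP => [/box_mon_inj/val_inj e|_]; last by rewrite mulr0.
by rewrite e eqxx in ny.
Qed.

(** Dimensions compared modulo order [n * a]. Both counts grow like [n^d / d!] times a constant, and
    the leading terms give [a^d <= mu]. *)
Lemma simplex_count n : (#|box d (n * a) (n * a)| <= #|box d n n| * mu)%N.
Proof.
have := indep_le_spans (ideal_subsp (ordge_ideal d K (n * a)%N)) (@simplex_indep (n * a)%N)
  (@power_basis_spans n).
by rewrite card_prod !card_sig card_ord.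
Qed.

End MilnorLowerBound.

Lemma card_simplex d n : (0 < d)%N -> #|box d n n| = cone_count d n.
Proof.
move=> d0; apply/eqP; rewrite -(eqr_nat int) card_boxE big_ord_recl mul0n subn0 bin0 expr0 !mul1r.
rewrite big1 ?addr0 // => i _; rewrite (_ : n - _ = 0)%N ?mulr0 //.
by rewrite /= /bump /= add1n mulSn; lia.
Qed.

(* [F] only provides the limits. *)
Lemma pow_le_milnor (F : realType) d (K : fieldType) a mu (g : 'I_d -> fps d K) (v : 'I_mu -> fps d K) :
  (0 < d)%N -> (forall i, ordge a (g i)) -> spans (idl g) v -> (a ^ d <= mu)%N.
Proof.
move=> d0 ga sv; suff : - (mu%:R : F) <= - (a ^ d)%:R by rewrite lerN2 ler_nat.
have H : \prod_(j < d) (1 + j%:R / n%:R) @[n --> \oo] --> (\prod_(j < d) (1 + 0) : F).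
  by apply: cvg_prodr => j; apply: cvgD; [exact: cvg_cst | exact: cvg_const_inv].
have {}H : - (mu%:R * \prod_(j < d) (1 + j%:R / n%:R)) @[n --> \oo] --> - (mu%:R : F).
  apply: cvgN; rewrite -[X in _ --> X]mulr1; apply: cvgM; first exact: cvg_cst.
  by rewrite addr0 prodr_const expr1n in H.
apply: (cvg_frequently_le H) => N; exists N.+1 => //; rewrite lerN2.
have := simplex_count ga sv N.+1; rewrite !card_simplex //.
rewrite -(leq_pmul2r (fact_gt0 d)) mulnAC !cone_count_prod // -(ler_nat F) natrM !natr_prod => h.
have p0 : 0 < N.+1%:R ^+ d :> F by rewrite exprn_gt0 // ltr0n.
rewrite -(ler_pM2r p0) -mulrA.
have -> : \prod_(j < d) (1 + j%:R / N.+1%:R) * N.+1%:R ^+ d = \prod_(j < d) (N.+1 + j)%:R :> F.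
  rewrite -[X in _ ^+ X](card_ord d) -prodr_const -big_split; apply: eq_bigr => j _ /=.
  by rewrite mulrDl mul1r divfK ?pnatr_eq0 // natrD.
rewrite mulrC in h; apply: le_trans h; rewrite -natrX -natrM -expnMn -natr_prod ler_nat.
rewrite -[X in (_ ^ X <= _)%N](card_ord d) -prod_nat_const; apply: leq_prod => j _.
by rewrite mulnC leq_addr.
Qed.

Lemma fps_derivXn d (A : comNzRingType) i (x : fps d A) n :
  fps_deriv i (x ^+ n.+1) = (x ^+ n * fps_deriv i x) *+ n.+1.
Proof.
elim: n => [|n IH]; first by rewrite expr1 expr0 mul1r.
by rewrite exprS fps_derivM IH mulrnAr mulrA -exprS [fps_deriv i x * _]mulrC -mulrS.
Qed.

(** * Jacobian and Tjurina ideals of the family *)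

Section Family.
Variables (d : nat) (K : numFieldType) (a : nat).
Hypothesis a0 : (0 < a)%N.
Local Notation R := (fps d K).
Local Notation ell := (sumX d K).
Local Notation boxI := (@box_ideal d K a).

(** The Fermat part alone is homogeneous, so its Milnor and Tjurina numbers agree. A term of higher
    degree separates them, and a power of a linear form is one to which the strong Lefschetz
    property applies. *)
Definition family : R := \sum_i fps_X K i ^+ a.+1 + ell ^+ a.+2.

Local Notation df := (fun i => fps_deriv i family).
Local Notation J := (idl df).
Local Notation I := (idl (fcons family df)).

Lemma fps_deriv_sum i T (r : seq T) (P : pred T) (F : T -> R) :
  fps_deriv i (\sum_(t <- r | P t) F t) = \sum_(t <- r | P t) fps_deriv i (F t).
Proof.
apply: (big_morph _ (fps_derivD i)).
by apply/fpsP => m; rewrite fcoef_deriv fcoef0 mul0rn.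
Qed.

Lemma family_deriv i : fps_deriv i family = fps_X K i ^+ a *+ a.+1 + ell ^+ a.+1 *+ a.+2.
Proof.
rewrite /family fps_derivD fps_deriv_sum (bigD1 i) //= big1 ?addr0.
  rewrite !fps_derivXn fps_derivX eqxx mulr1; congr (_ + _ *+ _).
  have := deriv_sumX i (1 : R); rewrite fps_deriv1 mulr0 addr0 mulr1 => ->.
  by rewrite mulr1.
by move=> j nj; rewrite fps_derivXn fps_derivX eq_sym (negbTE nj) mulr0 mul0rn.
Qed.

Lemma family_deriv_ordge i : ordge a (fps_deriv i family).
Proof.
rewrite family_deriv; apply: ordgeD; rewrite -scaler_nat; apply: ordgeZ.
  by apply: ordgeXn; exact: ordge_X.
by apply: (ordgeW (leqnSn a)); apply: ordgeXn; exact: sumX_ord.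
Qed.

Lemma jacobian_sub_tjurina : J `<=` I.
Proof.
apply: idl_min => [|i]; first exact: idl_ideal.
by have := idl_mem (fcons family df) (lift ord0 i); rewrite fconsS.
Qed.

(** By Euler's formula, [sum_i x_i f_i - (a+1) f] cancels the part of degree [a+1] and leaves the
    other term once. *)
Lemma family_sumX : I (ell ^+ a.+2).
Proof.
have idI := idl_ideal (fcons family df).
have If : I family by have := idl_mem (fcons family df) ord0; rewrite fcons0.
have E : \sum_i fps_X K i * df i - family *+ a.+1 = ell ^+ a.+2.
  rewrite (eq_bigr (fun i => fps_X K i ^+ a.+1 *+ a.+1 + (fps_X K i * ell ^+ a.+1) *+ a.+2)); last first.
    by move=> i _; rewrite family_deriv mulrDr !mulrnAr -exprS.
  rewrite big_split /= !sumrMnl -mulr_suml -exprS /family mulrnDl opprD addrACA subrr add0r.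
  by rewrite -mulrnBr // subSn // subnn.
rewrite -E; apply: (idealB idI).
  apply: (ideal_sum idI) => i _; apply: (idealM idI); apply: jacobian_sub_tjurina; exact: (idl_mem df).
by rewrite -mulr_natl; apply: (idealM idI).
Qed.

(* Modulo the Jacobian ideal, [fps_X i ^+ a] is a multiple of [ell ^+ a.+1]. *)
Lemma box_ideal_reduce n (q : R) : boxI q -> ordge n q -> exists2 q', ordge n.+1 q' & J (q - q').
Proof.
move=> Bq oq; have idJ := idl_ideal df.
have [m Hm|u [qE [ou _]]] := @mono_decomp d K xpredT a q.
  by apply: Bq => i; exact: Hm.
have na : (a.+1)%:R != 0 :> K by rewrite pnatr_eq0.
exists (\sum_i (- (a.+1%:R^-1 * a.+2%:R)) *: (ell ^+ a.+1 * u i)).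
  apply: ordge_sum => i _; apply: ordgeZ; apply: (@ordgeW _ _ (a.+1 + (n - a))); first by lia.
  by apply: ordgeM; [apply: ordgeXn; exact: sumX_ord | exact: ou].
rewrite qE -sumrB; apply: (ideal_sum idJ) => i _.
have -> : fps_X K i ^+ a * u i - - (a.+1%:R^-1 * a.+2%:R) *: (ell ^+ a.+1 * u i) = (a.+1%:R^-1 *: u i) * df i.
  have cu : (a.+1%:R^-1 *: u i) *+ a.+1 = u i by rewrite -scaler_nat scalerA mulfV // scale1r.
  have -> : (a.+1%:R^-1 *: u i) * df i = u i * fps_X K i ^+ a + (a.+1%:R^-1 *: u i) * ell ^+ a.+1 *+ a.+2.
    by rewrite -{2}cu family_deriv mulrDr !mulrnAr mulrnAl.
  rewrite [X in X - _]mulrC scaleNr opprK; congr (_ + _).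
  by rewrite -scalerAl [ell ^+ _ * _]mulrC -scalerA scaler_nat scalerMnr.
by apply: (idealM idJ); exact: (idl_mem df).
Qed.

Lemma family_ordge h : ordge (d * a).+1 h -> J h.
Proof.
apply: (ordge_nakayama (idl_ideal df)) => {}h oh; apply: (box_ideal_reduce _ oh) => m hm.
apply: oh; rewrite ltnS mdegE -[X in (_ <= X * _)%N](card_ord d) -sum_nat_const.
by apply: leq_sum => i _; exact: ltnW.
Qed.

Local Notation top := (d * a.-1)%N.
(** Multiplication by [ell^(a+2)] into degree [n] is injective up to this degree and surjective
    beyond it, since source and target degrees add up to [2 n - (a+2)], to be compared with
    [top]. *)
Local Notation lim := ((top + a.+2)./2).

Definition lefschetz_image n : 'M[K]_(#|slice d a n|) :=
  if (a.+2 <= n)%N then <<@lefschetz_mx d a K (n - a.+2)%N n>>%MS else 0.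

Definition lefschetz_compl n := row_base (lefschetz_image n)^C%MS.

Definition complement_family (q : {n : 'I_lim.+1 & 'I_(\rank (lefschetz_image n)^C%MS)}) : R :=
  slice_poly (row (tagged q) (lefschetz_compl (tag q))).

Lemma homog_part n (h : R) : ordge n h -> exists2 h', homog n h' & ordge n.+1 (h - h').
Proof.
move=> oh; exists (Fps (fun m => if mdeg m == n then fcoef h m else 0)).
  by move=> m /negbTE nm; rewrite fcoefE nm.
move=> m; rewrite ltnS leq_eqVlt fcoefB [X in _ - X]fcoefE => /orP[->|lt]; first by rewrite subrr.
by rewrite (ltn_eqF lt) subr0 oh.
Qed.

Lemma slice_poly_sum n k (r : 'I_k -> K) (M : 'M[K]_(k, #|slice d a n|)) :
  slice_poly (\row_i r i *m M) = \sum_i r i *: slice_poly (row i M).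
Proof.
rewrite /slice_poly; under [RHS]eq_bigr do rewrite scaler_sumr.
rewrite exchange_big; apply: eq_bigr => l _; rewrite mxE scaler_suml; apply: eq_bigr => i _.
by rewrite !mxE scalerA.
Qed.

(** Modulo [box_ideal], a form of degree [n] is the sum of a multiple of [ell^(a+2)], which lies in
    [I], and an element of the chosen complement; beyond [lim] the first alone suffices. The part in
    [box_ideal] is moved to larger order modulo [J], until [family_ordge] applies. *)
Lemma family_spans : spans I complement_family.
Proof.
have idI := idl_ideal (fcons family df); have sI := ideal_subsp idI.
have idB := box_ideal_ideal d K a.
pose U := span_mod I complement_family; have sU : subsp U := span_mod_subsp _ sI.
have main j h : ordge ((d * a).+1 - j) h -> U h.
  elim: j h => [|j IH] h oh.
    by apply: span_mod_sub => //; apply: jacobian_sub_tjurina; apply: family_ordge; rewrite -[X in ordge X]subn0.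
  set n := ((d * a).+1 - j.+1)%N in oh.
  have up x : ordge n.+1 x -> U x by move=> ox; apply: IH; apply: ordgeW ox; rewrite /n; lia.
  have [h' hh' oh'] := homog_part oh.
  rewrite -[h](subrK h'); apply: (subspD sU); first exact: up.
  suff [y [hy Uy By]] : exists y, [/\ homog n y, U y & boxI (h' - y)].
    rewrite -[h'](subrK y); apply: (subspD sU) => //.
    have ohy : ordge n (h' - y) by apply: ordgeB; exact: homog_ordge.
    have [q oq Jq] := box_ideal_reduce By ohy.
    rewrite -[_ - y](subrK q); apply: (subspD sU); last exact: up.
    by apply: span_mod_sub => //; exact: jacobian_sub_tjurina.
  have image r : (r <= lefschetz_image n)%MS -> exists y, [/\ homog n y, U y & boxI (slice_poly r - y)].
    rewrite /lefschetz_image; case: ifP => [le|_]; last first.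
      rewrite submx0 => /eqP ->; exists 0; split; first by move=> m _; exact: fcoef0.
        exact: subsp0 sU.
      by rewrite subr0 /slice_poly big1 => [|i _]; [exact: ideal0 | rewrite mxE scale0r].
    rewrite genmxE => /submxP[z ->].
    exists (ell ^+ a.+2 * slice_poly z); split.
    - rewrite -[n in homog n](subnKC le); apply: homogM; first exact: homog_sumXn.
      exact: slice_poly_homog.
    - apply: span_mod_sub => //; rewrite mulrC; apply: (idealM idI); exact: family_sumX.
    have hz : homog (n - a.+2)%N (slice_poly z) by exact: slice_poly_homog.
    have hn : homog n (ell ^+ a.+2 * slice_poly z).
      by rewrite -[n in homog n](subnKC le); apply: homogM => //; exact: homog_sumXn.
    have E := @crow_sumXn d a K _ n _ hz; rewrite subKn // crow_poly in E.
    by have := @crowP d a K n _ hn; rewrite E => H; rewrite -opprB; apply: (idealN idB).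
  have crowE : boxI (h' - slice_poly (crow a n h')) by exact: crowP.
  have [nle|ngt] := leqP n lim; last first.
    have full : row_full (lefschetz_image n).
      rewrite /lefschetz_image; case: ifP => le.
        rewrite /row_full genmxE; apply: lefschetz_mx_full => //; lia.
      by rewrite /row_full mxrank0 eq_sym card_slice_gt //; lia.
    have [y [hy Uy By]] := image _ (submx_full (crow a n h') full).
    by exists y; split=> //; exact: (ideal_trans idB crowE By).
  have : (crow a n h' <= lefschetz_image n + (lefschetz_image n)^C)%MS.
    by apply: submx_full; exact: addsmx_compl_full.
  case/sub_addsmxP => -[u1 u2] /= E.
  have [y [hy Uy By]] := image _ (submxMl u1 (lefschetz_image n)).
  have /submxP[z zE] : (u2 *m (lefschetz_image n)^C <= lefschetz_compl n)%MS.
    by rewrite eq_row_base submxMl.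
  have Uz : U (slice_poly (z *m lefschetz_compl n)).
    have -> : z = \row_i z ord0 i by apply/rowP => i; rewrite mxE.
    rewrite slice_poly_sum; apply: (subsp_sum sU) => i _; apply: (subspZ sU).
    have lt : (n < lim.+1)%N by [].
    exact: (span_mod_gen complement_family sI (existT _ (Ordinal lt) i)).
  exists (y + slice_poly (z *m lefschetz_compl n)); split.
  - by apply: homogD => //; exact: slice_poly_homog.
  - exact: (subspD sU).
  apply: (ideal_trans idB crowE); rewrite E zE slice_polyD opprD addrACA subrr addr0 //.
by move=> h; apply: (main (d * a).+1); rewrite subnn; exact: ordge0.
Qed.

(** In degrees from [a+2] to [lim] the map is injective, so its rank is the size of the slice
    [n - (a+2)]; summed over [n], the ranks fill the box below [lim.+1 - a.+2]. *)
Lemma family_count :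
  (#|{: {n : 'I_lim.+1 & 'I_(\rank (lefschetz_image n)^C%MS)}}| + #|box d a (lim.+1 - a.+2)|
   <= #|box d a lim.+1|)%N.
Proof.
rewrite card_tagged sumnE big_map big_enum /=.
under eq_bigr do rewrite card_ord mxrank_compl.
rewrite [X in (_ <= X)%N]card_box_slice.
have le n : (\rank (lefschetz_image n) <= #|slice d a n|)%N := rank_leq_row _.
have -> : (\sum_(n < lim.+1) #|slice d a n| = \sum_(n < lim.+1) (#|slice d a n| - \rank (lefschetz_image n)) +
   \sum_(n < lim.+1) \rank (lefschetz_image n))%N.
  by rewrite -big_split; apply: eq_bigr => n _; rewrite /= subnK.
rewrite leq_add2l card_box_slice.
rewrite -(big_mkord xpredT (fun n => \rank (lefschetz_image n))) -(big_mkord xpredT (fun n => #|slice d a n|)).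
have [lt|ge] := ltnP lim.+1 a.+2; first by rewrite (eqP (ltnW lt)) big_geq.
rewrite [X in (_ <= X)%N](big_cat_nat (n := a.+2)) //=; apply: leq_trans (leq_addl _ _).
have := big_addn 0 lim.+1 a.+2 xpredT (fun n => \rank (lefschetz_image n)); rewrite add0n => ->.
apply: eq_leq; apply: eq_big_nat => n /andP[_ nlt].
rewrite /lefschetz_image ifT ?leq_addl // genmxE.
have /eqP -> : row_free (@lefschetz_mx d a K (n + a.+2 - a.+2)%N (n + a.+2)%N).
  by apply: lefschetz_mx_free => //; lia.
by rewrite addnK.
Qed.

End Family.

(** * Milnor and Tjurina numbers *)

Lemma has_quot_dim_ordge d (K : fieldType) (I : set (fps d K)) M :
  ideal I -> (forall h, ordge M h -> I h) -> exists k, has_quot_dim I k.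
Proof.
move=> idI H; pose T : finType := bmultinom d M.
have sp : spans I (fun i : 'I_#|T| => fmon K (enum_val i : T)).
  move=> h; exists (fun i => fcoef h (enum_val i : T)); apply: H.
  have [r or {1}->] := fps_decomp M h.
  by rewrite (reindex _ (onW_bij _ (enum_val_bij T))) /= addrAC subrr add0r.
by have [k [_ hk]] := spans_basis (ideal_subsp idI) sp; exists k.
Qed.

Lemma milnor_finite d (K : numFieldType) (f : fps d K) tau (w : 'I_tau -> fps d K) :
    ordge 1 f -> spans (idl (fcons f (fun i => fps_deriv i f))) w ->
  exists mu, has_quot_dim (idl (fun i => fps_deriv i f)) mu.
Proof.
move=> f0 sw; pose df := fun i => fps_deriv i f; have idJ := idl_ideal df.
have [k fk] := nilpotent_mod_jacobian f0 sw.
have powJ x : idl (fcons f df) x -> idl df (x ^+ k).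
  move=> [c ->]; rewrite big_ord_recl fcons0.
  have J0 : idl df (\sum_i c (lift ord0 i) * fcons f df (lift ord0 i)).
    by apply: (ideal_sum idJ) => i _; rewrite fconsS; apply: (idealM idJ); exact: idl_mem.
  apply: (ideal_eq idJ (y := (c ord0 * f) ^+ k)).
    by apply: (ideal_eqX idJ); rewrite addrAC subrr add0r.
  by rewrite exprMn; apply: (idealM idJ).
have [L HL] := fin_codim_ordge (idl_ideal (fcons f df)) sw.
apply: (has_quot_dim_ordge (M := (d * (L * k)).+1)) => //.
apply: ordge_mono_ideal => // i; rewrite exprM; apply: powJ; apply: HL.
by apply: ordgeXn; exact: ordge_X.
Qed.

Section QuotDim.
Variables (R : realType) (K : fieldType) (V : lmodType K) (I : set V).
Hypothesis sI : subsp I.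

Lemma has_quot_dim_uniq k l : has_quot_dim I k -> has_quot_dim I l -> k = l.
Proof.
move=> [v [iv sv]] [w [iw sw]]; apply/eqP; rewrite eqn_leq.
have := indep_le_spans sI iv sw; have := indep_le_spans sI iw sv.
by rewrite !card_ord => -> ->.
Qed.

Lemma quot_dimE k : has_quot_dim I k -> quot_dim R I = (k%:R)%:E.
Proof.
move=> Ik; rewrite /quot_dim asboolT; last by exists k.
by rewrite (@has_quot_dim_uniq (xget 0%N [set k | has_quot_dim I k]) k) //; exact: (xgetI 0%N Ik).
Qed.

Lemma quot_dim_lty : (quot_dim R I < +oo)%E -> exists k, has_quot_dim I k.
Proof. by rewrite /quot_dim; case: asboolP. Qed.

End QuotDim.

Section Singularities.
Variables (R : realType) (d : nat).
Local Notation S := (fps d R[i]).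
Implicit Types f : S.

Lemma isolatedP f : isolated_hypersurface_sing f <-> ordge 2 f /\
  exists tau, has_quot_dim (idl (fcons f (fun i => fps_deriv i f))) tau.
Proof.
rewrite /isolated_hypersurface_sing /max_ideal max_ideal_powE /tjurina /tjurina_ideal ideal_gen_cons.
have sI := ideal_subsp (idl_ideal (fcons f (fun i => fps_deriv i f))).
split=> -[ord2]; first by move/quot_dim_lty.
by move=> [tau /(quot_dimE R sI) ->]; split=> //; exact: ltry.
Qed.

(** The Tjurina ideal lies in the maximal ideal, so the ratio has a nonzero denominator. *)
Lemma tjurina_gt0 f tau : ordge 2 f -> has_quot_dim (idl (fcons f (fun i => fps_deriv i f))) tau -> (0 < tau)%N.
Proof.
move=> ord2 [v [_ sv]]; rewrite lt0n; apply/eqP => t0.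
have [c] := sv 1; rewrite big1 ?subr0; last by move=> i _; have := ltn_ord i; rewrite {2}t0 ltn0.
have : idl (fcons f (fun i => fps_deriv i f)) `<=` [set h : S | ordge 1 h].
  apply: idl_min; first exact: ordge_ideal.
  by apply: fcons_ind => [|i]; [exact: ordgeW ord2 | exact: ordge_deriv].
by move=> H /H /ordge1P /eqP; rewrite fcoef1 eqxx oner_eq0.
Qed.

Lemma mu_tau_ratio f : (0 < d)%N -> isolated_hypersurface_sing f ->
  exists mu tau, [/\ has_quot_dim (idl (fun i => fps_deriv i f)) mu,
    has_quot_dim (idl (fcons f (fun i => fps_deriv i f))) tau, (0 < tau)%N,
    (milnor f / tjurina f)%E = (mu%:R / tau%:R)%:E & mu%:R / tau%:R <= mu_tau_bound R d].
Proof.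
move=> d0 /isolatedP[ord2 [tau Itau]]; have ord1 : ordge 1 f by exact: ordgeW ord2.
have [w [iw sw]] := Itau; have [mu Jmu] := milnor_finite ord1 sw.
have tau0 := tjurina_gt0 ord2 Itau; exists mu, tau; split=> //.
  have sI := ideal_subsp (idl_ideal (fcons f (fun i => fps_deriv i f))).
  have sJ := ideal_subsp (idl_ideal (fun i => fps_deriv i f)).
  rewrite /milnor /jacobian_ideal /tjurina /tjurina_ideal ideal_gen_cons ideal_gen_range.
  by rewrite (quot_dimE R sI Itau) (quot_dimE R sJ Jmu) inver pnatr_eq0 gtn_eqF // -EFinM.
have [v bv] := Jmu; have le := mu_window_le R d0 ord1 bv sw.
by rewrite mu_tau_boundE // ler_pdivrMr ?ltr0n // mulrC ler_pdivlMr ?window_gt0.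
Qed.

End Singularities.

(** * The limit of the ratio along the family *)

Section FamilyLimit.
Variables (R : realType) (d : nat).
Hypothesis d0 : (0 < d)%N.
Local Notation K := (R[i]).

Lemma family_ordge_eq (F : numFieldType) a k : (0 < a)%N -> ordge k (family d F a) <-> (k <= a.+1)%N.
Proof.
move=> a0; split=> [H|le]; last first.
  apply: ordgeD; first by apply: ordge_sum => i _; apply: ordgeW le _; apply: ordgeXn; exact: ordge_X.
  by apply: (ordgeW (leq_trans le (leqnSn _))); apply: ordgeXn; exact: sumX_ord.
rewrite leqNgt; apply/negP => lt.
pose m := mnm_muln (mnm1 (Ordinal d0)) a.+1.
have dm : mdeg m = a.+1 by rewrite mdegMn mdeg1 mul1n.
have := H m; rewrite dm => /(_ lt); rewrite /family fcoefD.
rewrite [X in _ + X](_ : _ = 0) ?addr0; last by apply: (@ordgeXn d F a.+2); [exact: sumX_ord | rewrite dm].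
rewrite fcoef_sum (bigD1 (Ordinal d0)) //=.
rewrite fmonXn fcoef_mon eqxx big1 ?addr0 => [/eqP|i ni]; first by rewrite oner_eq0.
rewrite fmonXn fcoef_mon; case: eqP => // /(congr1 (fun m : multinom d => m (Ordinal d0))).
by rewrite !mulmnE !mnm1E eqxx (negbTE ni) mul0n mul1n.
Qed.

Lemma family_isolated a : (0 < a)%N -> isolated_hypersurface_sing (family d K a).
Proof.
move=> a0; apply/isolatedP; split; first by apply/family_ordge_eq.
apply: (has_quot_dim_ordge (M := (d * a).+1)) => [|h oh]; first exact: idl_ideal.
by apply: jacobian_sub_tjurina; exact: family_ordge.
Qed.

Lemma family_multiplicity a : (0 < a)%N -> multiplicity (family d K a) = a.+1.
Proof.
move=> a0; rewrite /multiplicity /max_ideal.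
set P := [set m | _].
have PE m : P m -> m = a.+1.
  rewrite /P /= max_ideal_powE /= => -[/(@family_ordge_eq _ a m a0) le H].
  apply/eqP; rewrite eqn_leq le /=; apply: H; rewrite max_ideal_powE.
  exact/(@family_ordge_eq _ a a.+1 a0).
apply: PE; apply: (@xgetI _ 0%N P a.+1); rewrite /P /=; split.
  by rewrite max_ideal_powE; exact/(@family_ordge_eq _ a a.+1 a0).
by move=> k; rewrite max_ideal_powE => /(@family_ordge_eq _ a k a0).
Qed.

Lemma family_ratio_ge a mu tau : (0 < a)%N ->
    has_quot_dim (idl (fun i => fps_deriv i (family d K a))) mu ->
    has_quot_dim (idl (fcons (family d K a) (fun i => fps_deriv i (family d K a)))) tau ->
  let u := ((d * a.-1 + a.+2)./2).+1 in
  (a ^ d <= mu)%N /\ (tau + #|box d a (u - a.+2)| <= #|box d a u|)%N.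
Proof.
move=> a0 [v [_ sv]] [w [iw _]] u; split.
  by apply: (pow_le_milnor R d0 _ sv) => i; exact: family_deriv_ordge.
apply: leq_trans (@family_count d K a a0); rewrite leq_add2r.
have := indep_le_spans (ideal_subsp (idl_ideal _)) iw (@family_spans d K a a0).
by rewrite card_ord.
Qed.

(** The slab has width [p + 2] and is centred up to a shift bounded in terms of [d], so it has the
    same limit as the central slab of width [p]. *)
Lemma family_window_cvg :
  let u p := ((d * p.-1 + p.+2)./2).+1 in
  ((#|box d p (u p)|)%:R - (#|box d p (u p - p.+2)|)%:R) / p%:R ^+ d @[p --> \oo] --> window R d.
Proof.
move=> u; apply: (@window_cvg R d (d + 2) (fun p => (u p - p.+2)%N) u d0) => p.
all: have e1 : (d.-1 * p = d * p - p)%N by rewrite -subn1 mulnBl mul1n.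
all: have e2 : (d * p.-1 = d * p - d)%N by rewrite -subn1 mulnBr muln1.
all: have e3 : (p <= d * p)%N by rewrite leq_pmull.
all: have e4 : p = 0%N \/ (d <= d * p)%N by case: (p) => [|q]; [left | right; rewrite mulnS leq_addr].
all: rewrite /u /lower_cut ?e1 e2; move: (d * p)%N e3 e4 => q e3 e4; split; lia.
Qed.

Lemma family_ratio_cvg :
  (milnor (family d K n.+1) / tjurina (family d K n.+1))%E @[n --> \oo] --> (mu_tau_bound R d)%:E.
Proof.
have H n := mu_tau_ratio d0 (@family_isolated n.+1 (ltn0Sn n)).
have [mu Hmu] := choice H; have [tau {}H] := choice Hmu => {Hmu}.
under eq_fun => n do have [_ _ _ -> _] := H n.
apply: cvg_EFin; first exact: nearW.
pose u p := ((d * p.-1 + p.+2)./2).+1.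
pose B p : R := (#|box d p (u p)|)%:R - (#|box d p (u p - p.+2)|)%:R.
have lo : (B n.+1 / n.+1%:R ^+ d)^-1 @[n --> \oo] --> mu_tau_bound R d.
  rewrite mu_tau_boundE //; apply: cvgV; first by rewrite gt_eqF ?window_gt0.
  have W : B p / p%:R ^+ d @[p --> \oo] --> window R d := family_window_cvg.
  by rewrite -(cvg_shiftS (fun p => B p / p%:R ^+ d)) in W.
(* With [p = n + 1], the ratio lies between [p^d / B p] and the bound itself. *)
apply: (squeeze_cvgr _ lo (@cvg_cst _ (mu_tau_bound R d) _ _ _)); near=> n.
have [Jmu Itau tau0 _ le] := H n; rewrite /= le andbT.
have [h1 h2] := family_ratio_ge (ltn0Sn n) Jmu Itau.
rewrite invf_div; have t0 : 0 < (tau n)%:R :> R by rewrite ltr0n.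
have h3 : (tau n)%:R <= B n.+1 by rewrite lerBrDr -natrD ler_nat.
apply: ler_pM; rewrite ?invr_ge0 ?exprn_ge0 ?(le_trans _ h3) ?ler0n //.
  by rewrite -natrX ler_nat.
by rewrite lef_pV2 // posrE // (lt_le_trans t0).
Unshelve. all: by end_near.
Qed.

End FamilyLimit.

Theorem corollary5p4 (R : realType) (d : nat) (hd : (1 <= d)%N) :
  [/\ exists q : rat, mu_tau_bound R d = ratr q,
      forall f : fps d R[i], isolated_hypersurface_sing f ->
        (milnor f / tjurina f <= (mu_tau_bound R d)%:E)%E
    & exists F : nat -> fps d R[i],
        [/\ forall n, isolated_hypersurface_sing (F n),
            multiplicity (F n) @[n --> \oo] --> \oo
          & (milnor (F n) / tjurina (F n))%E @[n --> \oo]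
              --> (mu_tau_bound R d)%:E]].
Proof.
split.
- exact: mu_tau_bound_rat.
- by move=> f /(mu_tau_ratio hd)[mu [tau [_ _ _ -> le]]]; rewrite lee_fin.
exists (fun n => family d R[i] n.+1); split.
- by move=> n; exact: family_isolated.
- apply/cvgnyPge => A; near=> n; rewrite family_multiplicity //.
  by apply: (@leq_trans n); [near: n; exact: nbhs_infty_ge | lia].
- exact: family_ratio_cvg.
Unshelve. all: by end_near.
Qed.
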